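(* Let $m,n,p,q$ be positive integers. Consider Bayesian error-in-variable regression with additional error in the responses and classical errors in the features: for $i=1,\ldots,n$, independently, $$Y_i\mid\mathcal{V}_i\sim N_m(\mathcal{V}_i,U_i),\qquad \mathcal{V}_i\mid\mathcal{A}_i,\theta,\beta,\Sigma\sim N_m(\Theta^TZ_i+\mathcal{B}^T\mathcal{A}_i,\Sigma),\qquad X_i\mid\mathcal{A}_i\sim N_p(\mathcal{A}_i,V_i),$$ with known symmetric positive-definite (SPD) $U_i\in\mathbb{R}^{m\times m}$, $V_i\in\mathbb{R}^{p\times p}$ and fixed known $Z_i\in\mathbb{R}^q$, and independent priors $\mathcal{A}_i\sim N_p(k_i,K_i)$, $\Sigma\sim\mathcal{W}^{-1}(a_0,B_0)$, $(\theta,\beta)^T\sim N_{m(q+p)}(j_0,J_0)$, where $k_i\in\mathbb{R}^p$, $K_i\in\mathbb{R}^{p\times p}$ is SPD, $a_0\ge m$ is an integer, $B_0\in\mathbb{R}^{m\times m}$ is SPD, $j_0\in\mathbb{R}^{m(q+p)}$ and $J_0\in\mathbb{R}^{m(q+p)\times m(q+p)}$ is SPD. Write $\mathcal{V}=(\mathcal{V}_1,\ldots,\mathcal{V}_n)^T\in\mathbb{R}^{n\times m}$ and $\nu=\mathrm{vec}(\mathcal{V})$. Given any observed data $y_i\in\mathbb{R}^m$, $x_i\in\mathbb{R}^p$, $i=1,\ldots,n$, the posterior density is $$\pi_n(\mathcal{A},\nu,\theta,\beta,\Sigma)\propto\det(\Sigma)^{-(n+a_0+m+1)/2}\exp\Big[-\tfrac12\mathrm{tr}(\Sigma^{-1}B_0)-\tfrac12\sum_{i=1}^n(\mathcal{V}_i-\Theta^TZ_i-\mathcal{B}^T\mathcal{A}_i)^T\Sigma^{-1}(\mathcal{V}_i-\Theta^TZ_i-\mathcal{B}^T\mathcal{A}_i)\Big]$$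 $$\times\exp\Big[-\tfrac12\sum_{i=1}^n(\mathcal{V}_i-y_i)^TU_i^{-1}(\mathcal{V}_i-y_i)-\tfrac12\sum_{i=1}^n(\mathcal{A}_i-k_i')^T(V_i^{-1}+K_i^{-1})(\mathcal{A}_i-k_i')-\tfrac12((\theta,\beta)^T-j_0)^TJ_0^{-1}((\theta,\beta)^T-j_0)\Big],$$ where $k_i'=(V_i^{-1}+K_i^{-1})^{-1}[V_i^{-1}x_i+K_i^{-1}k_i]$. Then the 3-variable deterministic scan Gibbs sampler $(\mathcal{A}_t,\nu_t,\theta_t,\beta_t,\Sigma_t)_{t\ge0}$ for this posterior, which at each step $t\ge1$ generates $\Sigma_t\sim\pi_n(\cdot\mid\mathcal{A}_{t-1},\nu_{t-1},\theta_{t-1},\beta_{t-1})$, then $(\nu_t,\theta_t,\beta_t)\sim\pi_n(\cdot\mid\mathcal{A}_{t-1},\Sigma_t)$ jointly, then $\mathcal{A}_t\sim\pi_n(\cdot\mid\nu_t,\theta_t,\beta_t,\Sigma_t)$, is geometrically ergodic.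
   Context: Here $\mathcal{A}=(\mathcal{A}_1,\ldots,\mathcal{A}_n)^T\in\mathbb{R}^{n\times p}$, $\theta=\mathrm{vec}(\Theta)$ with $\Theta\in\mathbb{R}^{q\times m}$, $\beta=\mathrm{vec}(\mathcal{B})$ with $\mathcal{B}\in\mathbb{R}^{p\times m}$, $\Sigma\in\mathbb{R}^{m\times m}$ is SPD, $\mathrm{vec}$ stacks the columns of a matrix, and $(\theta,\beta)^T$ is the concatenated column vector. $N_d(\mu,C)$ is the $d$-dimensional normal distribution; $\mathcal{W}^{-1}(\kappa,S)$ is the inverse-Wishart distribution on SPD $m\times m$ matrices with density proportional to $\det(\Sigma)^{-(\kappa+m+1)/2}\exp(-\tfrac12\mathrm{tr}(\Sigma^{-1}S))$. Densities are with respect to Lebesgue measure (for $\Sigma$: on the open cone of SPD matrices in the symmetric matrices). The conditional densities $\pi_n(\cdot\mid\cdot)$ are the full conditionals obtained by normalizing $\pi_n$ in the indicated block with the other variables fixed (inverse-Wishart for $\Sigma$, Gaussian for the other two blocks). Let $P$ be the Markov transition kernel of the chain, $P^t$ its $t$-step iterate, and $\Pi_n$ the probability measure with density $\pi_n$. The chain is called geometrically ergodic if there are $\rho\in(0,1)$ and a function $M$ from the state space to $[0,\infty)$ such that for every initial state $s=(\mathcal{A},\nu,\theta,\beta,\Sigma)$ and every $t\ge1$, $\sup_B|P^t(s,B)-\Pi_n(B)|\le M(s)\rho^t$, the supremum being over Borel sets $B$. *)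

(* Defs.v *)
From HB Require Import structures.
From mathcomp Require Import all_boot all_order all_algebra.
From mathcomp Require Import all_classical all_reals all_analysis.

Set Implicit Arguments.
Unset Strict Implicit.
Unset Printing Implicit Defensive.

Import Order.TTheory GRing.Theory Num.Theory.
Import numFieldNormedType.Exports.

Local Open Scope classical_set_scope.
Local Open Scope ring_scope.

Definition measure_matrix_display : measure_display -> measure_display.
Proof. exact. Qed.

(* The sigma-algebra generated by the entries; for real matrices this is the
   Borel sigma-algebra of R^(a * b). *)
Section measurable_matrix.
Context {d} {T : sigmaRingType d}.
Variables a b : nat.

Let coors : 'I_(a * b) -> 'M[T]_(a, b) -> T := fun i A => mxvec A ord0 i.

Let mx_set0 : g_sigma_preimage coors set0.
Proof. exact: sigma_algebra0. Qed.

Let mx_setC A : g_sigma_preimage coors A -> g_sigma_preimage coors (~` A).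
Proof. exact: sigma_algebraC. Qed.

Let mx_bigcup (F : (set 'M[T]_(a, b))^nat) :
  (forall i, g_sigma_preimage coors (F i)) ->
  g_sigma_preimage coors (\bigcup_i (F i)).
Proof. exact: sigma_algebra_bigcup. Qed.

HB.instance Definition _ := @isMeasurable.Build
  (measure_matrix_display d)
  'M[T]_(a, b) (g_sigma_preimage coors) mx_set0 mx_setC mx_bigcup.

End measurable_matrix.

Section measurable_matrix_lemmas.
Context d (T : measurableType d) (a b : nat).

Lemma measurable_mxentry (i : 'I_a) (j : 'I_b) :
  measurable_fun [set: 'M[T]_(a, b)] (fun A => A i j).
Proof.
move=> _ Y mY; rewrite setTI; apply: sub_sigma_algebra => /=.
rewrite -bigcup_seq/=; exists (mxvec_index i j).
  by rewrite /= mem_index_enum.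
by exists Y => //; rewrite setTI; apply/seteqP; split => A /=; rewrite mxvecE.
Qed.

Lemma measurable_fun_mx d1 (T1 : measurableType d1) (f : T1 -> 'M[T]_(a, b)) :
  (forall i j, measurable_fun [set: T1] (fun x => f x i j)) ->
  measurable_fun [set: T1] f.
Proof.
move=> mf _ Y mY; rewrite setTI.
pose F := [set B : set 'M[T]_(a, b) | measurable (f @^-1` B)].
apply: (mY F); split.
  split => [|A|A].
  - by rewrite /F /= preimage_set0.
  - by rewrite /F /= setTD -preimage_setC => /measurableC.
  - by move=> mA; rewrite /F /= preimage_bigcup; exact: bigcupT_measurable.
move=> A; rewrite -bigcup_seq => -[k _ [B mB <-]].
rewrite /F /= setTI; case/mxvec_indexP: k => i j.
suff -> : f @^-1` ((fun A => mxvec A ord0 (mxvec_index i j)) @^-1` B) =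
    (fun x => f x i j) @^-1` B by rewrite -[X in measurable X]setTI; exact: mf.
by apply/seteqP; split => x /=; rewrite mxvecE.
Qed.

End measurable_matrix_lemmas.

(* Image of a sigma-finite measure under a measurable f with a measurable left
   inverse g; the last arguments only serve to equip it with the structure of
   sigma-finite measure. *)
Section embed_measure.
Local Open Scope ereal_scope.
Context d1 d2 (T1 : measurableType d1) (T2 : measurableType d2) (R : realType).
Variables (mu : {sigma_finite_measure set T1 -> \bar R}).
Variables (f : T1 -> T2) (g : T2 -> T1).
Hypotheses (mf : measurable_fun [set: T1] f) (mg : measurable_fun [set: T2] g).
Hypothesis fK : cancel f g.

Definition embed_measure of measurable_fun [set: T1] f &
  measurable_fun [set: T2] g & cancel f g : set T2 -> \bar R :=
  pushforward mu f.

Local Notation emu := (embed_measure mf mg fK).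

Let mpre A : measurable A -> measurable (f @^-1` A).
Proof. by move=> mA; rewrite -[X in measurable X]setTI; exact: mf. Qed.

Let emu0 : emu set0 = 0.
Proof. by rewrite /embed_measure /pushforward preimage_set0 measure0. Qed.

Let emu_ge0 A : 0 <= emu A.
Proof. exact: measure_ge0. Qed.

Let emu_sigma_additive : semi_sigma_additive emu.
Proof.
move=> F mF tF mUF; rewrite /embed_measure /pushforward preimage_bigcup.
apply: measure_semi_sigma_additive.
- by move=> n; exact: mpre.
- apply/trivIsetP => /= i j _ _ ij; rewrite -preimage_setI.
  by move/trivIsetP : tF => /(_ _ _ _ _ ij) ->//; rewrite preimage_set0.
- by rewrite -preimage_bigcup; exact: mpre.
Qed.

HB.instance Definition _ := isMeasure.Build _ _ _ emu
  emu0 emu_ge0 emu_sigma_additive.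

Let emu_sigma_finite : sigma_finite [set: T2] emu.
Proof.
have [F FT Ffin] := @sigma_finiteT _ _ _ mu.
exists (fun i => g @^-1` F i).
  by rewrite -preimage_bigcup -FT preimage_setT.
move=> i; have [mFi Fioo] := Ffin i; split.
  by rewrite -[X in measurable X]setTI; exact: mg.
rewrite /embed_measure /pushforward (_ : f @^-1` _ = F i)//.
by apply/seteqP; split => x /=; rewrite fK.
Qed.

HB.instance Definition _ := Measure_isSigmaFinite.Build _ _ _ emu
  emu_sigma_finite.

End embed_measure.

(* The product measure of two sigma-finite measures, as a sigma-finite measure;
   the canonical structures of \x only infer this for subprobabilities. *)
Section sfprod.
Local Open Scope ereal_scope.
Context d1 d2 (T1 : measurableType d1) (T2 : measurableType d2) (R : realType).
Variables (m1 : {sigma_finite_measure set T1 -> \bar R}).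
Variables (m2 : {sigma_finite_measure set T2 -> \bar R}).

Definition sfprod : set (T1 * T2) -> \bar R := m1 \x m2.

HB.instance Definition _ := Measure.copy sfprod (m1 \x m2).

Let sfprod_sigma_finite : sigma_finite [set: T1 * T2] sfprod.
Proof.
have /sigma_finiteP[F [TF ndF Foo]] := sigma_finiteT m1.
have /sigma_finiteP[G [TG ndG Goo]] := sigma_finiteT m2.
exists (fun n => F n `*` G n).
  rewrite -setXTT TF TG predeqE => -[x y]; split.
    move=> [/= [n _ Fnx] [k _ Gky]]; exists (maxn n k) => //; split.
    - by move: x Fnx; exact/subsetPset/ndF/leq_maxl.
    - by move: y Gky; exact/subsetPset/ndG/leq_maxr.
  by move=> [n _ []/= ? ?]; split; exists n.
move=> k; have [? ?] := Foo k; have [? ?] := Goo k.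
split; first exact: measurableX.
by rewrite /sfprod product_measure1E// lte_mul_pinfty// ge0_fin_numE.
Qed.

HB.instance Definition _ := Measure_isSigmaFinite.Build _ _ _ sfprod
  sfprod_sigma_finite.

End sfprod.

(* Lebesgue measure on R^d, with R^d represented by d.-tuple R *)
Section lebesgue_tuple.
Local Open Scope ereal_scope.
Context (R : realType).

Definition cons_pair d (x : measurableTypeR R * d.-tuple R) : d.+1.-tuple R :=
  [the d.+1.-tuple R of x.1 :: x.2].

Definition uncons_pair d (t : d.+1.-tuple R) : measurableTypeR R * d.-tuple R :=
  (thead t, [tuple of behead t]).

Lemma measurable_cons_pair d : measurable_fun setT (@cons_pair d).
Proof. exact: (measurable_cons (f := fst) (g := snd)). Qed.

Lemma measurable_uncons_pair d : measurable_fun setT (@uncons_pair d).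
Proof.
apply/measurable_fun_pairP; split; last exact: measurable_behead.
exact: (@measurable_tnth _ R).
Qed.

Lemma cons_pairK d : cancel (@cons_pair d) (@uncons_pair d).
Proof.
move=> [x t]; rewrite /cons_pair /uncons_pair /=.
by congr pair => //; apply: val_inj.
Qed.

Fixpoint lebesgue_tuple d : {sigma_finite_measure set (d.-tuple R) -> \bar R} :=
  match d with
  | 0 => [the {sigma_finite_measure set _ -> \bar R} of
           @dirac _ (0.-tuple R) [tuple] R]
  | d'.+1 => [the {sigma_finite_measure set _ -> \bar R} of
      embed_measure [the {sigma_finite_measure set _ -> \bar R} of
          sfprod (@lebesgue_measure R) (lebesgue_tuple d')]
        (@measurable_cons_pair d') (@measurable_uncons_pair d') (@cons_pairK d')]
  end.

End lebesgue_tuple.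

Section lebesgue_matrix.
Local Open Scope ereal_scope.
Context (R : realType).

Section rectangular.
Variables a b : nat.

Definition mx_of_tuple (t : (a * b).-tuple R) : 'M[R]_(a, b) :=
  \matrix_(i, j) tnth t (mxvec_index i j).

Definition tuple_of_mx (A : 'M[R]_(a, b)) : (a * b).-tuple R :=
  [tuple mxvec A ord0 k | k < a * b].

Lemma measurable_mx_of_tuple : measurable_fun setT mx_of_tuple.
Proof.
apply: measurable_fun_mx => i j; under eq_fun do rewrite mxE.
exact: measurable_tnth.
Qed.

Lemma measurable_tuple_of_mx : measurable_fun setT tuple_of_mx.
Proof.
apply/measurable_fun_tnthP => k; case/mxvec_indexP: k => i j.
rewrite (_ : _ \o _ = fun A : 'M[R]_(a, b) => A i j).
  exact: measurable_mxentry.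
by apply/funext => A /=; rewrite tnth_mktuple mxvecE.
Qed.

Lemma mx_of_tupleK : cancel mx_of_tuple tuple_of_mx.
Proof.
move=> t; apply: eq_from_tnth => k; case/mxvec_indexP: k => i j.
by rewrite tnth_mktuple mxvecE mxE.
Qed.

Definition lebesgue_mx : {sigma_finite_measure set 'M[R]_(a, b) -> \bar R} :=
  [the {sigma_finite_measure set _ -> \bar R} of
    embed_measure (lebesgue_tuple R (a * b))
      measurable_mx_of_tuple measurable_tuple_of_mx mx_of_tupleK].

End rectangular.

(* The coordinates of a symmetric matrix are its entries (i, j) with i <= j;
   lebesgue_sym is the Lebesgue measure on these m(m+1)/2 coordinates, seen as
   a measure on 'M_m carried by the symmetric matrices. *)
Section symmetric.
Variable m : nat.

Definition sym_idx := {ij : 'I_m * 'I_m | (ij.1 <= ij.2)%N}.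

Lemma sym_pair_proof (i j : 'I_m) :
  let ij := if (i <= j)%N then (i, j) else (j, i) in (ij.1 <= ij.2)%N.
Proof. by rewrite /=; case: (leqP i j) => [//|/ltnW]. Qed.

Definition sym_pair (i j : 'I_m) : sym_idx :=
  exist _ (if (i <= j)%N then (i, j) else (j, i)) (sym_pair_proof i j).

Definition sym_of_tuple (t : #|{: sym_idx}|.-tuple R) : 'M[R]_m :=
  \matrix_(i, j) tnth t (enum_rank (sym_pair i j)).

Definition tuple_of_sym (A : 'M[R]_m) : #|{: sym_idx}|.-tuple R :=
  [tuple A (val (enum_val k)).1 (val (enum_val k)).2 | k < #|{: sym_idx}|].

Lemma sym_of_tuple_sym t : (sym_of_tuple t)^T = sym_of_tuple t.
Proof.
apply/matrixP => i j; rewrite !mxE; congr (tnth t (enum_rank _)).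
apply: val_inj => /=; case: (ltngtP i j) => // ij.
by have -> : i = j by apply: val_inj.
Qed.

Lemma measurable_sym_of_tuple : measurable_fun setT sym_of_tuple.
Proof.
apply: measurable_fun_mx => i j.
have -> : (fun t => sym_of_tuple t i j) =
    (fun t => tnth t (enum_rank (sym_pair i j))).
  by apply/funext => t; rewrite /sym_of_tuple mxE.
exact: measurable_tnth.
Qed.

Lemma measurable_tuple_of_sym : measurable_fun setT tuple_of_sym.
Proof.
apply/measurable_fun_tnthP => k.
rewrite (_ : _ \o _ =
    fun A : 'M[R]_m => A (val (enum_val k)).1 (val (enum_val k)).2).
  exact: measurable_mxentry.
by apply/funext => A /=; rewrite tnth_mktuple.
Qed.

Lemma sym_of_tupleK : cancel sym_of_tuple tuple_of_sym.
Proof.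
move=> t; apply: eq_from_tnth => k; rewrite tnth_mktuple mxE.
congr (tnth t _); rewrite -[RHS]enum_valK; congr enum_rank.
by apply: val_inj => /=; case: (enum_val k) => -[i j] /= ->.
Qed.

Definition lebesgue_sym : {sigma_finite_measure set 'M[R]_m -> \bar R} :=
  [the {sigma_finite_measure set _ -> \bar R} of
    embed_measure (lebesgue_tuple R #|{: sym_idx}|)
      measurable_sym_of_tuple measurable_tuple_of_sym sym_of_tupleK].

End symmetric.
End lebesgue_matrix.

Section vectorization.
Context (T : Type) (a b : nat).

(* mxvec lists the entries row by row, hence the transposition *)
Definition vec (A : 'M[T]_(a, b)) : 'cV[T]_(b * a) := (mxvec A^T)^T.

Definition unvec (v : 'cV[T]_(b * a)) : 'M[T]_(a, b) := (vec_mx v^T)^T.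

Lemma vecK : cancel vec unvec.
Proof. by move=> A; rewrite /unvec /vec !trmxK mxvecK trmxK. Qed.

Lemma unvecK : cancel unvec vec.
Proof. by move=> v; rewrite /unvec /vec trmxK vec_mxK trmxK. Qed.

End vectorization.

Section densities.
Context {R : realType}.

Definition qform d (M : 'M[R]_d) (v : 'cV[R]_d) : R := (v^T *m M *m v) ord0 ord0.

Definition spd d : set 'M[R]_d :=
  [set M | M^T = M /\ forall v : 'cV[R]_d, v != 0 -> 0 < qform M v].

Definition normal_mx_pdf d (mu : 'cV[R]_d) (C : 'M[R]_d) (v : 'cV[R]_d) : R :=
  (Num.sqrt ((2 * pi) ^+ d * \det C))^-1 *
  expR (- (qform (invmx C) (v - mu) / 2)).

Definition inv_wishart_fun m (kappa : nat) (S : 'M[R]_m) (Sigma : 'M[R]_m) : R :=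
  (\det Sigma) `^ (- ((kappa + m + 1)%:R / 2)) *
  expR (- (\tr (invmx Sigma *m S) / 2)).

Definition inv_wishart_pdf m (kappa : nat) (S : 'M[R]_m) (Sigma : 'M[R]_m) : R :=
  inv_wishart_fun kappa S Sigma /
  fine (\int[lebesgue_sym R m]_(T in @spd m) (inv_wishart_fun kappa S T)%:E)%E.

End densities.

Section state_space.
Context (R : realType) (m n p q : nat).

(* (nu, theta, beta) *)
Definition regression_block : Type :=
  ('cV[R]_(m * n) * 'cV[R]_(m * q) * 'cV[R]_(m * p))%type.

(* (A, (nu, theta, beta), Sigma); the chain lives on the subset state_space *)
Definition state : Type := ('M[R]_(n, p) * regression_block * 'M[R]_m)%type.

Definition state_space : set state := [set s | spd s.2].

Definition lebesgue_block : {sigma_finite_measure set regression_block -> \bar R} :=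
  [the {sigma_finite_measure set _ -> \bar R} of
    sfprod [the {sigma_finite_measure set _ -> \bar R} of
        sfprod (lebesgue_mx R (m * n) 1) (lebesgue_mx R (m * q) 1)]
      (lebesgue_mx R (m * p) 1)].

Definition lebesgue_state : {sigma_finite_measure set state -> \bar R} :=
  [the {sigma_finite_measure set _ -> \bar R} of
    sfprod [the {sigma_finite_measure set _ -> \bar R} of
        sfprod (lebesgue_mx R n p) lebesgue_block]
      (lebesgue_sym R m)].

End state_space.
Arguments state_space {R m n p q}.

Section bayesian_model.
Context {R : realType} {m n p q : nat}.
Variables (U : 'I_n -> 'M[R]_m) (V : 'I_n -> 'M[R]_p) (Z : 'I_n -> 'cV[R]_q).
Variables (k : 'I_n -> 'cV[R]_p) (K : 'I_n -> 'M[R]_p).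
Variables (a0 : nat) (B0 : 'M[R]_m).
Variables (j0 : 'cV[R]_(m * q + m * p)) (J0 : 'M[R]_(m * q + m * p)).
Variables (y : 'I_n -> 'cV[R]_m) (x : 'I_n -> 'cV[R]_p).

Definition feature (A : 'M[R]_(n, p)) (i : 'I_n) : 'cV[R]_p := (row i A)^T.

Definition latent_response (nu : 'cV[R]_(m * n)) (i : 'I_n) : 'cV[R]_m :=
  (row i (unvec nu : 'M[R]_(n, m)))^T.

Definition regression_mean (A : 'M[R]_(n, p)) (theta : 'cV[R]_(m * q))
    (beta : 'cV[R]_(m * p)) (i : 'I_n) : 'cV[R]_m :=
  (unvec theta : 'M[R]_(q, m))^T *m Z i +
  (unvec beta : 'M[R]_(p, m))^T *m feature A i.

(* likelihood times prior, as a function of the parameters *)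
Definition joint_pdf (s : state R m n p q) : R :=
  let: (A, (nu, theta, beta), Sigma) := s in
  (\prod_(i < n)
     (normal_mx_pdf (latent_response nu i) (U i) (y i) *
      normal_mx_pdf (regression_mean A theta beta i) Sigma
        (latent_response nu i) *
      normal_mx_pdf (feature A i) (V i) (x i) *
      normal_mx_pdf (k i) (K i) (feature A i))) *
  inv_wishart_pdf a0 B0 Sigma *
  normal_mx_pdf j0 J0 (col_mx theta beta).

Definition posterior_pdf (s : state R m n p q) : R :=
  joint_pdf s /
  fine (\int[lebesgue_state R m n p q]_(s' in state_space)
    (joint_pdf s')%:E)%E.

Definition updated_precision (i : 'I_n) : 'M[R]_p := invmx (V i) + invmx (K i).

Definition updated_mean (i : 'I_n) : 'cV[R]_p :=
  invmx (updated_precision i) *m (invmx (V i) *m x i + invmx (K i) *m k i).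

Definition posterior_fun (s : state R m n p q) : R :=
  let: (A, (nu, theta, beta), Sigma) := s in
  (\det Sigma) `^ (- ((n + a0 + m + 1)%:R / 2)) *
  expR (- (\tr (invmx Sigma *m B0) / 2)
        - (\sum_(i < n) qform (invmx Sigma)
             (latent_response nu i - regression_mean A theta beta i)) / 2) *
  expR (- (\sum_(i < n) qform (invmx (U i)) (latent_response nu i - y i)) / 2
        - (\sum_(i < n) qform (updated_precision i)
             (feature A i - updated_mean i)) / 2
        - qform (invmx J0) (col_mx theta beta - j0) / 2).

End bayesian_model.

Section gibbs_sampler.
Local Open Scope ereal_scope.
Context {R : realType} {m n p q : nat}.
Variable dens : state R m n p q -> R.

Definition cond_Sigma (A : 'M[R]_(n, p)) (w : regression_block R m n p q)
    (Sigma : 'M[R]_m) : R :=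
  (dens (A, w, Sigma) /
   fine (\int[lebesgue_sym R m]_(T in @spd R m) (dens (A, w, T))%:E))%R.

Definition cond_block (A : 'M[R]_(n, p)) (Sigma : 'M[R]_m)
    (w : regression_block R m n p q) : R :=
  (dens (A, w, Sigma) /
   fine (\int[lebesgue_block R m n p q]_w' (dens (A, w', Sigma))%:E))%R.

Definition cond_A (w : regression_block R m n p q) (Sigma : 'M[R]_m)
    (A : 'M[R]_(n, p)) : R :=
  (dens (A, w, Sigma) /
   fine (\int[lebesgue_mx R n p]_A' (dens (A', w, Sigma))%:E))%R.

(* the law of the state (A', w', Sigma') reached in one step from s: first
   Sigma' given (A, w), then w' given (A, Sigma'), then A' given (w', Sigma') *)
Definition gibbs_kernel (s : state R m n p q) (B : set (state R m n p q)) :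
    \bar R :=
  let: (A, w, _) := s in
  \int[lebesgue_sym R m]_(Sigma' in @spd R m)
    ((cond_Sigma A w Sigma')%:E *
     \int[lebesgue_block R m n p q]_w'
       ((cond_block A Sigma' w')%:E *
        \int[lebesgue_mx R n p]_A'
          ((cond_A w' Sigma' A')%:E * (\1_B (A', w', Sigma'))%:E))).

Definition target_measure (B : set (state R m n p q)) : \bar R :=
  \int[lebesgue_state R m n p q]_(s in state_space `&` B) (dens s)%:E.

End gibbs_sampler.

Section geometric_ergodicity.
Local Open Scope ereal_scope.
Context d (T : measurableType d) (R : realType).

Fixpoint kernel_iter (P : T -> set T -> \bar R) (t : nat) (s : T) (B : set T) :
    \bar R :=
  if t is t'.+1 then \int[P s]_s' kernel_iter P t' s' B else \d_s B.

(* E is the state space, as a subset of T *)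
Definition geometrically_ergodic (E : set T) (P : T -> set T -> \bar R)
    (Pi : set T -> \bar R) : Prop :=
  exists (rho : R) (M : T -> R),
    [/\ (0 < rho < 1)%R, (forall s, E s -> 0 <= M s)%R &
      forall s, E s -> forall t, (1 <= t)%N ->
        ereal_sup [set `|kernel_iter P t s B - Pi B| |
                    B in [set B | measurable B /\ B `<=` E]]
          <= (M s * rho ^+ t)%:E].

End geometric_ergodicity.

(* Main.v *)
Require Import Defs.
From HB Require Import structures.
From mathcomp Require Import all_boot all_order all_algebra.
From mathcomp Require Import all_classical all_reals all_analysis.
From mathcomp Require Import measurable_realfun zify ring lra.

(* The chain is uniformly ergodic: it satisfies a Doeblin condition in two
   steps.  The posterior is a product of one factor per block and a coupling
   exp(- E / 2), where E, the sum of the squared Sigma^-1-norms of the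
   residuals, is nonnegative and is bounded on bounded sets.

   Whatever the conditioning variables are, the updates of Sigma and of (nu,
   theta, beta) put mass at least 1/2 on {tr(Sigma^-1 B0) <= r} and on {|nu|^2
   + |theta|^2 + |beta|^2 <= r} respectively, for r large. The tails are
   controlled by dilations: halving Sigma doubles tr(Sigma^-1 B0) and E, and,
   the residuals being linear and homogeneous in (nu, theta, beta), doubling
   this block multiplies E by 4; both moves multiply the density in the tail
   by at most M exp(- kappa r) and Lebesgue measure by a constant, neither
   depending on the conditioning variables. Given such values the update of A
   has a density bounded below on {|A|^2 <= r}, so a bounded set of (A, nu,
   theta, beta) is hit in one step with probability at least delta. From that
   set the transition density dominates a fixed nonzero function, hence the
   oscillation of P^t 1_B contracts by a constant factor every two steps; the
   posterior is invariant by Tonelli's theorem.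

   The posterior is integrable because the inverse-Wishart kernel is, by
   induction on the size of the matrix through Schur complements, and because
   the energies of the other two blocks are coercive. *)

Import Order.TTheory GRing.Theory Num.Theory.
Import numFieldNormedType.Exports.

Local Open Scope classical_set_scope.
Local Open Scope ring_scope.

Set Implicit Arguments.
Unset Strict Implicit.
Unset Printing Implicit Defensive.

(** * Doeblin's condition *)

(** The coupling is not bounded below, so neither the conditional densities nor their normalizing
    constants have uniform lower bounds. A dilation compares one conditional density at two points,
    so its normalizing constant cancels, and the coupling only helps, since both moves increase the
    nonnegative energy E. Doubling would not multiply E by 4 if nu were held fixed while theta and
    beta moved: the residuals would only be affine. The joint update of the three is what the
    argument exploits. For Sigma only an upper bound on tr(Sigma^-1 B0) is required. A large Sigma
    makes E small, so the good set of Sigma may be unbounded; a start with huge residuals, which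
    pushes Sigma to infinity, does no harm. Two steps are used because a step begins with Sigma,
    whose conditional density is bounded below only when A and (nu, theta, beta) are already
    bounded. The first step brings them into a bounded set; the second is then minorized, each
    normalizing constant being bounded above because the coupling is at most 1. *)

Section density_measure.
Local Open Scope ereal_scope.
Context d (T : measurableType d) (R : realType).
Variables (lam : {measure set T -> \bar R}) (g : T -> R).
Hypotheses (mg : measurable_fun [set: T] g) (g0 : forall x, (0 <= g x)%R).

(** The two proofs are arguments of the definition so that the measure structure can be attached to
    the term. *)
Definition density_measure of measurable_fun [set: T] g &
    (forall x, (0 <= g x)%R) : set T -> \bar R :=
  fun B => \int[lam]_(x in B) (g x)%:E.

Local Notation nu := (density_measure mg g0).

Let nu0 : nu set0 = 0.
Proof. exact: integral_set0. Qed.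

Let nu_ge0 B : 0 <= nu B.
Proof. by apply: integral_ge0 => x _; rewrite lee_fin. Qed.

Let nu_sigma_additive : semi_sigma_additive nu.
Proof.
move=> F mF tF mUF; rewrite /density_measure ge0_integral_bigcup//.
- by apply: is_cvg_ereal_nneg_natsum => n _; exact: nu_ge0.
- by apply/measurable_EFinP; exact: measurable_funTS.
- by move=> x _; rewrite lee_fin.
Qed.

HB.instance Definition _ := isMeasure.Build _ _ _ nu
  nu0 nu_ge0 nu_sigma_additive.

Import HBNNSimple.

(** Both sides are limits along simple functions increasing to [h], by monotone convergence. On a
    simple function the identity reduces to indicators, where it is the definition of the
    measure. *)
Lemma integral_density_measure (h : T -> \bar R) :
  measurable_fun [set: T] h -> (forall x, 0 <= h x) ->
  \int[nu]_x h x = \int[lam]_x ((g x)%:E * h x).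
Proof.
move=> mh h0.
pose h_ := nnsfun_approx measurableT mh.
have mEg : measurable_fun [set: T] (EFin \o g) by exact/measurable_EFinP.
have cvgh x : (h_ n x)%:E @[n --> \oo] --> h x by exact: cvg_nnsfun_approx.
transitivity (limn (fun n => \int[nu]_x (h_ n x)%:E)).
  rewrite -monotone_convergence//=.
  - by apply: eq_integral => x _; apply/esym/cvg_lim => //; exact: cvgh.
  - by move=> n; exact/measurable_EFinP.
  - by move=> n x _; rewrite lee_fin.
  - by move=> x _ a b ab; rewrite lee_fin; exact/lefP/nd_nnsfun_approx.
transitivity (limn (fun n => \int[lam]_x ((g x)%:E * (h_ n x)%:E))); last first.
  rewrite -monotone_convergence//=.
  - apply: eq_integral => x _; apply/cvg_lim => //.
    by apply: cvgeZl => //; exact: cvgh.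
  - by move=> n; apply: emeasurable_funM => //; exact/measurable_EFinP.
  - by move=> n x _; rewrite -EFinM lee_fin mulr_ge0.
  - move=> x _ a b ab; apply: lee_wpmul2l; first by rewrite lee_fin.
    by rewrite lee_fin; exact/lefP/nd_nnsfun_approx.
congr (limn _); apply/funext => n.
under [LHS]eq_integral do rewrite fimfunE -fsumEFin//.
rewrite [LHS]ge0_integral_fsum//; last 2 first.
- by move=> r; exact/measurable_EFinP/measurable_funM.
- by move=> r x _; rewrite EFinM nnfun_muleindic_ge0.
under [RHS]eq_integral.
  move=> x _; rewrite fimfunE -fsumEFin// ge0_mule_fsumr; last first.
    by move=> r; rewrite EFinM nnfun_muleindic_ge0.
  over.
rewrite [RHS]ge0_integral_fsum//; last 2 first.
- move=> r; apply/emeasurable_funM => //.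
  by exact/measurable_EFinP/measurable_funM.
- move=> r x _; rewrite mule_ge0 ?lee_fin// -lee_fin EFinM.
  exact: nnfun_muleindic_ge0.
apply: eq_fsbigr => r _; rewrite integralZl_indic_nnsfun// integral_indic//=.
under eq_integral do rewrite EFinM muleCA.
(* The sum ranges over all reals [r]; for a negative one the level set is empty, and otherwise [r]
   can be taken out of the integral. *)
have [r0|r0] := ltP r 0%R.
  rewrite preimage_nnfun0// set0I measure0 mule0 (eq_integral (cst 0))
    ?integral0//.
  by move=> x _; rewrite indicE in_set0 !mule0.
rewrite ge0_integralZl_EFin//; last 2 first.
- by move=> x _; rewrite -EFinM lee_fin mulr_ge0// indicE ler0n.
- by apply: emeasurable_funM => //; exact/measurable_EFinP/measurable_indic.
congr (_ * _); rewrite setIT /density_measure [LHS]integral_mkcond.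
apply: eq_integral => x _; rewrite -EFinM patchE indicE.
by case: ifPn => _; rewrite ?mulr1 ?mulr0.
Qed.

End density_measure.

(** [kernel_iter] integrates against a bare set function. Agreement with a measure on measurable
    sets makes it a measure; nonnegativity is asked of every set because the structure demands it
    there too. *)
Lemma integral_eq_measure d (T : measurableType d) (R : realType)
    (m1 : set T -> \bar R) (m2 : {measure set T -> \bar R}) (f : T -> \bar R) :
    (forall B, 0 <= m1 B)%E -> (forall B, measurable B -> m1 B = m2 B) ->
  (\int[m1]_x f x = \int[m2]_x f x)%E.
Proof.
move=> m1_ge0 m12.
have m10 : m1 set0 = 0%E by rewrite m12// measure0.
have m1_sigma : semi_sigma_additive m1.
  move=> F mF tF mUF; rewrite m12//.
  under eq_fun do under eq_bigr do rewrite m12//.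
  exact: measure_semi_sigma_additive.
pose M1 : {measure set T -> \bar R} :=
  HB.pack m1 (isMeasure.Build _ _ _ m1 m10 m1_ge0 m1_sigma).
by apply: (@eq_measure_integral _ _ _ setT m2 M1) => A mA _; exact: m12.
Qed.

(** * Markov kernels with a density, acting on bounded functions *)

Section density_kernel.
Context d (T : measurableType d) (R : realType).
Variable lam : {sigma_finite_measure set T -> \bar R}.
Variable k : T -> T -> R.
Hypothesis mk : measurable_fun [set: T * T] (fun z => k z.1 z.2).
Hypothesis k0 : forall s s', 0 <= k s s'.
Hypothesis k1 : forall s, (\int[lam]_s' (k s s')%:E = 1)%E.

(** For bounded nonnegative measurable [h] the integral is finite, so [fine] loses nothing
    ([kernel_opE]); all uses stay in that class. *)
Definition kernel_op (h : T -> R) (s : T) : R :=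
  fine (\int[lam]_s' (k s s' * h s')%:E)%E.

Let mks s : measurable_fun [set: T] (k s).
Proof. exact: (measurable_fun_pair2 s mk). Qed.

Let mkh (h : T -> R) s : measurable_fun setT h ->
  measurable_fun [set: T] (fun s' => (k s s' * h s')%:E).
Proof. by move=> mh; apply/measurable_EFinP; exact: measurable_funM. Qed.

Lemma integral_kernel_le (h : T -> R) (b : R) s : measurable_fun setT h ->
  (forall x, 0 <= h x <= b) -> (\int[lam]_s' (k s s' * h s')%:E <= b%:E)%E.
Proof.
move=> mh h0b; have b0 : 0 <= b by have /andP[lo up] := h0b s;
  exact: le_trans lo up.
rewrite -[leRHS]mule1 -(k1 s) -ge0_integralZl_EFin//; last 2 first.
- by move=> x _; rewrite lee_fin.
- exact/measurable_EFinP.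
apply: ge0_le_integral => //.
- by move=> x _; rewrite lee_fin mulr_ge0//; case/andP: (h0b x).
- exact: mkh.
- by apply/measurable_EFinP; exact: measurable_funM.
- move=> x _; rewrite -EFinM lee_fin mulrC ler_wpM2r//.
  by case/andP: (h0b x).
Qed.

Lemma kernel_opE (h : T -> R) (b : R) s : measurable_fun setT h ->
  (forall x, 0 <= h x <= b) ->
  ((kernel_op h s)%:E = \int[lam]_s' (k s s' * h s')%:E)%E.
Proof.
move=> mh h0b; rewrite /kernel_op fineK// ge0_fin_numE.
  by apply: le_lt_trans (integral_kernel_le s mh h0b) _; rewrite ltry.
apply: integral_ge0 => x _; rewrite lee_fin mulr_ge0//.
by case/andP: (h0b x).
Qed.

Lemma kernel_op_bound (h : T -> R) (b : R) s : measurable_fun setT h ->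
  (forall x, 0 <= h x <= b) -> 0 <= kernel_op h s <= b.
Proof.
move=> mh h0b; rewrite -2!lee_fin (kernel_opE _ mh h0b) integral_kernel_le//.
rewrite andbT; apply: integral_ge0 => x _; rewrite lee_fin mulr_ge0//.
by case/andP: (h0b x).
Qed.

Lemma measurable_kernel_op (h : T -> R) : measurable_fun setT h ->
  (forall x, 0 <= h x) -> measurable_fun [set: T] (kernel_op h).
Proof.
move=> mh h0; apply/measurableT_comp; first exact: fine_measurable.
apply: (measurable_fun_fubini_tonelli_F (m2 := lam)
  (fun z : T * T => (k z.1 z.2 * h z.2)%:E)).
- apply/measurable_EFinP; apply: measurable_funM => //.
  by apply: measurableT_comp => //; exact: measurable_snd.
- by move=> z; rewrite lee_fin mulr_ge0.
Qed.

Lemma kernel_opD (h u v : T -> R) (b c : R) s : measurable_fun setT u ->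
    measurable_fun setT v -> (forall x, 0 <= u x <= b) ->
    (forall x, 0 <= v x <= c) -> (forall x, h x = u x + v x) ->
  kernel_op h s = kernel_op u s + kernel_op v s.
Proof.
move=> mu mv u0 v0 hE; apply/EFin_inj.
have /funext -> : h =1 (u \+ v) by [].
rewrite EFinD (kernel_opE _ mu u0) (kernel_opE _ mv v0).
rewrite (@kernel_opE _ (b + c)); last 2 first.
- exact: measurable_funD.
- move=> x; have /andP[? ?] := u0 x; have /andP[? ?] := v0 x.
  by rewrite addr_ge0//= lerD.
rewrite -ge0_integralD//; last 4 first.
- by move=> x _; rewrite lee_fin mulr_ge0//; case/andP: (u0 x).
- exact: mkh.
- by move=> x _; rewrite lee_fin mulr_ge0//; case/andP: (v0 x).
- exact: mkh.
by apply: eq_integral => x _; rewrite -EFinD mulrDr.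
Qed.

Lemma kernel_op_cst (c : R) s : 0 <= c -> kernel_op (cst c) s = c.
Proof.
move=> c0; rewrite /kernel_op; under eq_integral do rewrite /= mulrC EFinM.
rewrite ge0_integralZl_EFin// ?k1 ?mule1//.
- by move=> x _; rewrite lee_fin.
- exact/measurable_EFinP.
Qed.

(** Shifting by [a] gives a nonnegative function, and constants are fixed because the kernel has
    total mass 1. *)
Lemma kernel_op_between (h : T -> R) (a b : R) s : measurable_fun setT h ->
  0 <= a -> (forall x, a <= h x <= b) -> a <= kernel_op h s <= b.
Proof.
move=> mh a0 ahb; pose u x := h x - a.
have ub x : 0 <= u x <= b - a.
  by have /andP[? ?] := ahb x; rewrite /u; apply/andP; split; lra.
have mu : measurable_fun setT u by exact: measurable_funB.
rewrite (@kernel_opD _ u (cst a) (b - a) a)//.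
- rewrite kernel_op_cst//; have /andP[? ?] := kernel_op_bound s mu ub.
  by apply/andP; split; lra.
- by move=> x /=; apply/andP.
- by move=> x; rewrite /= /u subrK.
Qed.

(** * Contraction of the oscillation in two steps *)

Variables (C : set T) (delta : R) (g : T -> R) (G : R).
Hypothesis mC : measurable C.
Hypothesis delta0 : 0 <= delta.
Hypothesis C_hit :
  forall s, (delta%:E <= \int[lam]_s' (k s s' * \1_C s')%:E)%E.
Hypothesis mg : measurable_fun setT g.
Hypothesis g0 : forall s, 0 <= g s.
Hypothesis gG : (\int[lam]_s (g s)%:E = G%:E)%E.
Hypothesis minor : forall s, C s -> forall s', g s' <= k s s'.

Let G0 : 0 <= G.
Proof. by rewrite -lee_fin -gG integral_ge0// => x _; rewrite lee_fin. Qed.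

(** The integral of [u] against the minorizing measure, of density [g]. *)
Let gam (u : T -> R) : R := fine (\int[lam]_s (g s * u s)%:E)%E.

Let gamE (u : T -> R) (b : R) : measurable_fun setT u ->
    (forall x, 0 <= u x <= b) ->
  ((gam u)%:E = \int[lam]_s (g s * u s)%:E)%E.
Proof.
move=> mu ub; rewrite fineK// ge0_fin_numE; last first.
  by apply: integral_ge0 => x _; rewrite lee_fin mulr_ge0//; case/andP: (ub x).
apply: (@le_lt_trans _ _ (b%:E * \int[lam]_s (g s)%:E)%E); last first.
  by rewrite gG -EFinM ltry.
have b0 : 0 <= b by have /andP[lo up] := ub point; exact: le_trans lo up.
rewrite -ge0_integralZl_EFin//; last 2 first.
- by move=> x _; rewrite lee_fin.
- exact/measurable_EFinP.
apply: ge0_le_integral => //.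
- by move=> x _; rewrite lee_fin mulr_ge0//; case/andP: (ub x).
- by apply/measurable_EFinP; exact: measurable_funM.
- by apply/measurable_EFinP; exact: measurable_funM.
- move=> x _; rewrite -EFinM lee_fin mulrC ler_wpM2r//.
  by case/andP: (ub x).
Qed.

(** The first step lands in [C] with probability at least [delta], and on [C] the second step gives
    at least [gam u] by minorization. *)
Lemma kernel_op2_ge (u : T -> R) (b : R) s : measurable_fun setT u ->
    (forall x, 0 <= u x <= b) ->
  delta * gam u <= kernel_op (kernel_op u) s.
Proof.
move=> mu ub.
have ku x := kernel_op_bound x mu ub.
have u0 x : 0 <= u x by case/andP: (ub x).
have mku := measurable_kernel_op mu u0.
have gam0 : 0 <= gam u.
  by rewrite fine_ge0// integral_ge0// => x _; rewrite lee_fin mulr_ge0.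
rewrite -lee_fin (kernel_opE _ mku ku).
apply: (@le_trans _ _ (\int[lam]_s' ((gam u)%:E * (k s s' * \1_C s')%:E))%E).
  rewrite ge0_integralZl_EFin//; last 2 first.
  - by move=> x _; rewrite lee_fin mulr_ge0.
  - by apply: mkh; exact: measurable_indic.
  rewrite mulrC EFinM lee_wpmul2l//.
apply: ge0_le_integral => //.
- by move=> x _; rewrite -EFinM lee_fin !mulr_ge0.
- apply/measurable_EFinP; apply: measurable_funM => //.
  by apply: measurable_funM => //; exact: measurable_indic.
- exact: mkh.
move=> x _; rewrite -EFinM lee_fin mulrCA ler_wpM2l//.
rewrite indicE; case: (boolP (x \in C)) => [/set_mem Cx|_]; last first.
  by rewrite mulr0; case/andP: (ku x).
rewrite mulr1 -lee_fin (gamE mu ub) (kernel_opE _ mu ub).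
apply: ge0_le_integral => //.
- by move=> y _; rewrite lee_fin mulr_ge0.
- by apply/measurable_EFinP; exact: measurable_funM.
- exact: mkh.
by move=> y _; rewrite lee_fin ler_wpM2r// minor.
Qed.

(* With u = h - a and v = b - h, the two bounds gain delta * gam u and
   delta * gam v, which add up to delta * G * (b - a). *)
Lemma kernel_op2_contract (h : T -> R) (a b : R) : measurable_fun setT h ->
    0 <= a -> (forall x, a <= h x <= b) ->
  exists a' b', [/\ a <= a', b' - a' = (1 - delta * G) * (b - a) &
    forall s, a' <= kernel_op (kernel_op h) s <= b'].
Proof.
move=> mh a0 ahb.
have ab : a <= b by have /andP[lo up] := ahb point; exact: le_trans lo up.
pose u x := h x - a; pose v x := b - h x.
have ub x : 0 <= u x <= b - a.
  by have /andP[? ?] := ahb x; rewrite /u; apply/andP; split; lra.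
have vb x : 0 <= v x <= b - a.
  by have /andP[? ?] := ahb x; rewrite /v; apply/andP; split; lra.
have hb x : 0 <= h x <= b.
  by have /andP[? ?] := ahb x; apply/andP; split => //; lra.
have mu : measurable_fun setT u by exact: measurable_funB.
have mv : measurable_fun setT v by exact: measurable_funB.
have b0 : 0 <= b by exact: le_trans ab.
have cb (c : R) : 0 <= c -> forall x : T, 0 <= cst c x <= c
  by move=> ? ? /=; apply/andP.
have uE s : kernel_op (kernel_op h) s = kernel_op (kernel_op u) s + a.
  rewrite (@kernel_opD _ (kernel_op u) (cst a) (b - a) a)//.
  - by rewrite kernel_op_cst.
  - by apply: measurable_kernel_op => // x; case/andP: (ub x).
  - by move=> x; exact: kernel_op_bound.
  - exact: cb.
  - move=> x; rewrite -[cst a x](kernel_op_cst x a0).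
    rewrite (@kernel_opD _ u (cst a) (b - a) a)//; first exact: cb.
    by move=> y; rewrite /= /u subrK.
have vE s : b = kernel_op (kernel_op h) s + kernel_op (kernel_op v) s.
  rewrite -(kernel_op_cst s b0) -(@kernel_opD (cst b) _ _ b (b - a))//.
  - by apply: measurable_kernel_op => // x; case/andP: (hb x).
  - by apply: measurable_kernel_op => // x; case/andP: (vb x).
  - by move=> x; exact: kernel_op_bound.
  - by move=> x; exact: kernel_op_bound.
  - move=> x; rewrite -(kernel_op_cst x b0).
    rewrite (@kernel_opD _ h v b (b - a))//.
    by move=> y; rewrite /= /v addrC subrK.
have gamuv : gam u + gam v = (b - a) * G.
  apply/EFin_inj; rewrite EFinD (gamE mu ub) (gamE mv vb) -ge0_integralD//;
    last 4 first.
  - by move=> x _; rewrite lee_fin mulr_ge0//; case/andP: (ub x).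
  - by apply/measurable_EFinP; exact: measurable_funM.
  - by move=> x _; rewrite lee_fin mulr_ge0//; case/andP: (vb x).
  - by apply/measurable_EFinP; exact: measurable_funM.
  rewrite EFinM -gG -ge0_integralZl_EFin ?subr_ge0//; last 2 first.
  - by move=> x _; rewrite lee_fin.
  - exact/measurable_EFinP.
  by apply: eq_integral => x _; rewrite -EFinD -EFinM /u /v; congr EFin; ring.
have gamu0 : 0 <= gam u.
  rewrite fine_ge0// integral_ge0// => x _; rewrite lee_fin mulr_ge0//.
  by case/andP: (ub x).
exists (a + delta * gam u), (b - delta * gam v); split.
- by rewrite lerDl mulr_ge0.
- transitivity (b - a - delta * (gam u + gam v)); first by ring.
  by rewrite gamuv; ring.
- move=> s; rewrite [in a + _ <= _]uE addrC lerD2r (kernel_op2_ge s mu ub)/=.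
  by rewrite {1}(vE s) lerBrDr lerD2l; exact: kernel_op2_ge mv vb.
Qed.

End density_kernel.

(** A factor [r] every two steps is a rate sqrt r per step; the constant 1 / sqrt r pays for the
    step lost by rounding down when [t] is odd. *)
Lemma geometric_half_rate (R : realType) (r : R) : 0 < r < 1 ->
  exists rho M : R, [/\ 0 < rho < 1, 0 <= M &
    forall t, (1 <= t)%N -> r ^+ t./2 <= M * rho ^+ t].
Proof.
move=> /andP[r0 r1]; exists (Num.sqrt r), (Num.sqrt r)^-1.
have s0 : 0 < Num.sqrt r by rewrite sqrtr_gt0.
have s1 : Num.sqrt r < 1 by rewrite -[ltRHS]sqrtr1 ltr_sqrt.
split; [by rewrite s0 s1|by rewrite invr_ge0 ltW|].
case=> // t _; rewrite exprS mulKf ?gt_eqF//.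
rewrite -{1}(sqr_sqrtr (ltW r0)) -exprM ler_wiXn2l// ?(ltW s0) ?(ltW s1)//.
have := uphalf_half t; have := odd_double_half t; lia.
Qed.

(** * From minorization to geometric ergodicity *)

Section doeblin.
Context d (T : measurableType d) (R : realType).
Variables (lam : {sigma_finite_measure set T -> \bar R}) (E : set T).
Variables (P : T -> set T -> \bar R) (Pi : set T -> \bar R).
Variables (k : T -> T -> R) (pi : T -> R).
Hypothesis mk : measurable_fun [set: T * T] (fun z => k z.1 z.2).
Hypothesis k0 : forall s s', 0 <= k s s'.
Hypothesis k1 : forall s, (\int[lam]_s' (k s s')%:E = 1)%E.
Hypothesis P_ge0 : forall s B, (0 <= P s B)%E.
Hypothesis PE : forall s B, measurable B ->
  P s B = (\int[lam]_(s' in B) (k s s')%:E)%E.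
Hypothesis mpi : measurable_fun setT pi.
Hypothesis pi0 : forall s, 0 <= pi s.
Hypothesis pi1 : (\int[lam]_s (pi s)%:E = 1)%E.
Hypothesis PiE : forall B, measurable B -> B `<=` E ->
  Pi B = (\int[lam]_(s in B) (pi s)%:E)%E.
Hypothesis pi_invariant :
  forall s', (\int[lam]_s (pi s * k s s')%:E = (pi s')%:E)%E.
Variables (C : set T) (delta : R) (g : T -> R).
Hypothesis mC : measurable C.
Hypothesis delta0 : 0 < delta.
Hypothesis C_hit : forall s, (delta%:E <= P s C)%E.
Hypothesis mg : measurable_fun setT g.
Hypothesis g0 : forall s, 0 <= g s.
Hypothesis g_gt0 : (0 < \int[lam]_s (g s)%:E)%E.
Hypothesis minor : forall s, C s -> forall s', g s' <= k s s'.

Local Notation op := (kernel_op lam k).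

(** [h B t s] is the real-valued probability of being in [B] after [t] steps from [s]
    ([kernel_iterE]). *)
Let h (B : set T) := fix h t : T -> R := if t is t'.+1 then op (h t') else \1_B.

Let mks s : measurable_fun [set: T] (k s).
Proof. exact: (measurable_fun_pair2 s mk). Qed.

Let hP B : measurable B -> forall t, measurable_fun setT (h B t) /\
  forall x, 0 <= h B t x <= 1.
Proof.
move=> mB; elim=> [|t [mt ht]] /=.
  by split; [exact: measurable_indic|move=> x; rewrite indicE; case: (_ \in _);
    rewrite /= ?lexx ?ler01].
split; first by apply: measurable_kernel_op => // x; case/andP: (ht x).
by move=> x; exact: kernel_op_bound.
Qed.

Let integralP s (f : T -> R) : measurable_fun setT f -> (forall x, 0 <= f x) ->
  (\int[P s]_x (f x)%:E = \int[lam]_x (k s x * f x)%:E)%E.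
Proof.
move=> mf f0.
rewrite (integral_eq_measure (m2 := density_measure lam (mks s) (k0 s)))//;
  last exact: PE.
rewrite integral_density_measure//; last exact/measurable_EFinP.
Qed.

Let kernel_iterE B : measurable B -> forall t s,
  kernel_iter P t s B = (h B t s)%:E.
Proof.
move=> mB; elim=> [//|t IH] s.
have [mt ht] := hP mB t.
transitivity (\int[P s]_s' kernel_iter P t s' B)%E => [//|];
  rewrite (funext IH : (fun s' => kernel_iter P t s' B) = _).
rewrite integralP//; last by move=> x; case/andP: (ht x).
by rewrite [h B t.+1]/= (kernel_opE mk k0 k1 _ mt ht).
Qed.

(** Invariance makes [Pi B] the [pi]-average of [h B t] for every [t]. It therefore lies in any
    interval that contains all the values of [h B t], which is how the oscillation bounds the
    distance to [Pi]. *)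
Let Pih B : measurable B -> B `<=` E -> forall t,
  (\int[lam]_s (pi s * h B t s)%:E = Pi B)%E.
Proof.
move=> mB BE; elim=> [|t IH].
  rewrite PiE// [RHS]integral_mkcond; apply: eq_integral => x _.
  by rewrite patchE [h _ _]/= indicE; case: (_ \in _); rewrite ?mulr1 ?mulr0.
have [mt ht] := hP mB t.
have ht0 x : 0 <= h B t x by case/andP: (ht x).
rewrite -IH.
pose f (z : T * T) := (pi z.1 * (k z.1 z.2 * h B t z.2))%:E.
have mf : measurable_fun setT f.
  apply/measurable_EFinP; apply: measurable_funM.
    exact: measurableT_comp.
  by apply: measurable_funM => //; exact: measurableT_comp.
have f0 z : (0 <= f z)%E by rewrite lee_fin !mulr_ge0.
transitivity (\int[lam]_x \int[lam]_y f (x, y))%E.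
  apply: eq_integral => x _; rewrite [h B t.+1]/= EFinM.
  rewrite (kernel_opE mk k0 k1 _ mt ht) -ge0_integralZl_EFin//.
  - by move=> y _; rewrite lee_fin mulr_ge0.
  - by apply/measurable_EFinP; exact: measurable_funM.
rewrite fubini_tonelli//; apply: eq_integral => y _.
rewrite (mulrC (pi y)) EFinM -pi_invariant -ge0_integralZl_EFin//.
- by apply: eq_integral => x _; rewrite -EFinM; congr EFin; ring.
- by move=> x _; rewrite lee_fin mulr_ge0.
- apply/measurable_EFinP; apply: measurable_funM => //.
  exact: (measurable_fun_pair1 y mk).
Qed.

Theorem doeblin_geometrically_ergodic : geometrically_ergodic E P Pi.
Proof.
pose G := fine (\int[lam]_s (g s)%:E)%E.
(* [C] is nonempty because it is hit with positive probability, and on it [g] is below a probability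
   density. *)
have gle1 : (\int[lam]_s (g s)%:E <= 1)%E.
  have [[s Cs]|C0] := pselect (exists s, C s).
    rewrite -(k1 s); apply: ge0_le_integral => //.
    - by move=> x _; rewrite lee_fin.
    - exact/measurable_EFinP.
    - exact/measurable_EFinP.
    - by move=> x _; rewrite lee_fin minor.
  have := C_hit point; suff -> : C = set0
    by rewrite PE// integral_set0 lee_fin leNgt delta0.
  by apply/seteqP; split=> // s Cs; apply: C0; exists s.
have gE : (\int[lam]_s (g s)%:E = G%:E)%E.
  by rewrite /G fineK// fin_real// (lt_le_trans _ (ltW g_gt0))//=
    (le_lt_trans gle1)// ltry.
have G0 : 0 < G by rewrite -lte_fin -gE.
have G1 : G <= 1 by rewrite -lee_fin -gE.
have delta1 : delta <= 1.
  rewrite -lee_fin (le_trans (C_hit point))// PE// -(k1 point).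
  apply: ge0_subset_integral => //; first exact/measurable_EFinP.
  by move=> x _; rewrite lee_fin.
have C_hit' s : (delta%:E <= \int[lam]_s' (k s s' * \1_C s')%:E)%E.
  rewrite (le_trans (C_hit s))// PE// [leLHS]integral_mkcond le_eqVlt;
    apply/orP; left.
  apply/eqP/eq_integral => x _; rewrite patchE indicE.
  by case: (_ \in _); rewrite ?mulr1 ?mulr0.
(* Half of the available gain is given up so that [r] stays positive even when [delta * G] is 1. *)
pose r := 1 - delta * G / 2.
have dG0 : 0 < delta * G by exact: mulr_gt0.
have dG1 : delta * G <= 1 by rewrite mulr_ile1// ltW.
have r01 : 0 < r < 1 by rewrite /r; apply/andP; split; lra.
have /andP[r0 r1] := r01.
have [rho [M [rho01 M0 Mr]]] := geometric_half_rate r01.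
exists rho, (fun=> M); split => // s Es t t1.
apply: ub_ereal_sup => _ [B [mB BE] <-].
have osc j : exists a b, [/\ 0 <= a, b - a <= r ^+ j &
    forall s, a <= h B j.*2 s <= b].
  elim: j => [|j [a [b [a0 ab hab]]]].
    by exists 0, 1; rewrite subr0 expr0; split => // x;
      have [_] := hP mB 0%N; apply.
  have [mt _] := hP mB j.*2.
  have [a' [b' [aa' ba' hab']]] := kernel_op2_contract mk k0 k1 mC (ltW delta0)
    C_hit' mg g0 gE minor mt a0 hab.
  exists a', b'; split; [exact: le_trans aa'| |exact: hab'].
  have ab0 : 0 <= b - a by rewrite subr_ge0; have /andP[lo up] := hab point;
    exact: le_trans lo up.
  rewrite ba' exprS ler_pM//; rewrite /r; lra.
(* For odd [t] the additional step cannot widen the interval. *)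
have osc' : exists a b, [/\ 0 <= a, b - a <= r ^+ t./2 &
    forall s, a <= h B t s <= b].
  have [a [b [a0 ab hab]]] := osc t./2.
  rewrite -(odd_double_half t); case: (odd t) => /=; last first.
    by rewrite add0n doubleK; exists a, b.
  exists a, b; split => //; first by rewrite add0n uphalf_double.
  by move=> x; rewrite add0n; apply: kernel_op_between => //;
    case: (hP mB (t./2).*2).
have [a [b [a0 ab hab]]] := osc'.
have [mt ht] := hP mB t.
(* Integration against [pi] is the action of a kernel that ignores its starting point, so
   [kernel_op_between] applies to it as well. *)
have mpi2 : measurable_fun [set: T * T] (fun z => pi z.2)
  by exact: measurableT_comp.
have /andP[Pa Pb] := kernel_op_between mpi2 (fun _ => pi0) (fun _ => pi1)
  s mt a0 hab.
have /andP[ha hb] := hab s.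
rewrite kernel_iterE// -(Pih mB BE t).
rewrite -(kernel_opE mpi2 (fun _ => pi0) (fun _ => pi1) s mt ht).
rewrite -EFinB abse_EFin lee_fin (le_trans _ (Mr t t1))// (le_trans _ ab)//.
by rewrite ler_norml; apply/andP; split; lra.
Qed.

End doeblin.

(** * Three-block Gibbs samplers *)

Lemma sfprod_tonelli1 d1 d2 (T1 : measurableType d1) (T2 : measurableType d2)
    (R : realType) (m1 : {sigma_finite_measure set T1 -> \bar R})
    (m2 : {sigma_finite_measure set T2 -> \bar R}) (f : T1 * T2 -> \bar R) :
  measurable_fun setT f -> (forall z, 0 <= f z)%E ->
  (\int[sfprod m1 m2]_z f z = \int[m1]_x \int[m2]_y f (x, y))%E.
Proof. exact: fubini_tonelli1. Qed.

Lemma sfprod_tonelli2 d1 d2 (T1 : measurableType d1) (T2 : measurableType d2)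
    (R : realType) (m1 : {sigma_finite_measure set T1 -> \bar R})
    (m2 : {sigma_finite_measure set T2 -> \bar R}) (f : T1 * T2 -> \bar R) :
  measurable_fun setT f -> (forall z, 0 <= f z)%E ->
  (\int[sfprod m1 m2]_z f z = \int[m2]_y \int[m1]_x f (x, y))%E.
Proof. exact: fubini_tonelli2. Qed.

(** The formula x^-1 = x * (x^2)^-1 holds at 0 too, where the inverse is 0, and x^2 is nonnegative,
    so the second factor is a value of [powR]. *)
Lemma measurable_inv (R : realType) : measurable_fun setT (@GRing.inv R).
Proof.
have -> : @GRing.inv R = fun x => x * (x ^+ 2) `^ (-1).
  apply/funext => x; rewrite powR_inv1 ?sqr_ge0//.
  by have [->|x0] := eqVneq x 0;
    rewrite ?invr0 ?mul0r// expr2 invfM mulrA divff ?mul1r.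
apply: measurable_funM => //.
apply: (measurableT_comp (measurable_powR _)) => //; exact: measurable_funX.
Qed.

Section gibbs.
Context dX dY dS (X : measurableType dX) (Y : measurableType dY)
  (S : measurableType dS) (R : realType).
Variables (muX : {sigma_finite_measure set X -> \bar R})
  (muY : {sigma_finite_measure set Y -> \bar R})
  (muS : {sigma_finite_measure set S -> \bar R}).
Variables (D : set S) (f : X * Y * S -> R).

(** The normalizing constants of the three conditionals, each named after the variable that is
    integrated out. *)
Definition margS x y : R := fine (\int[muS]_(s in D) (f (x, y, s))%:E)%E.
Definition margY x s : R := fine (\int[muY]_y (f (x, y, s))%:E)%E.
Definition margX y s : R := fine (\int[muX]_x (f (x, y, s))%:E)%E.

Definition gibbs_step (z : X * Y * S) (B : set (X * Y * S)) : \bar R :=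
  let: (x, y, _) := z in
  (\int[muS]_(s in D) ((f (x, y, s) / margS x y)%:E *
    \int[muY]_y' ((f (x, y', s) / margY x s)%:E *
      \int[muX]_x' ((f (x', y', s) / margX y' s)%:E *
        (\1_B (x', y', s))%:E))))%E.

(** The density of a whole step: the product of the three conditionals, in the order of simulation.
    The old value [z.2] does not occur, since it is resampled first. *)
Definition gibbs_density (z z' : X * Y * S) : R :=
  f (z.1.1, z.1.2, z'.2) / margS z.1.1 z.1.2 *
  (f (z.1.1, z'.1.2, z'.2) / margY z.1.1 z'.2 *
   (f z' / margX z'.1.2 z'.2)).

Hypothesis mf : measurable_fun setT f.
Hypothesis mD : measurable D.
Hypothesis f0 : forall z, 0 <= f z.
Hypothesis fD : forall x y s, ~ D s -> f (x, y, s) = 0.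
Hypothesis margS_gt0 : forall x y,
  (0 < \int[muS]_(s in D) (f (x, y, s))%:E < +oo)%E.
Hypothesis margY_gt0 : forall x s, D s ->
  (0 < \int[muY]_y (f (x, y, s))%:E < +oo)%E.
Hypothesis margX_gt0 : forall y s, D s ->
  (0 < \int[muX]_x (f (x, y, s))%:E < +oo)%E.

Local Notation lam := (sfprod (sfprod muX muY) muS).

Let intS x y : (\int[muS]_(s in D) (f (x, y, s))%:E =
  \int[muS]_s (f (x, y, s))%:E)%E.
Proof.
rewrite integral_mkcond; apply: eq_integral => s _; rewrite patchE.
by case: ifPn => // /negP sD; rewrite fD// => Ds; apply: sD; rewrite inE.
Qed.

Let margSE x y : ((margS x y)%:E = \int[muS]_s (f (x, y, s))%:E)%E.
Proof.
have /andP[h0 hoo] := margS_gt0 x y.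
by rewrite -intS /margS fineK// ge0_fin_numE// ltW.
Qed.

Let margYE x s : D s -> ((margY x s)%:E = \int[muY]_y (f (x, y, s))%:E)%E.
Proof.
by move=> /(margY_gt0 x)/andP[h0 hoo];
  rewrite /margY fineK// ge0_fin_numE// ltW.
Qed.

Let margXE y s : D s -> ((margX y s)%:E = \int[muX]_x (f (x, y, s))%:E)%E.
Proof.
by move=> /(margX_gt0 y)/andP[h0 hoo];
  rewrite /margX fineK// ge0_fin_numE// ltW.
Qed.

Let margS0 x y : 0 < margS x y.
Proof. by rewrite -lte_fin margSE -intS; case/andP: (margS_gt0 x y). Qed.

Let margY0 x s : D s -> 0 < margY x s.
Proof.
by move=> Ds; rewrite -lte_fin margYE//; case/andP: (margY_gt0 x Ds).
Qed.

Let margX0 y s : D s -> 0 < margX y s.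
Proof.
by move=> Ds; rewrite -lte_fin margXE//; case/andP: (margX_gt0 y Ds).
Qed.

Let margS_ge0 x y : 0 <= margS x y. Proof. exact: ltW. Qed.

Let margY_ge0 x s : 0 <= margY x s.
Proof. by rewrite fine_ge0// integral_ge0// => y _; rewrite lee_fin. Qed.

Let margX_ge0 x s : 0 <= margX x s.
Proof. by rewrite fine_ge0// integral_ge0// => y _; rewrite lee_fin. Qed.

Let mEf : measurable_fun setT (EFin \o f).
Proof. exact/measurable_EFinP. Qed.

Let mfx y s : measurable_fun setT (fun x => f (x, y, s)).
Proof.
exact: (measurable_fun_pair1 y (measurable_fun_pair1 s mf)).
Qed.

Let mfy x s : measurable_fun setT (fun y => f (x, y, s)).
Proof.
exact: (measurable_fun_pair2 x (measurable_fun_pair1 s mf)).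
Qed.

Let mfs x y : measurable_fun setT (fun s => f (x, y, s)).
Proof. exact: (measurable_fun_pair2 (x, y) mf). Qed.

Lemma measurable_margS : measurable_fun setT (fun z : X * Y => margS z.1 z.2).
Proof.
have -> : (fun z : X * Y => margS z.1 z.2) =
    fine \o (fubini_F muS (EFin \o f)).
  by apply/funext => -[x y]; rewrite /margS intS.
apply: measurableT_comp; first exact: fine_measurable.
exact: measurable_fun_fubini_tonelli_F.
Qed.

Lemma measurable_margY : measurable_fun setT (fun z : X * S => margY z.1 z.2).
Proof.
apply: measurableT_comp; first exact: fine_measurable.
(* The coordinates are permuted so that the integrated one comes last. *)
apply: (measurable_fun_fubini_tonelli_F (m2 := muY)
  (fun z : X * S * Y => (f (z.1.1, z.2, z.1.2))%:E)).
- apply/measurable_EFinP; apply: (measurableT_comp mf).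
  apply: measurable_fun_pair; last exact: measurableT_comp.
  by apply: measurable_fun_pair => //; exact: measurableT_comp.
- by move=> z; rewrite lee_fin.
Qed.

Lemma measurable_margX : measurable_fun setT (fun z : Y * S => margX z.1 z.2).
Proof.
apply: measurableT_comp; first exact: fine_measurable.
apply: (measurable_fun_fubini_tonelli_F (m2 := muX)
  (fun z : Y * S * X => (f (z.2, z.1.1, z.1.2))%:E)).
- apply/measurable_EFinP; apply: (measurableT_comp mf).
  apply: measurable_fun_pair; last exact: measurableT_comp.
  by apply: measurable_fun_pair => //; exact: measurableT_comp.
- by move=> z; rewrite lee_fin.
Qed.

Lemma gibbs_density_ge0 z z' : 0 <= gibbs_density z z'.
Proof. by rewrite /gibbs_density !mulr_ge0// invr_ge0. Qed.

Lemma measurable_gibbs_density :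
  measurable_fun setT (fun z => gibbs_density z.1 z.2).
Proof.
pose V := (X * Y * S * (X * Y * S))%type.
have m1 : measurable_fun setT (fun z : V => z.1.1) by exact: measurableT_comp.
have mx : measurable_fun setT (fun z : V => z.1.1.1) by exact: measurableT_comp.
have my : measurable_fun setT (fun z : V => z.1.1.2) by exact: measurableT_comp.
have m1' : measurable_fun setT (fun z : V => z.2.1) by exact: measurableT_comp.
have my' : measurable_fun setT (fun z : V => z.2.1.2)
  by exact: measurableT_comp.
have ms' : measurable_fun setT (fun z : V => z.2.2) by exact: measurableT_comp.
have minv := @measurable_inv R.
apply: measurable_funM; apply: measurable_funM.
- apply: (measurableT_comp mf); apply: measurable_fun_pair => //.
  exact: measurable_fun_pair.
- apply: (measurableT_comp minv).
  exact: (measurableT_comp measurable_margS).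
- apply: measurable_funM.
    apply: (measurableT_comp mf); apply: measurable_fun_pair => //.
    exact: measurable_fun_pair.
  apply: (measurableT_comp minv).
  apply: (measurableT_comp measurable_margY
    (g := fun z : V => (z.1.1.1, z.2.2))).
  exact: measurable_fun_pair.
- apply: measurable_funM; first exact: (measurableT_comp mf).
  apply: (measurableT_comp minv).
  apply: (measurableT_comp measurable_margX
    (g := fun z : V => (z.2.1.2, z.2.2))).
  exact: measurable_fun_pair.
Qed.

Let mgz z : measurable_fun setT (gibbs_density z).
Proof. exact: (measurable_fun_pair2 z measurable_gibbs_density). Qed.

(** Tonelli in the order of simulation: [s] outermost, then [y'], then [x']. Off [D] the first
    factor vanishes, so the outer integral may be restricted to [D]. *)
Lemma integral_gibbs_density (h : X * Y * S -> R) z :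
    measurable_fun setT h -> (forall z', 0 <= h z') ->
  (\int[lam]_z' (gibbs_density z z' * h z')%:E =
  \int[muS]_(s in D) ((f (z.1, s) / margS z.1.1 z.1.2)%:E *
    \int[muY]_y' ((f (z.1.1, y', s) / margY z.1.1 s)%:E *
      \int[muX]_x' ((f (x', y', s) / margX y' s)%:E * (h (x', y', s))%:E))))%E.
Proof.
move=> mh h0; case: z => -[x y] s0 /=.
have mgh : measurable_fun setT
    (fun z' => (gibbs_density (x, y, s0) z' * h z')%:E).
  by apply/measurable_EFinP; exact: measurable_funM.
have gh0 z' : (0 <= (gibbs_density (x, y, s0) z' * h z')%:E)%E.
  by rewrite lee_fin mulr_ge0// gibbs_density_ge0.
rewrite sfprod_tonelli2// [RHS]integral_mkcond; apply: eq_integral => s _.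
rewrite patchE; case: ifPn => [_|sD]; last first.
  apply: integral0_eq => z _; rewrite /gibbs_density /= fD ?mul0r//.
  by move=> Ds; move/negP: sD; apply; rewrite inE.
pose v (z : X * Y) := (f (x, z.2, s) / margY x s *
   (f (z, s) / margX z.2 s * h (z, s)))%:E.
have mfs1 : measurable_fun setT (fun z : X * Y => f (z, s)).
  exact: (measurable_fun_pair1 s mf).
have mhs : measurable_fun setT (fun z : X * Y => h (z, s)).
  exact: (measurable_fun_pair1 s mh).
have mXs : measurable_fun setT (fun z : X * Y => margX z.2 s).
  apply: (measurableT_comp (measurable_fun_pair1 s measurable_margX)).
  exact: measurable_snd.
have mc3 : measurable_fun setT
  (fun z : X * Y => f (z, s) / margX z.2 s * h (z, s)).
  apply: measurable_funM => //; apply: measurable_funM => //.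
  exact: (measurableT_comp (@measurable_inv R)).
have mv : measurable_fun setT v.
  apply/measurable_EFinP; apply: measurable_funM => //.
  apply: measurable_funM => //.
  by apply: (measurableT_comp (mfy x s)); exact: measurable_snd.
have v0 z : (0 <= v z)%E.
  by rewrite lee_fin !mulr_ge0// invr_ge0.
transitivity ((f (x, y, s) / margS x y)%:E * \int[sfprod muX muY]_z v z)%E.
  rewrite -ge0_integralZl_EFin//; last by rewrite mulr_ge0// invr_ge0.
  by apply: eq_integral => z _; rewrite /gibbs_density /= -EFinM !mulrA.
rewrite sfprod_tonelli2//; congr (_ * _)%E; apply: eq_integral => y' _.
rewrite -ge0_integralZl_EFin//.
- by move=> x' _; rewrite -EFinM lee_fin !mulr_ge0// invr_ge0.
- by under eq_fun do rewrite -EFinM; apply/measurable_EFinP;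
    exact: (measurable_fun_pair1 y' mc3).
- by rewrite mulr_ge0// invr_ge0.
Qed.

Lemma gibbs_stepE z B : measurable B ->
  gibbs_step z B = (\int[lam]_(z' in B) (gibbs_density z z')%:E)%E.
Proof.
move=> mB; transitivity (\int[lam]_z' (gibbs_density z z' * \1_B z')%:E)%E.
  by rewrite integral_gibbs_density//; case: z => -[].
rewrite [RHS]integral_mkcond; apply: eq_integral => x _; rewrite patchE indicE.
by case: (_ \in _); rewrite ?mulr1 ?mulr0.
Qed.

Lemma gibbs_step_ge0 z B : (0 <= gibbs_step z B)%E.
Proof.
case: z => -[x y] s0; apply: integral_ge0 => s _; apply: mule_ge0.
  by rewrite lee_fin mulr_ge0// invr_ge0.
apply: integral_ge0 => y' _; apply: mule_ge0.
  by rewrite lee_fin mulr_ge0// invr_ge0.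
apply: integral_ge0 => x' _; apply: mule_ge0.
  by rewrite lee_fin mulr_ge0// invr_ge0.
by rewrite lee_fin.
Qed.

Let cX1 y s : D s -> (\int[muX]_x (f (x, y, s) / margX y s)%:E = 1)%E.
Proof.
move=> Ds; under eq_integral do rewrite mulrC EFinM.
rewrite ge0_integralZl_EFin// ?invr_ge0//.
- by rewrite -margXE// -EFinM mulVf// gt_eqF// margX0.
- by move=> x _; rewrite lee_fin.
- exact/measurable_EFinP.
Qed.

Let cY1 x s : D s -> (\int[muY]_y (f (x, y, s) / margY x s)%:E = 1)%E.
Proof.
move=> Ds; under eq_integral do rewrite mulrC EFinM.
rewrite ge0_integralZl_EFin// ?invr_ge0//.
- by rewrite -margYE// -EFinM mulVf// gt_eqF// margY0.
- by move=> y _; rewrite lee_fin.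
- exact/measurable_EFinP.
Qed.

Let cS1 x y : (\int[muS]_s (f (x, y, s) / margS x y)%:E = 1)%E.
Proof.
under eq_integral do rewrite mulrC EFinM.
rewrite ge0_integralZl_EFin// ?invr_ge0//.
- by rewrite -margSE -EFinM mulVf// gt_eqF// margS0.
- by move=> s _; rewrite lee_fin.
- exact/measurable_EFinP.
Qed.

Lemma gibbs_density1 z : (\int[lam]_z' (gibbs_density z z')%:E = 1)%E.
Proof.
transitivity (\int[lam]_z' (gibbs_density z z' * cst 1 z')%:E)%E.
  by apply: eq_integral => z' _; rewrite mulr1.
rewrite integral_gibbs_density//; case: z => -[x y] s0 /=.
rewrite -[RHS](cS1 x y) [LHS]integral_mkcond; apply: eq_integral => s _.
rewrite patchE; case: ifPn => [/set_mem Ds|sD]; last first.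
  by rewrite fD ?mul0r// => Ds; move/negP: sD; apply; rewrite inE.
rewrite -[RHS]mule1 -[X in _ = (_ * X)%E](cY1 x Ds); congr (_ * _)%E;
  apply: eq_integral => y' _.
rewrite -[RHS]mule1 -[X in _ = (_ * X)%E](cX1 y' Ds); congr (_ * _)%E;
  apply: eq_integral => x' _.
by rewrite mule1.
Qed.

(** The old variables are integrated out in the order in which they are resampled, and each integral
    cancels one denominator: [s] yields [margS x y], then [y] yields [margY x s'], then [x] yields
    [margX y' s']. What remains is [f z']. *)
Lemma gibbs_invariant z' :
  (\int[lam]_z (f z * gibbs_density z z')%:E = (f z')%:E)%E.
Proof.
have mfg : measurable_fun setT (fun z => (f z * gibbs_density z z')%:E).
  apply/measurable_EFinP; apply: measurable_funM => //.
  exact: (measurable_fun_pair1 z' measurable_gibbs_density).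
have fg0 z : (0 <= (f z * gibbs_density z z')%:E)%E.
  by rewrite lee_fin mulr_ge0// gibbs_density_ge0.
case: z' mfg fg0 => -[x' y'] s' mfg fg0.
(* Off [D] the constants [margX] and [margY] may vanish, but both sides are then 0. *)
have [Ds|nDs] := pselect (D s'); last first.
  rewrite fD//; apply: integral0_eq => z _.
  by rewrite /gibbs_density /= fD// !(mul0r, mulr0).
rewrite sfprod_tonelli1//=.
pose c3 := f (x', y', s') / margX y' s'.
have c30 : 0 <= c3 by rewrite mulr_ge0// invr_ge0.
pose v (z : X * Y) := (f (z, s') * (f (z.1, y', s') / margY z.1 s' * c3))%:E.
transitivity (\int[sfprod muX muY]_z v z)%E.
  apply: eq_integral => -[x y] _.
  transitivity (\int[muS]_s
      ((f (x, y, s') / margS x y * (f (x, y', s') / margY x s' * c3))%:E *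
        (f (x, y, s))%:E))%E.
    by apply: eq_integral => s _; rewrite /gibbs_density /= -EFinM mulrC.
  rewrite ge0_integralZl_EFin//; last 3 first.
  - by move=> s _; rewrite lee_fin.
  - exact/measurable_EFinP.
  - by rewrite !mulr_ge0// invr_ge0.
  rewrite -margSE -EFinM /v /=; congr EFin; field.
  by rewrite !gt_eqF// ?margX0// ?margY0.
have mfs1 : measurable_fun setT (fun z : X * Y => f (z, s')).
  exact: (measurable_fun_pair1 s' mf).
have mv : measurable_fun setT v.
  apply/measurable_EFinP; apply: measurable_funM => //.
  apply: measurable_funM => //; apply: measurable_funM.
    by apply: (measurableT_comp (mfx y' s')); exact: measurable_fst.
  apply: (measurableT_comp (@measurable_inv R)).
  apply: (measurableT_comp (measurable_fun_pair1 s' measurable_margY)).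
  exact: measurable_fst.
have v0 z : (0 <= v z)%E by rewrite lee_fin !mulr_ge0// invr_ge0.
rewrite sfprod_tonelli1//.
transitivity (\int[muX]_x (c3%:E * (f (x, y', s'))%:E))%E; last first.
  rewrite ge0_integralZl_EFin//; last 2 first.
  - by move=> x _; rewrite lee_fin.
  - exact/measurable_EFinP.
  by rewrite -margXE// -EFinM /c3 divfK// gt_eqF// margX0.
apply: eq_integral => x _.
transitivity (\int[muY]_y
  ((f (x, y', s') / margY x s' * c3)%:E * (f (x, y, s'))%:E))%E.
  by apply: eq_integral => y _; rewrite /v /= -EFinM mulrC.
rewrite ge0_integralZl_EFin//; last 3 first.
- by move=> y _; rewrite lee_fin.
- exact/measurable_EFinP.
- by rewrite !mulr_ge0// invr_ge0.
rewrite -margYE// -!EFinM; congr EFin; field.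
by rewrite gt_eqF// margY0.
Qed.

End gibbs.

Lemma measurable_sublevel d (T : measurableType d) (R : realType)
  (N : T -> R) r :
  measurable_fun setT N -> measurable [set x | N x <= r].
Proof.
move=> mN; rewrite -[X in measurable X]setTI.
rewrite (_ : [set x | _] = N @^-1` `]-oo, r]); first exact: mN.
by apply/seteqP; split=> x /=; rewrite in_itv.
Qed.

(** * Monotonicity and positivity of integrals *)

Section integral_complements.
Context d (T : measurableType d) (R : realType).
Variable mu : {measure set T -> \bar R}.
Implicit Types (D : set T) (f g : T -> \bar R).
Local Open Scope ereal_scope.

(** No measurability is required: the integral is a supremum over simple functions, and those below
    [f] are below [g]. *)
Lemma ge0_integral_mono D f g : (forall x, D x -> 0 <= f x) ->
  (forall x, D x -> f x <= g x) ->
  \int[mu]_(x in D) f x <= \int[mu]_(x in D) g x.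
Proof.
move=> f0 fg.
have g0 x : D x -> 0 <= g x by move=> Dx; exact: le_trans (f0 x Dx) (fg x Dx).
rewrite !ge0_integralE//; apply: le_ereal_sup => _ [h /= hf <-];
  exists h => //= x.
apply: le_trans (hf x) _; rewrite !patchE; case: ifPn => // /set_mem; exact: fg.
Qed.

Lemma integral_gt0 D f : measurable D -> measurable_fun D f ->
  (forall x, D x -> 0 < f x) -> mu D != 0 -> 0 < \int[mu]_(x in D) f x.
Proof.
move=> mD mf f0 muD.
rewrite lt0e integral_ge0 ?andbT; last by move=> x Dx; exact/ltW/f0.
apply: contra muD => /eqP intf0.
have : \int[mu]_(x in D) `|f x| = 0.
  rewrite -intf0; apply: eq_integral => x /[!inE] Dx.
  by rewrite gee0_abs// ltW// f0.
move=> /(ae_eq_integral_abs mu mD mf) [N [mN N0 DN]].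
rewrite -measure_le0 -N0 le_measure ?inE// => x Dx; apply: DN => /=.
by move=> /(_ Dx) fx0; have := f0 x Dx; rewrite fx0 ltxx.
Qed.

Lemma integral_gt0_measure D f : measurable D -> measurable_fun D f ->
  (forall x, D x -> 0 <= f x) -> 0 < \int[mu]_(x in D) f x -> mu D != 0.
Proof.
move=> mD mf f0; apply: contraTneq => muD0.
rewrite -leNgt -(@integral_abs_eq0 _ _ _ mu D f)//.
by apply: ge0_integral_mono => // x Dx; rewrite gee0_abs ?f0.
Qed.

(** The sublevel sets at the integers cover the space; if all were null, countable subadditivity
    would make the space null. *)
Lemma measure_sublevel_neq0 (N : T -> R) (mN : measurable_fun setT N) :
  mu setT != 0 ->
  exists r0 : R, forall r, (r0 <= r)%R -> mu [set x | (N x <= r)%R] != 0.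
Proof.
move=> muT; have mA r := measurable_sublevel r mN.
have [[n An]|/forallNP A0] := pselect
  (exists n, mu [set x | (N x <= n%:R)%R] != 0).
  exists n%:R => r nr; apply: contra An => /eqP r0.
  rewrite -measure_le0 -r0 le_measure ?inE// => x /= xn; exact: le_trans nr.
exfalso; move/negP: muT; apply; rewrite -measure_le0.
have -> : [set: T] = \bigcup_n [set x | (N x <= n%:R)%R].
  apply/seteqP; split => // x _; exists (Num.truncn `|N x|).+1 => //=.
  by rewrite (le_trans (ler_norm _))// ltW// Num.Theory.truncnS_gt.
apply: le_trans (measure_sigma_subadditive mu (fun n => mA n%:R) _
  (@subset_refl _ _)) _.
  by apply: bigcupT_measurable => n; exact: mA.
rewrite eseries0// => n _ _; apply/eqP; move: (A0 n) => /negP; rewrite negbK//.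
Qed.

End integral_complements.

Lemma expR_small (R : realType) (c kappa : R) : 0 <= c -> 0 < kappa ->
  exists r0, forall r, r0 <= r -> c * expR (- (kappa * r)) <= 2^-1.
Proof.
(* From exp x >= 1 + x: it suffices that [kappa * r] exceed [2 * c]. *)
move=> c0 k0; exists (2 * c / kappa) => r rc.
have kr : 2 * c <= kappa * r by rewrite (mulrC kappa) -ler_pdivrMr.
rewrite expRN ler_pdivrMr ?expR_gt0//.
have := expR_ge1Dx (kappa * r); lra.
Qed.

(** * Tail bounds by dilation *)

Section scaling_tail.
Context d (T : measurableType d) (R : realType).
Variables (mu : {measure set T -> \bar R}) (phi : T -> T) (N : T -> R).
Variables (K M kappa : R).
Hypothesis mN : measurable_fun setT N.
Hypothesis M0 : 0 <= M.
Hypothesis K0 : 0 <= K.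
Hypothesis phi_scale : forall h : T -> \bar R, measurable_fun setT h ->
  (forall x, 0 <= h x)%E -> (\int[mu]_x h x = K%:E * \int[mu]_x h (phi x))%E.

(* The tail {N > r} is pulled back along the dilation phi, along which g decays
   like exp(- kappa r); no closed form of the integral of g is needed. *)
Lemma scaling_tail_half (g : T -> R) (r : R) : measurable_fun setT g ->
    (forall x, 0 <= g x) ->
    (forall x, r < N (phi x) -> g (phi x) <= M * expR (- (kappa * r)) * g x) ->
    K * M * expR (- (kappa * r)) <= 2^-1 ->
    (\int[mu]_x (g x)%:E < +oo)%E ->
  (2^-1%:E * \int[mu]_x (g x)%:E <= \int[mu]_(x in [set x | (N x <= r)%R])
    (g x)%:E)%E.
Proof.
move=> mg g0 gphi KM goo.
have mEg : measurable_fun setT (EFin \o g) by exact/measurable_EFinP.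
pose A := [set x | N x <= r].
have mA : measurable A by exact: measurable_sublevel.
have AE : (\int[mu]_(x in A) (g x)%:E = \int[mu]_x (g x * \1_A x)%:E)%E.
  rewrite integral_mkcond; apply: eq_integral => x _; rewrite patchE indicE.
  by case: (_ \in _); rewrite ?mulr1 ?mulr0.
have mgA B : measurable B -> measurable_fun setT (fun x => (g x * \1_B x)%:E).
  by move=> mB; apply/measurable_EFinP; apply: measurable_funM => //;
    exact: measurable_indic.
(* The change of variables [phi] bounds the tail by a small multiple of the full integral of [g].
   Being at most half of it, the tail leaves at least half to [A]. *)
have tail : (\int[mu]_x (g x * \1_(~` A) x)%:E <= 2^-1%:E * \int[mu]_x
  (g x)%:E)%E.
  have M1 : 0 <= M * expR (- (kappa * r)) by rewrite mulr_ge0// expR_ge0.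
  rewrite phi_scale//; last 2 first.
  - by apply: mgA; exact: measurableC.
  - by move=> x; rewrite lee_fin mulr_ge0// indicE.
  apply: (@le_trans _ _
    (K%:E * ((M * expR (- (kappa * r)))%:E * \int[mu]_x (g x)%:E))%E).
    apply: lee_wpmul2l; first by rewrite lee_fin.
    rewrite -ge0_integralZl_EFin//; last by move=> x _; rewrite lee_fin.
    apply: ge0_integral_mono => x _; rewrite ?lee_fin ?mulr_ge0//.
    rewrite indicE; case: (boolP (phi x \in _)) => [/set_mem|_] /=;
      last by rewrite mulr0 mulr_ge0.
    by rewrite /A /= => /negP; rewrite -ltNge mulr1 => /gphi.
  rewrite muleA -EFinM mulrA; apply: lee_wpmul2r; last by rewrite lee_fin.
  by apply: integral_ge0 => x _; rewrite lee_fin.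
have split : (\int[mu]_x (g x)%:E =
    \int[mu]_x (g x * \1_A x)%:E + \int[mu]_x (g x * \1_(~` A) x)%:E)%E.
  rewrite -ge0_integralD//; last 4 first.
  - by move=> x _; rewrite lee_fin mulr_ge0// indicE.
  - exact: mgA.
  - by move=> x _; rewrite lee_fin mulr_ge0// indicE.
  - by apply: mgA; exact: measurableC.
  apply: eq_integral => x _; rewrite -EFinD -mulrDr !indicE in_setC.
  by case: (_ \in _); rewrite ?addr0 ?add0r mulr1.
have I0 : (0 <= \int[mu]_x (g x)%:E)%E by apply: integral_ge0 => x _;
  rewrite lee_fin.
have P1 : (0 <= \int[mu]_x (g x * \1_A x)%:E)%E.
  by apply: integral_ge0 => x _; rewrite lee_fin mulr_ge0// indicE.
have P2 : (0 <= \int[mu]_x (g x * \1_(~` A) x)%:E)%E.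
  by apply: integral_ge0 => x _; rewrite lee_fin mulr_ge0// indicE.
rewrite AE; move: split tail goo I0 P1 P2.
move: (\int[mu]_x (g x)%:E)%E => I.
move: (\int[mu]_x (g x * \1_A x)%:E)%E => a.
move: (\int[mu]_x (g x * \1_(~` A) x)%:E)%E => b.
case: I => [I| |]//; case: a => [a| |]//; case: b => [b| |]//.
rewrite -EFinD => -[->]; rewrite -!EFinM !lee_fin => ? _ _ _ _; lra.
Qed.

End scaling_tail.

Lemma sfprodE d1 d2 (T1 : measurableType d1) (T2 : measurableType d2)
    (R : realType) (m1 : {sigma_finite_measure set T1 -> \bar R})
    (m2 : {sigma_finite_measure set T2 -> \bar R}) (A : set T1) (B : set T2) :
  measurable A -> measurable B -> sfprod m1 m2 (A `*` B) = (m1 A * m2 B)%E.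
Proof. exact: product_measure1E. Qed.

Lemma ratio_ge (R : realType) (u v eps I M F : R) : 0 < u -> 0 <= v ->
    0 <= eps -> 0 < I -> 0 < M -> M <= u * I -> u * v * eps <= F ->
  eps * v / I <= F / M.
Proof.
move=> u0 v0 eps0 I0 M0 MuI uvF; rewrite ler_pdivlMr// (le_trans _ uvF)//.
apply: (@le_trans _ _ (eps * v / I * (u * I))).
  by rewrite ler_wpM2l// !mulr_ge0// invr_ge0 ltW.
by rewrite le_eqVlt; apply/orP; left; apply/eqP; field; rewrite gt_eqF.
Qed.

(** One update: the conditional density [g / m] gives [A] at least half of the mass, and from there
    the later updates succeed with probability at least [delta]. *)
Lemma integral_cond_hit d (T : measurableType d) (R : realType)
    (mu : {measure set T -> \bar R}) (D A : set T) (g : T -> R)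
    (m delta : R) (h : T -> \bar R) :
    measurable D -> measurable A -> measurable_fun setT g ->
    (forall x, 0 <= g x) -> (forall x, ~ D x -> g x = 0) -> 0 < m ->
    (2^-1%:E * m%:E <= \int[mu]_(x in A) (g x)%:E)%E -> 0 <= delta ->
    (forall x, 0 <= h x)%E -> (forall x, D x -> A x -> delta%:E <= h x)%E ->
  ((2^-1 * delta)%:E <= \int[mu]_(x in D) ((g x / m)%:E * h x))%E.
Proof.
move=> mD mA mg g0 gD m0 hA delta0 h0 hdelta.
apply: (@le_trans _ _ (\int[mu]_(x in A) ((delta / m)%:E * (g x)%:E)))%E.
  rewrite ge0_integralZl_EFin//; last 3 first.
  - by move=> x _; rewrite lee_fin.
  - by apply/measurable_EFinP; exact: measurable_funTS.
  - by rewrite mulr_ge0// invr_ge0 ltW.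
  apply: (@le_trans _ _ ((delta / m)%:E * (2^-1%:E * m%:E)))%E.
    by rewrite -!EFinM lee_fin le_eqVlt; apply/orP; left; apply/eqP; field;
      rewrite gt_eqF.
  by apply: lee_wpmul2l => //; rewrite lee_fin mulr_ge0// invr_ge0 ltW.
rewrite integral_mkcond [leRHS]integral_mkcond; apply: ge0_integral_mono => x _.
  rewrite patchE; case: ifPn => // _.
  by rewrite -EFinM lee_fin !mulr_ge0// invr_ge0 ltW.
have gh0 : (0 <= (g x / m)%:E * h x)%E.
  by rewrite mule_ge0// lee_fin mulr_ge0// invr_ge0 ltW.
rewrite !patchE; case: ifPn => [/set_mem Ax|_]; last by case: ifPn.
case: ifPn => [/set_mem Dx|nDx]; last first.
  by rewrite gD ?mule0// => Dx; move/negP: nDx; apply; rewrite inE.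
rewrite -EFinM (_ : delta / m * g x = g x / m * delta) ?EFinM; last by ring.
apply: lee_wpmul2l; last exact: hdelta.
by rewrite lee_fin mulr_ge0// invr_ge0 ltW.
Qed.

(* x, y and s stand for A, (nu, theta, beta) and Sigma; the coupling e is the
   only factor that mixes the blocks. *)
Section product_form.
Context dX dY dS (X : measurableType dX) (Y : measurableType dY)
  (S : measurableType dS) (R : realType).
Variables (muX : {sigma_finite_measure set X -> \bar R})
  (muY : {sigma_finite_measure set Y -> \bar R})
  (muS : {sigma_finite_measure set S -> \bar R}).
Variables (D : set S) (a : S -> R) (b : Y -> R) (c : X -> R).
Variable e : X -> Y -> S -> R.

Definition product_form (z : X * Y * S) : R :=
  a z.2 * b z.1.2 * c z.1.1 * e z.1.1 z.1.2 z.2.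

Local Notation f := product_form.

Hypothesis mD : measurable D.
Hypothesis ma : measurable_fun setT a.
Hypothesis mb : measurable_fun setT b.
Hypothesis mc : measurable_fun setT c.
Hypothesis mf : measurable_fun setT f.
Hypothesis a_gt0 : forall s, D s -> 0 < a s.
Hypothesis aD : forall s, ~ D s -> a s = 0.
Hypothesis b0 : forall y, 0 < b y.
Hypothesis c0 : forall x, 0 < c x.
Hypothesis e0 : forall x y s, D s -> 0 < e x y s.
Hypothesis e1 : forall x y s, D s -> e x y s <= 1.
Hypothesis intA : (0 < \int[muS]_s (a s)%:E < +oo)%E.
Hypothesis intB : (0 < \int[muY]_y (b y)%:E < +oo)%E.
Hypothesis intC : (0 < \int[muX]_x (c x)%:E < +oo)%E.

Local Notation lam := (sfprod (sfprod muX muY) muS).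

Let a_ge0 s : 0 <= a s.
Proof. by have [Ds|nDs] := pselect (D s); [exact/ltW/a_gt0|rewrite aD]. Qed.

Let b_ge0 y : 0 <= b y. Proof. exact/ltW. Qed.
Let c_ge0 x : 0 <= c x. Proof. exact/ltW. Qed.

Let f_ge0 z : 0 <= f z.
Proof.
rewrite /f; have [Ds|nDs] := pselect (D z.2); last by rewrite aD ?mul0r.
by rewrite !mulr_ge0//; exact/ltW/e0.
Qed.

Let f_gt0 x y s : D s -> 0 < f (x, y, s).
Proof. by move=> Ds; rewrite /f !mulr_gt0//= ?a_gt0 ?e0. Qed.

Let fD x y s : ~ D s -> f (x, y, s) = 0.
Proof. by move=> nDs; rewrite /f /= aD ?mul0r. Qed.

Let f_le z : f z <= a z.2 * b z.1.2 * c z.1.1.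
Proof.
rewrite /f; have [Ds|nDs] := pselect (D z.2); last by rewrite aD ?mul0r.
by rewrite ler_piMr ?e1// !mulr_ge0.
Qed.

Let IA := fine (\int[muS]_s (a s)%:E)%E.
Let IB := fine (\int[muY]_y (b y)%:E)%E.
Let IC := fine (\int[muX]_x (c x)%:E)%E.

Let IAE : (\int[muS]_s (a s)%:E = IA%:E)%E.
Proof.
by have /andP[h0 hoo] := intA; rewrite /IA fineK// ge0_fin_numE// ltW.
Qed.
Let IBE : (\int[muY]_y (b y)%:E = IB%:E)%E.
Proof.
by have /andP[h0 hoo] := intB; rewrite /IB fineK// ge0_fin_numE// ltW.
Qed.
Let ICE : (\int[muX]_x (c x)%:E = IC%:E)%E.
Proof.
by have /andP[h0 hoo] := intC; rewrite /IC fineK// ge0_fin_numE// ltW.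
Qed.

Let IA0 : 0 < IA. Proof. by rewrite -lte_fin -IAE; case/andP: intA. Qed.
Let IB0 : 0 < IB. Proof. by rewrite -lte_fin -IBE; case/andP: intB. Qed.
Let IC0 : 0 < IC. Proof. by rewrite -lte_fin -ICE; case/andP: intC. Qed.

Let mfx y s : measurable_fun setT (fun x => f (x, y, s)).
Proof. exact: (measurable_fun_pair1 y (measurable_fun_pair1 s mf)). Qed.
Let mfy x s : measurable_fun setT (fun y => f (x, y, s)).
Proof. exact: (measurable_fun_pair2 x (measurable_fun_pair1 s mf)). Qed.
Let mfs x y : measurable_fun setT (fun s => f (x, y, s)).
Proof. exact: (measurable_fun_pair2 (x, y) mf). Qed.

Let integral_le_scale d (T : measurableType d)
    (mu : {measure set T -> \bar R}) (g h : T -> R) (k I : R) :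
    measurable_fun setT h -> (forall x, 0 <= g x) -> (forall x, 0 <= h x) ->
    0 <= k -> (forall x, g x <= k * h x) -> (\int[mu]_x (h x)%:E = I%:E)%E ->
  (\int[mu]_x (g x)%:E <= (k * I)%:E)%E.
Proof.
move=> mh g0 h0 k0 gh IE; rewrite EFinM -IE -ge0_integralZl_EFin//;
  last 2 first.
- by move=> x _; rewrite lee_fin.
- exact/measurable_EFinP.
by apply: ge0_integral_mono => x _; rewrite -?EFinM lee_fin.
Qed.

Let intS_le x y :
  (\int[muS]_(s in D) (f (x, y, s))%:E <= (b y * c x * IA)%:E)%E.
Proof.
apply: (@le_trans _ _ (\int[muS]_s (f (x, y, s))%:E)%E).
  apply: ge0_subset_integral => //; first exact/measurable_EFinP.
  by move=> s _; rewrite lee_fin.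
apply: (@integral_le_scale _ _ _ _ a) => //; first by rewrite mulr_ge0.
by move=> s; apply: le_trans (f_le _) _; rewrite /= -mulrA mulrC.
Qed.

Let intY_le x s : (\int[muY]_y (f (x, y, s))%:E <= (a s * c x * IB)%:E)%E.
Proof.
apply: (@integral_le_scale _ _ _ _ b) => //; first by rewrite mulr_ge0.
by move=> y; apply: le_trans (f_le _) _; rewrite /= mulrAC.
Qed.

Let intX_le y s : (\int[muX]_x (f (x, y, s))%:E <= (a s * b y * IC)%:E)%E.
Proof. by apply: (@integral_le_scale _ _ _ _ c) => //; rewrite mulr_ge0. Qed.

(** Here and in the next two facts, non-nullity is read off from the positivity of the integral of a
    factor. *)
Let muD : muS D != 0%E.
Proof.
apply: (@integral_gt0_measure _ _ _ _ _ (EFin \o a)) => //.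
- by apply/measurable_EFinP; exact: measurable_funTS.
- by move=> s _; rewrite lee_fin.
rewrite integral_mkcond (eq_integral (EFin \o a)); first by case/andP: intA.
move=> s _; rewrite patchE; case: ifPn => // sD /=; rewrite aD// => Ds.
by move/negP: sD; apply; rewrite inE.
Qed.

Let muXT : muX setT != 0%E.
Proof.
apply: (@integral_gt0_measure _ _ _ _ _ (EFin \o c)) => //.
- exact/measurable_EFinP.
- by move=> s _; rewrite lee_fin.
- by case/andP: intC.
Qed.

Let muYT : muY setT != 0%E.
Proof.
apply: (@integral_gt0_measure _ _ _ _ _ (EFin \o b)) => //.
- exact/measurable_EFinP.
- by move=> s _; rewrite lee_fin.
- by case/andP: intB.
Qed.

Let margS_gt0 x y : (0 < \int[muS]_(s in D) (f (x, y, s))%:E < +oo)%E.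
Proof.
apply/andP; split; last by rewrite (le_lt_trans (intS_le x y))// ltry.
apply: integral_gt0 => //.
- by apply/measurable_EFinP; exact: measurable_funTS.
- by move=> s Ds; rewrite lte_fin f_gt0.
Qed.

Let margY_gt0 x s : D s -> (0 < \int[muY]_y (f (x, y, s))%:E < +oo)%E.
Proof.
move=> Ds; apply/andP; split;
  last by rewrite (le_lt_trans (intY_le x s))// ltry.
apply: integral_gt0 => //; first exact/measurable_EFinP.
by move=> y _; rewrite lte_fin f_gt0.
Qed.

Let margX_gt0 y s : D s -> (0 < \int[muX]_x (f (x, y, s))%:E < +oo)%E.
Proof.
move=> Ds; apply/andP; split;
  last by rewrite (le_lt_trans (intX_le y s))// ltry.
apply: integral_gt0 => //; first exact/measurable_EFinP.
by move=> y' _; rewrite lte_fin f_gt0.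
Qed.

(** Finite because [e] is at most 1, which leaves a product of three finite integrals; positive
    because [f] is positive on the cylinder over [D], which is not null. *)
Lemma integral_product_form : (0 < \int[lam]_z (f z)%:E < +oo)%E.
Proof.
have mEf : measurable_fun setT (EFin \o f) by exact/measurable_EFinP.
apply/andP; split; last first.
  rewrite sfprod_tonelli2//.
  apply: (@le_lt_trans _ _ (\int[muS]_s ((IC * IB)%:E * (a s)%:E))%E).
    apply: ge0_integral_mono => [s _|s _].
      by apply: integral_ge0 => z _; rewrite lee_fin.
    rewrite sfprod_tonelli2//; last 2 first.
    - by apply/measurable_EFinP; exact: (measurable_fun_pair1 s mf).
    - by move=> z; rewrite lee_fin.
    apply: (@le_trans _ _ (\int[muY]_y ((a s * IC)%:E * (b y)%:E))%E).
      apply: ge0_integral_mono => [y _|y _].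
        by apply: integral_ge0 => z _; rewrite lee_fin.
      by apply: le_trans (intX_le y s) _; rewrite -EFinM lee_fin mulrAC.
    rewrite ge0_integralZl_EFin//; last 3 first.
    - by move=> y _; rewrite lee_fin.
    - exact/measurable_EFinP.
    - by rewrite mulr_ge0// ltW.
    by rewrite IBE -!EFinM lee_fin le_eqVlt; apply/orP; left; apply/eqP; ring.
  rewrite ge0_integralZl_EFin//; last 3 first.
  - by move=> y _; rewrite lee_fin.
  - exact/measurable_EFinP.
  - by rewrite mulr_ge0// ltW.
  by rewrite IAE -EFinM ltry.
apply: (@lt_le_trans _ _
  (\int[lam]_(z in [set z | D z.2]) (f z)%:E)%E); last first.
  apply: ge0_subset_integral => //; last by move=> z _; rewrite lee_fin.
  by rewrite -[X in measurable X]setTI;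
    exact: (@measurable_snd _ _ (X * Y)%type S).
have DE : [set z : X * Y * S | D z.2] = (setT `*` setT) `*` D.
  by apply/seteqP; split => z //= -[].
rewrite DE; apply: integral_gt0.
- by apply: measurableX => //; exact: measurableX.
- exact: measurable_funTS.
- by case=> -[x y] s /= [_ Ds]; rewrite lte_fin f_gt0.
have lamE : lam ((setT `*` setT) `*` D) = (muX setT * muY setT * muS D)%E.
  rewrite -(sfprodE muX muY (@measurableT _ X) (@measurableT _ Y)).
  by apply: sfprodE => //; exact: measurableX.
rewrite [X in X != _%E](_ : _ = muX setT * muY setT * muS D)%E;
  last exact: lamE.
by rewrite !mule_neq0.
Qed.

(** * Doeblin's condition for a product form *)

Hypothesis f_total : (\int[lam]_z (f z)%:E = 1)%E.

Variables (T : S -> R) (NX : X -> R) (NY : Y -> R).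
Hypothesis mT : measurable_fun setT T.
Hypothesis mNX : measurable_fun setT NX.
Hypothesis mNY : measurable_fun setT NY.
Hypothesis e_bounded : forall r, exists2 eps, 0 < eps & forall x y s, D s ->
  T s <= r -> NX x <= r -> NY y <= r -> eps <= e x y s.

Variables (phiS : S -> S) (KS MS kS : R) (phiY : Y -> Y) (KY MY kY : R).
Hypothesis KS0 : 0 <= KS.
Hypothesis MS0 : 0 <= MS.
Hypothesis kS0 : 0 < kS.
Hypothesis phiS_scale : forall h : S -> \bar R, measurable_fun setT h ->
  (forall s, 0 <= h s)%E ->
    (\int[muS]_s h s = KS%:E * \int[muS]_s h (phiS s))%E.
Hypothesis phiS_decay : forall x y s r, r < T (phiS s) ->
  f (x, y, phiS s) <= MS * expR (- (kS * r)) * f (x, y, s).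
Hypothesis KY0 : 0 <= KY.
Hypothesis MY0 : 0 <= MY.
Hypothesis kY0 : 0 < kY.
Hypothesis phiY_scale : forall h : Y -> \bar R, measurable_fun setT h ->
  (forall y, 0 <= h y)%E ->
    (\int[muY]_y h y = KY%:E * \int[muY]_y h (phiY y))%E.
Hypothesis phiY_decay : forall x y s r, D s -> r < NY (phiY y) ->
  f (x, phiY y, s) <= MY * expR (- (kY * r)) * f (x, y, s).

Theorem product_form_geometrically_ergodic (E : set (X * Y * S))
    (Pi : set (X * Y * S) -> \bar R) :
  (forall B, measurable B -> B `<=` E -> Pi B =
    (\int[lam]_(z in B) (f z)%:E)%E) ->
  geometrically_ergodic E (gibbs_step muX muY muS D f) Pi.
Proof.
move=> PiE.
have [rS rSP] := expR_small (mulr_ge0 KS0 MS0) kS0.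
have [rY rYP] := expR_small (mulr_ge0 KY0 MY0) kY0.
(* [x] is resampled last, when [s] and [y] are already good. It needs no tail estimate, only a
   sublevel set that is not null. *)
have [rX rXP] := measure_sublevel_neq0 mNX muXT.
pose r := Num.max rS (Num.max rY rX).
have rSr : rS <= r by rewrite /r le_max lexx.
have rYr : rY <= r by rewrite /r !le_max lexx !orbT.
have rXr : rX <= r by rewrite /r !le_max lexx !orbT.
have [eps eps0 epsP] := e_bounded r.
pose AX := [set x | NX x <= r]; pose AY := [set y | NY y <= r].
pose AS := [set s | T s <= r].
have mAX : measurable AX by exact: measurable_sublevel.
have mAY : measurable AY by exact: measurable_sublevel.
have mAS : measurable AS by exact: measurable_sublevel.
have intSD x y :
  (\int[muS]_s (f (x, y, s))%:E = \int[muS]_(s in D) (f (x, y, s))%:E)%E.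
  rewrite [RHS]integral_mkcond; apply: eq_integral => s _; rewrite patchE.
  by case: ifPn => // sD; rewrite fD// => Ds; move/negP: sD; apply; rewrite inE.
have hitS x y : (2^-1%:E * \int[muS]_s (f (x, y, s))%:E <=
    \int[muS]_(s in AS) (f (x, y, s))%:E)%E.
  apply: (scaling_tail_half (kappa := kS) mT MS0 KS0 phiS_scale) => //.
  - by move=> s; exact: phiS_decay.
  - exact: rSP.
  - by rewrite intSD; case/andP: (margS_gt0 x y).
have hitY x s : D s -> (2^-1%:E * \int[muY]_y (f (x, y, s))%:E <=
    \int[muY]_(y in AY) (f (x, y, s))%:E)%E.
  move=> Ds; apply: (scaling_tail_half (kappa := kY) mNY MY0 KY0
    phiY_scale) => //.
  - by move=> y; exact: phiY_decay.
  - exact: rYP.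
  - by have /andP[] := margY_gt0 x Ds.
have muAX : muX AX != 0%E by exact: rXP.
have mEc : measurable_fun setT (EFin \o c) by exact/measurable_EFinP.
have muAY : muY AY != 0%E.
  have [s Ds] : exists s, D s.
    have [//|nD] := pselect (exists s, D s).
    move/negP: muD; case; rewrite (_ : D = set0) ?measure0//.
    by apply/seteqP; split => // s Ds; apply: nD; exists s.
  have /andP[h0 _] := margY_gt0 point Ds.
  apply: (@integral_gt0_measure _ _ _ _ _
    (fun y => (f (point, y, s))%:E)) => //.
  - by apply/measurable_EFinP; exact: measurable_funTS.
  - by move=> y _; rewrite lee_fin.
  - by rewrite (lt_le_trans _ (hitY point s Ds))// mule_gt0// lte_fin invr_gt0.
have mASD : measurable (AS `&` D) by exact: measurableI.
have muASD : muS (AS `&` D) != 0%E.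
  have /andP[h0 _] := margS_gt0 point point.
  apply: (@integral_gt0_measure _ _ _ _ _
    (fun s => (f (point, point, s))%:E)) => //.
  - by apply/measurable_EFinP; exact: measurable_funTS.
  - by move=> y _; rewrite lee_fin.
  - have : (0 < \int[muS]_(s in AS) (f (point, point, s))%:E)%E.
      by rewrite (lt_le_trans _ (hitS point point))// mule_gt0
        ?lte_fin ?invr_gt0// intSD.
    suff -> : (\int[muS]_(s in AS) (f (point, point, s))%:E =
      \int[muS]_(s in AS `&` D) (f (point, point, s))%:E)%E by [].
    rewrite integral_mkcond [RHS]integral_mkcond; apply: eq_integral => s _.
    rewrite !patchE in_setI; case: (s \in AS) => //=; case: ifPn => // sD.
    by rewrite fD// => Ds; move/negP: sD; apply; rewrite inE.
pose JX := fine (\int[muX]_(x in AX) (c x)%:E)%E.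
have JXE : (\int[muX]_(x in AX) (c x)%:E = JX%:E)%E.
  rewrite /JX fineK// ge0_fin_numE; last by apply: integral_ge0 => x _;
    rewrite lee_fin.
  apply: (@le_lt_trans _ _ (\int[muX]_x (c x)%:E)%E); last by case/andP: intC.
  by apply: ge0_subset_integral => // x _; rewrite lee_fin.
have JX0 : 0 < JX.
  rewrite -lte_fin -JXE; apply: integral_gt0 => //; last by move=> x _;
    rewrite lte_fin.
  exact: measurable_funTS.
(* [JX / IC] is the share of the mass of [c] in [AX], and [eps] the loss due to the coupling. *)
pose delta := eps * JX / IC.
have delta0 : 0 < delta by rewrite /delta divr_gt0// mulr_gt0.
have mSE x y : ((margS muS D f x y)%:E = \int[muS]_(s in D) (f (x, y, s))%:E)%E.
  by have /andP[h0 hoo] := margS_gt0 x y;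
    rewrite /margS fineK// ge0_fin_numE// ltW.
have mYE x s : D s -> ((margY muY f x s)%:E = \int[muY]_y (f (x, y, s))%:E)%E.
  by move=> /(margY_gt0 x)/andP[h0 hoo];
    rewrite /margY fineK// ge0_fin_numE// ltW.
have mXE y s : D s -> ((margX muX f y s)%:E = \int[muX]_x (f (x, y, s))%:E)%E.
  by move=> /(margX_gt0 y)/andP[h0 hoo];
    rewrite /margX fineK// ge0_fin_numE// ltW.
have mS0 x y : 0 < margS muS D f x y.
  by rewrite -lte_fin mSE; case/andP: (margS_gt0 x y).
have mY0 x s : D s -> 0 < margY muY f x s.
  by move=> Ds; rewrite -lte_fin mYE//; case/andP: (margY_gt0 x Ds).
have mX0 y s : D s -> 0 < margX muX f y s.
  by move=> Ds; rewrite -lte_fin mXE//; case/andP: (margX_gt0 y Ds).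
(* This bound and the next two: the coupling is at least [eps] in the numerator, and at most 1 in
   the normalizing constant. *)
have cX x y s : D s -> T s <= r -> NX x <= r -> NY y <= r ->
    eps * c x / IC <= f (x, y, s) / margX muX f y s.
  move=> Ds Ts xr yr; apply: (@ratio_ge _ (a s * b y));
    rewrite ?(ltW eps0)// ?mX0//.
  - by rewrite mulr_gt0// a_gt0.
  - by rewrite -lee_fin mXE// intX_le.
  - by rewrite /f ler_wpM2l ?epsP// !mulr_ge0.
have cY x y s : D s -> T s <= r -> NX x <= r -> NY y <= r ->
    eps * b y / IB <= f (x, y, s) / margY muY f x s.
  move=> Ds Ts xr yr; apply: (@ratio_ge _ (a s * c x));
    rewrite ?(ltW eps0)// ?mY0//.
  - by rewrite mulr_gt0// a_gt0.
  - by rewrite -lee_fin mYE// intY_le.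
  - by rewrite /f (mulrAC (a s)) ler_wpM2l ?epsP// !mulr_ge0.
have cS x y s : D s -> T s <= r -> NX x <= r -> NY y <= r ->
    eps * a s / IA <= f (x, y, s) / margS muS D f x y.
  move=> Ds Ts xr yr; apply: (@ratio_ge _ (b y * c x)); rewrite ?(ltW eps0)//.
  - by rewrite mulr_gt0.
  - by rewrite -lee_fin mSE// intS_le.
  - by rewrite /f (mulrC (b y * _)) mulrA ler_wpM2l ?epsP// !mulr_ge0.
(* No condition on [s]: the next step forgets it. *)
pose C := [set z : X * Y * S | NX z.1.1 <= r /\ NY z.1.2 <= r].
have CE : C = (AX `*` AY) `*` setT by apply/seteqP; split => z //= [].
have mC : measurable C by rewrite CE; apply: measurableX => //;
  exact: measurableX.
have cX0 x y s : 0 <= f (x, y, s) / margX muX f y s.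
  by rewrite mulr_ge0// invr_ge0 fine_ge0// integral_ge0// => *;
    rewrite lee_fin.
(* One factor 1/2 for the update of [s], one for that of [y], and [delta] for that of [x]; the start
   [z] is arbitrary. *)
have hit z : ((2^-1 * (2^-1 * delta))%:E <= gibbs_step muX muY muS D f z C)%E.
  case: z => -[x y] s0; rewrite /gibbs_step.
  apply: (@integral_cond_hit _ _ _ _ _ AS) => //.
  - by move=> s; exact: fD.
  - by rewrite mSE -intSD.
  - by rewrite mulr_ge0// ltW.
  - move=> s; apply: integral_ge0 => y' _; apply: mule_ge0.
      by rewrite lee_fin mulr_ge0// invr_ge0 fine_ge0// integral_ge0// => *;
        rewrite lee_fin.
    by apply: integral_ge0 => x' _; rewrite -EFinM lee_fin mulr_ge0.
  move=> s Ds Ts; apply: (@integral_cond_hit _ _ _ _ _ AY) => //.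
  - by move=> y' /(_ Logic.I).
  - exact: mY0.
  - by rewrite mYE// hitY.
  - exact: ltW.
  - by move=> y'; apply: integral_ge0 => x' _; rewrite -EFinM lee_fin mulr_ge0.
  move=> y' _ yr.
  rewrite /delta mulrAC EFinM -JXE -ge0_integralZl_EFin//; last 3 first.
  - by move=> x' _; rewrite lee_fin.
  - exact: measurable_funTS.
  - by rewrite mulr_ge0// ?invr_ge0 ltW.
  rewrite integral_mkcond; apply: ge0_integral_mono => x' _; rewrite patchE.
    by case: ifPn => // _; rewrite -EFinM lee_fin !mulr_ge0// ?invr_ge0 ltW.
  case: ifPn => [/set_mem xr|_]; last by rewrite -EFinM lee_fin mulr_ge0.
  rewrite -!EFinM lee_fin indicE mem_set//= mulr1.
  by apply: le_trans (cX x' y' s Ds Ts xr yr); rewrite mulrAC.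
pose G := (AX `*` AY) `*` (AS `&` D).
have mG : measurable G by apply: measurableX => //; exact: measurableX.
(* The product of the three lower bounds, which depends on the new state alone. It is valid when the
   old [x] and [y] and the whole new state are good; the latter is enforced by the indicator of
   [G]. *)
pose g (z : X * Y * S) := eps * a z.2 / IA *
  (eps * b z.1.2 / IB * (eps * c z.1.1 / IC)).
have mg : measurable_fun setT g.
  apply: measurable_funM; first by do 2 apply: measurable_funM => //;
    exact: measurableT_comp.
  apply: measurable_funM; apply: measurable_funM => //;
    apply: measurable_funM => //.
    by apply: (measurableT_comp mb); exact: measurableT_comp.
  by apply: (measurableT_comp mc); exact: measurableT_comp.
have g0 z : 0 <= g z by rewrite /g !mulr_ge0// ?invr_ge0 ltW.
pose gG z := g z * \1_G z.
have gGE z : (gG z)%:E = ((fun z => (g z)%:E) \_ G) z.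
  by rewrite patchE /gG indicE; case: ifPn; rewrite ?mulr1 ?mulr0.
apply: (@doeblin_geometrically_ergodic _ _ _ lam _ _ _
  (gibbs_density muX muY muS D f) f
  _ _ _ _ _ _ _ _ _ _ C (2^-1 * (2^-1 * delta)) gG) => //.
- exact: measurable_gibbs_density.
- exact: gibbs_density_ge0.
- exact: gibbs_density1.
- exact: gibbs_step_ge0.
- by move=> z B mB; exact: gibbs_stepE.
- exact: gibbs_invariant.
- by rewrite !mulr_gt0// invr_gt0.
- by apply: measurable_funM => //; exact: measurable_indic.
- by move=> z; rewrite mulr_ge0// indicE.
- under eq_integral do rewrite gGE.
  rewrite -integral_mkcond; apply: integral_gt0 => //.
  + by apply/measurable_EFinP; exact: measurable_funTS.
  + move=> [[x y] s] [_ [_ Ds]]; rewrite lte_fin /g.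
    by rewrite !mulr_gt0// ?invr_gt0// a_gt0.
  have lamE : lam G = (muX AX * muY AY * muS (AS `&` D))%E.
    rewrite -(sfprodE muX muY mAX mAY).
    by apply: sfprodE => //; exact: measurableX.
  rewrite [X in X != _%E](_ : _ = muX AX * muY AY * muS (AS `&` D))%E;
    last exact: lamE.
  by rewrite !mule_neq0.
- move=> [[x y] s] [xr yr] [[x' y'] s']; rewrite /gG indicE.
  case: (boolP (_ \in G)) => [/set_mem [/= [xr' yr'] [Ts' Ds']]|_]; last first.
    by rewrite mulr0; exact: gibbs_density_ge0.
  rewrite mulr1 /g /gibbs_density /=.
  rewrite ler_pM//; try (by rewrite !mulr_ge0// ?invr_ge0 ltW).
  + exact: cS.
  + rewrite ler_pM//; try (by rewrite !mulr_ge0// ?invr_ge0 ltW).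
    * exact: cY.
    * exact: cX.
Qed.

End product_form.

(** * Symmetric positive-definite matrices *)

Section spd_theory.
Context {R : realType}.

Lemma qformE d (M : 'M[R]_d) v :
  qform M v = \sum_i \sum_j v i 0 * M i j * v j 0.
Proof.
rewrite /qform mxE exchange_big /=; apply: eq_bigr => j _.
by rewrite mxE big_distrl; apply: eq_bigr => i _; rewrite mxE.
Qed.

Lemma qformD d (M N : 'M[R]_d) v : qform (M + N) v = qform M v + qform N v.
Proof. by rewrite /qform mulmxDr mulmxDl mxE. Qed.

Lemma qformZv d (M : 'M[R]_d) a v : qform M (a *: v) = a ^+ 2 * qform M v.
Proof.
by rewrite /qform -scalemxAr [(a *: v)^T]linearZ /= -!scalemxAl
  scalerA mxE expr2.
Qed.

Lemma qformN d (M : 'M[R]_d) v : qform M (- v) = qform M v.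
Proof. by rewrite -scaleN1r qformZv sqrrN expr1n mul1r. Qed.

Lemma qformZ d (M : 'M[R]_d) a v : qform (a *: M) v = a * qform M v.
Proof. by rewrite /qform -scalemxAr -scalemxAl mxE. Qed.

Lemma qform0 d (M : 'M[R]_d) : qform M 0 = 0.
Proof. by rewrite /qform mulmx0 mxE. Qed.

Lemma qform_ge0 d (M : 'M[R]_d) v : spd M -> 0 <= qform M v.
Proof. by move=> [_ Mp]; have [->|/Mp/ltW//] := eqVneq v 0; rewrite qform0. Qed.

Lemma qform1 d (v : 'cV[R]_d) : qform 1%:M v = \sum_i v i 0 ^+ 2.
Proof.
by rewrite /qform mulmx1 mxE; apply: eq_bigr => i _; rewrite mxE expr2.
Qed.

Lemma spd_sym d (M : 'M[R]_d) : spd M -> M^T = M. Proof. by case. Qed.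

(** On a nonzero vector of the kernel the quadratic form would vanish. *)
Lemma spd_unitmx d (M : 'M[R]_d) : spd M -> M \in unitmx.
Proof.
move=> [Msym Mp]; rewrite -unitmx_tr -row_free_unit -kermx_eq0.
apply/eqP/row_matrixP => i; rewrite row0.
have [//|i0] := eqVneq (row i (kermx M^T)) 0.
have := Mp (row i (kermx M^T))^T; rewrite trmx_eq0 => /(_ i0).
rewrite /qform trmxK -mulmxA.
have /(congr1 trmx) : row i (kermx M^T) *m M^T = 0
  by apply/sub_kermxP; exact: row_sub.
by rewrite trmx_mul trmxK => ->; rewrite trmx0 mulmx0 mxE ltxx.
Qed.

Lemma spd_inv d (M : 'M[R]_d) : spd M -> spd (invmx M).
Proof.
move=> Ms; have Mu := spd_unitmx Ms; case: (Ms) => Msym Mp; split.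
  by rewrite trmx_inv Msym.
move=> v v0; suff -> : qform (invmx M) v = qform M (invmx M *m v).
  apply: Mp; apply: contraNneq v0 => iv0.
  by rewrite -[v](mulKVmx Mu) iv0 mulmx0.
by rewrite /qform trmx_mul trmx_inv Msym -!mulmxA mulKVmx.
Qed.

Lemma spdD d (M N : 'M[R]_d) : spd M -> spd N -> spd (M + N).
Proof.
move=> [Ms Mp] [Ns Np]; split; first by rewrite linearD /= Ms Ns.
by move=> v v0; rewrite qformD addr_gt0 ?Mp ?Np.
Qed.

Lemma spdZ d (M : 'M[R]_d) a : 0 < a -> spd M -> spd (a *: M).
Proof.
move=> a0 [Ms Mp]; split; first by rewrite linearZ /= Ms.
by move=> v v0; rewrite qformZ mulr_gt0 ?Mp.
Qed.

Lemma spd0 (M : 'M[R]_0) : spd M.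
Proof. by split; [apply/matrixP => -[]|move=> v; rewrite flatmx0 eqxx]. Qed.

(** The Schur complement of the corner entry. The upper right block is taken to be the transpose of
    the lower left one, so it is meant for symmetric [M]. *)
Definition schur m (M : 'M[R]_(1 + m)) : 'M[R]_m :=
  drsubmx M - (M 0 0)^-1 *: (dlsubmx M *m (dlsubmx M)^T).

Lemma sym_blockE m (M : 'M[R]_(1 + m)) : M^T = M ->
  M = block_mx (M 0 0)%:M (dlsubmx M)^T (dlsubmx M) (drsubmx M).
Proof.
move=> Ms; rewrite -{1}[M]submxK; congr block_mx.
  rewrite [ulsubmx M]mx11_scalar !mxE. congr ((M _ _)%:M); exact: val_inj.
by rewrite trmx_dlsub Ms.
Qed.

(** Completing the square in the first coordinate. *)
Lemma qform_schur m (M : 'M[R]_(1 + m)) x (z : 'cV[R]_m) : M^T = M ->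
  M 0 0 != 0 ->
  qform M (col_mx x%:M z) =
  M 0 0 * (x + ((dlsubmx M)^T *m z) 0 0 / M 0 0) ^+ 2 + qform (schur M) z.
Proof.
move=> Ms t0; rewrite {1}(sym_blockE Ms).
set t := M 0 0; set v := dlsubmx M; set W := drsubmx M.
rewrite /schur -/t -/v -/W qformD -scaleNr qformZ.
have -> : qform (v *m v^T) z = ((v^T *m z) 0 0) ^+ 2.
  rewrite /qform mulmxA -mulmxA [z^T *m v]mx11_scalar [v^T *m z]mx11_scalar.
  rewrite -scalar_mxM !mxE eqxx mulr1n expr2; congr (_ * _).
  by apply: eq_bigr => i _; rewrite !mxE mulrC.
rewrite {1}/qform tr_col_mx mul_row_block mul_row_col !mulmxDl tr_scalar_mx.
rewrite !mul_scalar_mx !mul_mx_scalar -!scalemxAl.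
have zv : (z^T *m v) 0 0 = (v^T *m z) 0 0.
  by rewrite !mxE; apply: eq_bigr => i _; rewrite !mxE mulrC.
rewrite 4!mxE [t%:M _ _]mxE eqxx mulr1n [(x *: (z^T *m v)) _ _]mxE zv.
rewrite [(_ + z^T *m W *m z) _ _]mxE [(x *: (v^T *m z)) _ _]mxE -/(qform W z).
by field.
Qed.

(** The recursion on the size behind the factorization, the sign of the determinant, the
    measurability of the cone and the inverse-Wishart integrals. *)
Lemma spdS m (M : 'M[R]_(1 + m)) :
  spd M <-> [/\ M^T = M, 0 < M 0 0 & spd (schur M)].
Proof.
split=> [[Ms Mp]|[Ms t0 [Ss Sp]]].
  have t0 : 0 < M 0 0.
    have := Mp (delta_mx 0 0).
    rewrite /qform trmx_delta -rowE -colE !mxE; apply.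
    by apply/eqP => /matrixP/(_ 0 0)/eqP; rewrite !mxE !eqxx oner_eq0.
  split=> //; split.
    rewrite /schur linearB /= trmx_drsub Ms linearZ /= trmx_mul trmxK //.
  move=> z z0.
  (* The first coordinate is chosen to cancel the square, which leaves the form of the Schur
     complement. *)
  have := @qform_schur m M (- (((dlsubmx M)^T *m z) 0 0 / M 0 0)) z Ms
    (lt0r_neq0 t0).
  rewrite addNr expr0n mulr0 add0r => <-; apply: Mp.
  apply: contraNneq z0 => /eqP; rewrite col_mx_eq0 => /andP[_ //].
split=> // u u0;
  rewrite -[u]vsubmxK [usubmx u]mx11_scalar qform_schur ?gt_eqF//.
have [z0|z0] := eqVneq (dsubmx u) 0.
  rewrite z0 qform0 addr0 mulmx0.
  have -> : (0 : 'M[R]_1) 0 0 = 0 by rewrite mxE.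
  rewrite mul0r addr0.
  rewrite mulr_gt0// lt0r sqr_ge0 andbT.
  rewrite sqrf_eq0; apply: contraNneq u0 => x0.
  by rewrite -[u]vsubmxK z0 [usubmx u]mx11_scalar x0 raddf0 col_mx0.
by rewrite ltr_wpDl ?Sp// mulr_ge0 ?sqr_ge0// ltW.
Qed.

(** The Cholesky factorization, built one column at a time. *)
Lemma spd_factor m (M : 'M[R]_m) : spd M -> exists C : 'M[R]_m, M = C *m C^T.
Proof.
elim: m M => [|m IH] M; first by exists 0; apply/matrixP => -[].
move=> /(@spdS m)[Ms t0 /IH [C CE]].
have t0' : 0 <= M 0 0 by exact: ltW.
pose C' : 'M[R]_(1 + m) := block_mx (Num.sqrt (M 0 0))%:M 0
  ((Num.sqrt (M 0 0))^-1 *: dlsubmx (M : 'M[R]_(1 + m))) C.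
suff ME : (M : 'M[R]_(1 + m)) = C' *m C'^T by exists C'.
rewrite {1}(@sym_blockE m M Ms) /C' tr_block_mx mulmx_block !trmx0.
have sn : Num.sqrt (M 0 0) != 0 by rewrite gt_eqF// sqrtr_gt0.
rewrite !(mulmx0, mul0mx) !addr0 tr_scalar_mx !mul_scalar_mx
  mul_mx_scalar linearZ /=.
rewrite !scalerA mulfV// !scale1r; congr block_mx.
  by rewrite scale_scalar_mx -expr2 sqr_sqrtr.
rewrite -CE /schur -scalemxAl -scalemxAr scalerA -invfM -expr2 sqr_sqrtr//.
by rewrite addrC subrK.
Qed.

Lemma det_schur m (M : 'M[R]_(1 + m)) : M^T = M -> M 0 0 != 0 ->
  \det M = M 0 0 * \det (schur M).
Proof.
move=> Ms t0; rewrite {1}(sym_blockE Ms).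
have -> : block_mx (M 0 0)%:M (dlsubmx M)^T (dlsubmx M) (drsubmx M) =
  block_mx 1%:M 0 ((M 0 0)^-1 *: dlsubmx M) 1%:M *m
  block_mx (M 0 0)%:M (dlsubmx M)^T 0 (schur M).
  rewrite mulmx_block !(mul0mx, mulmx0, mul1mx) !addr0 mul_mx_scalar
    scalerA mulfV//.
  by rewrite scale1r /schur -scalemxAl addrC subrK.
by rewrite det_mulmx det_lblock det_ublock !det1 !mul1r det_scalar1.
Qed.

Lemma spd_det_gt0 m (M : 'M[R]_m) : spd M -> 0 < \det M.
Proof.
elim: m M => [|m IH] M; first by rewrite det_mx00.
move=> /(@spdS m)[Ms t0 /IH S0].
by rewrite (@det_schur m)// ?gt_eqF// mulr_gt0.
Qed.

(** The candidate is checked by multiplication; its diagonal blocks give the trace of the inverse in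
    terms of the Schur complement. *)
Lemma spd_inv_block m (M : 'M[R]_(1 + m)) : spd M ->
  let v := dlsubmx M in let X := invmx (schur M) in
  invmx M = block_mx ((M 0 0)^-1 + qform X v / (M 0 0) ^+ 2)%:M
    (- (M 0 0)^-1 *: (v^T *m X)) (- (M 0 0)^-1 *: (X *m v)) X.
Proof.
move=> Mspd v X; have [Ms t0 Sspd] := (spdS M).1 Mspd.
have Su := spd_unitmx Sspd.
set N := block_mx _ _ _ _.
have tn : M 0 0 != 0 by rewrite gt_eqF.
suff MN : M *m N = 1%:M.
  by rewrite -[RHS]mul1mx -(mulVmx (spd_unitmx Mspd)) -mulmxA MN mulmx1.
have WE : drsubmx M = schur M + (M 0 0)^-1 *: (v *m v^T)
  by rewrite /schur subrK.
have qE : v^T *m (X *m v) = (qform X v)%:M.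
  by rewrite mulmxA [LHS]mx11_scalar.
have SX : schur M *m X = 1%:M by rewrite /X mulmxV.
rewrite {1}(sym_blockE Ms) -/v WE /N mulmx_block.
have -> : (1%:M : 'M[R]_(1 + m)) = block_mx 1%:M 0 0 1%:M
  by rewrite -scalar_mx_block.
congr block_mx.
- rewrite -!scalemxAr qE mul_scalar_mx !scale_scalar_mx -raddfD /=;
    congr (_%:M); field.
  by [].
- by rewrite mul_scalar_mx scalerA mulrN mulfV// scaleN1r addNr.
- rewrite mul_mx_scalar -scalemxAr mulmxDl -scalemxAl
    (mulmxA (schur M)) SX mul1mx.
  rewrite -(mulmxA v) qE mul_mx_scalar scalerA scalerDr scalerA
    addrA -!scalerDl.
  by apply/eqP; rewrite scaler_eq0; apply/orP; left; apply/eqP; field.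
- rewrite mulmxDl SX -scalemxAr -scalemxAl mulmxA scaleNr addrCA addNr addr0 //.
Qed.

Lemma mxtrace_inv_schur m (M : 'M[R]_(1 + m)) : spd M ->
  \tr (invmx M) = (M 0 0)^-1 + qform (invmx (schur M)) (dlsubmx M) /
    (M 0 0) ^+ 2
    + \tr (invmx (schur M)).
Proof.
by move=> Ms; rewrite spd_inv_block// mxtrace_block mxtrace_scalar mulr1n.
Qed.

Lemma qform_factor d (C : 'M[R]_d) v :
  qform (C *m C^T) v = \sum_i (C^T *m v) i 0 ^+ 2.
Proof.
rewrite -qform1 /qform mulmx1 trmx_mul trmxK !mulmxA //.
Qed.

(** A substitute for the least eigenvalue: with M = C C^T the form is the squared norm of w = C^T v,
    and v is recovered from w by a fixed matrix. *)
Lemma spd_coercive d (M : 'M[R]_d) : spd M ->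
  exists2 h : R, 0 < h & forall v : 'cV[R]_d,
    h * \sum_i v i 0 ^+ 2 <= qform M v.
Proof.
move=> Ms; have [C CE] := spd_factor Ms.
have Cu : C^T \in unitmx.
  by have := spd_unitmx Ms; rewrite CE unitmx_mul => /andP[].
pose D := invmx C^T; pose s := \sum_i \sum_j `|D i j|.
have s0 : 0 <= s by apply: sumr_ge0 => i _; apply: sumr_ge0.
(* The summand 1 keeps the constant positive when [d] is 0 as well. *)
exists (1 + d%:R * s ^+ 2)^-1;
  first by rewrite invr_gt0 ltr_pwDl// mulr_ge0// sqr_ge0.
move=> v; rewrite CE qform_factor; set w := C^T *m v.
have vE : v = D *m w by rewrite /w mulKmx.
set W := \sum_i w i 0 ^+ 2.
have W0 : 0 <= W by apply: sumr_ge0 => i _; exact: sqr_ge0.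
have ws i : `|w i 0| <= Num.sqrt W.
  rewrite -sqrtr_sqr ler_wsqrtr// /W (bigD1 i)//= lerDl.
  by apply: sumr_ge0 => j _; exact: sqr_ge0.
have vs i : `|v i 0| <= s * Num.sqrt W.
  rewrite vE mxE (le_trans (ler_norm_sum _ _ _))//.
  apply: (@le_trans _ _ ((\sum_j `|D i j|) * Num.sqrt W)).
    by rewrite big_distrl/=; apply: ler_sum => j _; rewrite normrM ler_wpM2l.
  rewrite ler_wpM2r ?sqrtr_ge0// /s [leRHS](bigD1 i)//= lerDl.
  by apply: sumr_ge0 => k _; exact: sumr_ge0.
rewrite mulrC ler_pdivrMr ?ltr_pwDl// ?mulr_ge0 ?sqr_ge0//.
apply: (@le_trans _ _ (\sum_(i < d) s ^+ 2 * W)).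
  apply: ler_sum => i _; rewrite -(sqr_sqrtr W0) -exprMn -[leLHS]real_normK
    ?num_real//.
  by rewrite lerXn2r ?nnegrE// mulr_ge0 ?sqrtr_ge0.
by rewrite sumr_const card_ord -[_ *+ d]mulr_natl mulrA mulrDr mulr1
  [W * _]mulrC lerDr.
Qed.

Lemma trace_factor_mul m (C B : 'M[R]_m) :
  \tr (C *m C^T *m B) = \sum_k qform B (col k C).
Proof.
rewrite -mulmxA mxtrace_mulC; apply: eq_bigr => k _.
rewrite /qform tr_col -row_mul [RHS]mxE [LHS]mxE.
by apply: eq_bigr => i _; rewrite [row _ _ _ _]mxE [col _ _ _ _]mxE.
Qed.

(** Coercivity of [B], applied to each column of a factor of [P]. *)
Lemma spd_trace_mul_ge m (B : 'M[R]_m) : spd B ->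
  exists2 b : R, 0 < b & forall P, spd P -> b * \tr P <= \tr (P *m B).
Proof.
move=> /spd_coercive[b b0 bB]; exists b => // P /spd_factor[C ->].
rewrite -[X in b * \tr X]mulmx1 !trace_factor_mul mulr_sumr.
by apply: ler_sum => k _; rewrite qform1.
Qed.

Lemma spd_entry_le m (P : 'M[R]_m) i j : spd P -> `|P i j| <= \tr P.
Proof.
move=> /spd_factor[C ->]; rewrite -[X in \tr X]mulmx1 trace_factor_mul.
rewrite mxE (le_trans (ler_norm_sum _ _ _))//; apply: ler_sum => k _.
rewrite qform1 mxE normrM; under eq_bigr do rewrite mxE -real_normK ?num_real//.
have [<-|ij] := eqVneq i j.
  by rewrite -expr2 (bigD1 i)//= lerDl; apply: sumr_ge0 => l _; exact: sqr_ge0.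
rewrite (bigD1 i)//= (bigD1 j)/= 1?eq_sym// addrA.
apply: ler_wpDr; first by apply: sumr_ge0 => l _; exact: sqr_ge0.
by have := sqr_ge0 (`|C i k| - `|C j k|);
  have := sqr_ge0 (`|C i k| + `|C j k|); nra.
Qed.

Lemma spd_qform_le m (P : 'M[R]_m) (v : 'cV[R]_m) (t B : R) : spd P ->
    \tr P <= t -> (forall i, `|v i 0| <= B) ->
  qform P v <= m%:R ^+ 2 * t * B ^+ 2.
Proof.
move=> Ps Pt vB; rewrite qformE.
apply: (@le_trans _ _ (\sum_(i < m) \sum_(j < m) B * t * B)).
  apply: ler_sum => i _; apply: ler_sum => j _.
  rewrite (le_trans (ler_norm _))// !normrM ler_pM ?mulr_ge0//.
  by rewrite ler_pM// (le_trans (spd_entry_le i j Ps)).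
rewrite !sumr_const !card_ord -mulrnA -[X in X <= _]mulr_natr natrM le_eqVlt.
by apply/orP; left; apply/eqP; ring.
Qed.

End spd_theory.

(** * Measurability of matrix operations *)

Section measurable_matrix_functions.
Context d (T : measurableType d) (R : realType).

Lemma measurable_fun_entry a b (f : T -> 'M[R]_(a, b)) i j :
  measurable_fun setT f -> measurable_fun setT (fun x => f x i j).
Proof. by move=> mf; apply: (measurableT_comp (measurable_mxentry i j)). Qed.

Lemma measurable_fun_mulmx a b c (f : T -> 'M[R]_(a, b))
  (g : T -> 'M[R]_(b, c)) :
  measurable_fun setT f -> measurable_fun setT g ->
  measurable_fun setT (fun x => f x *m g x).
Proof.
move=> mf mg; apply: measurable_fun_mx => i j; under eq_fun do rewrite mxE.
apply: measurable_sum => k; apply: measurable_funM; exact: measurable_fun_entry.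
Qed.

Lemma measurable_fun_addmx a b (f g : T -> 'M[R]_(a, b)) :
  measurable_fun setT f -> measurable_fun setT g ->
  measurable_fun setT (fun x => f x + g x).
Proof.
move=> mf mg; apply: measurable_fun_mx => i j; under eq_fun do rewrite mxE.
apply: measurable_funD; exact: measurable_fun_entry.
Qed.

Lemma measurable_fun_scalemx a b (h : T -> R) (f : T -> 'M[R]_(a, b)) :
  measurable_fun setT h -> measurable_fun setT f ->
  measurable_fun setT (fun x => h x *: f x).
Proof.
move=> mh mf; apply: measurable_fun_mx => i j; under eq_fun do rewrite mxE.
apply: measurable_funM => //; exact: measurable_fun_entry.
Qed.

Lemma measurable_fun_oppmx a b (f : T -> 'M[R]_(a, b)) :
  measurable_fun setT f -> measurable_fun setT (fun x => - f x).
Proof.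
move=> mf; under eq_fun do rewrite -scaleN1r.
exact: measurable_fun_scalemx.
Qed.

Lemma measurable_fun_trmx a b (f : T -> 'M[R]_(a, b)) :
  measurable_fun setT f -> measurable_fun setT (fun x => (f x)^T).
Proof.
move=> mf; apply: measurable_fun_mx => i j; under eq_fun do rewrite mxE.
exact: measurable_fun_entry.
Qed.

Lemma measurable_fun_trace n (f : T -> 'M[R]_n) :
  measurable_fun setT f -> measurable_fun setT (fun x => \tr (f x)).
Proof.
by move=> mf; apply: measurable_sum => k; exact: measurable_fun_entry.
Qed.

Lemma measurable_fun_det n (f : T -> 'M[R]_n) :
  measurable_fun setT f -> measurable_fun setT (fun x => \det (f x)).
Proof.
move=> mf; apply: measurable_sum => s; apply: measurable_funM => //.
by apply: measurable_prod => i _; exact: measurable_fun_entry.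
Qed.

Lemma measurable_fun_qform n (f : T -> 'M[R]_n) (g : T -> 'cV[R]_n) :
  measurable_fun setT f -> measurable_fun setT g ->
  measurable_fun setT (fun x => qform (f x) (g x)).
Proof.
move=> mf mg; apply: measurable_fun_entry; apply: measurable_fun_mulmx => //.
by apply: measurable_fun_mulmx => //; exact: measurable_fun_trmx.
Qed.

Lemma measurable_fun_invmx n (f : T -> 'M[R]_n) : measurable_fun setT f ->
  measurable_fun setT (fun x => invmx (f x)).
Proof.
move=> mf; apply: measurable_fun_mx => i j.
have mdet := measurable_fun_det mf.
(* [invmx] returns a singular matrix unchanged, whence the case distinction; elsewhere the cofactor
   formula applies. *)
have -> : (fun x => invmx (f x) i j) = (fun x =>
    if \det (f x) == 0 then f x i j else (\det (f x))^-1 * cofactor (f x) j i).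
  by apply/funext => x; rewrite /invmx unitmxE unitfE; case: eqP => _ //=;
    rewrite !mxE.
apply: measurable_fun_ifT.
- by apply: (measurable_fun_eqr (g := cst 0)).
- exact: measurable_fun_entry.
- apply: measurable_funM; first exact: (measurableT_comp (@measurable_inv R)).
  apply: measurable_funM => //; apply: measurable_fun_det.
  apply: measurable_fun_mx => a b; under eq_fun do rewrite !mxE.
  exact: measurable_fun_entry.
Qed.

End measurable_matrix_functions.

(** The definition quantifies over uncountably many vectors. [spdS] replaces it by finitely many
    equations, a sign condition and a preimage under [schur]. *)
Lemma measurable_spd (R : realType) m : measurable (@spd R m).
Proof.
elim: m => [|m IH].
  rewrite (_ : @spd R 0 = setT) //; apply/seteqP; split => // M _; exact: spd0.
have mid := @measurable_id _ 'M[R]_(1 + m) setT.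
have mdl : measurable_fun setT (fun M : 'M[R]_(1 + m) => dlsubmx M).
  apply: measurable_fun_mx => i j; under eq_fun do rewrite !mxE.
  exact: measurable_fun_entry.
have ms : measurable_fun setT (@schur R m).
  apply: measurable_fun_addmx.
    apply: measurable_fun_mx => i j; under eq_fun do rewrite !mxE.
    exact: measurable_fun_entry.
  apply: measurable_fun_oppmx; apply: measurable_fun_scalemx.
    apply: (measurableT_comp (@measurable_inv R)); exact: measurable_fun_entry.
  by apply: measurable_fun_mulmx => //; exact: measurable_fun_trmx.
have -> : @spd R (1 + m) = (\bigcap_(ij in [set: 'I_(1 + m) * 'I_(1 + m)])
   [set M : 'M[R]_(1 + m) | M ij.2 ij.1 - M ij.1 ij.2 = 0]) `&`
     ((fun M : 'M[R]_(1 + m) => M 0 0) @^-1` `]0, +oo[ `&` @schur R m @^-1`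
     (@spd R m)).
  apply/seteqP; split => M.
    move=> /spdS[Ms t0 Ss]; split; last by split => //=; rewrite in_itv/= t0.
    by move=> [i j] _ /=; rewrite -{1}Ms mxE subrr.
  move=> [Ms [/= t0 Ss]]; apply/spdS; split => //;
    last by rewrite in_itv/= andbT in t0.
  by apply/matrixP => i j; rewrite mxE; apply/eqP; rewrite -subr_eq0; apply/eqP;
    exact: (Ms (i, j)).
apply: measurableI; last first.
  apply: measurableI; rewrite -[X in measurable X]setTI.
    by apply: (measurable_mxentry 0 0) => //; exact: measurable_itv.
  exact: ms.
apply: fin_bigcap_measurable => // -[i j] _ /=.
rewrite -[X in measurable X]setTI.
have mB : measurable_fun setT (fun M : 'M[R]_(1 + m) => M j i - M i j).
  by apply: measurable_funB; exact: measurable_mxentry.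
exact: (mB measurableT [set 0] (measurable_set1 0)).
Qed.

(** * Lebesgue measure on tuples and matrices *)

Section integral_transfer.
Local Open Scope ereal_scope.
Context d1 d2 (T1 : measurableType d1) (T2 : measurableType d2) (R : realType).

Lemma integral_image (m1 : {measure set T1 -> \bar R})
    (m2 : {measure set T2 -> \bar R}) (f : T1 -> T2) (F : T2 -> \bar R) :
    measurable_fun setT f ->
    (forall A, measurable A -> m2 A = m1 (f @^-1` A)) ->
    measurable_fun setT F -> (forall x, 0 <= F x) ->
  \int[m2]_x F x = \int[m1]_x F (f x).
Proof.
move=> mf m12 mF F0.
transitivity (\int[pushforward m1 f]_x F x).
  apply: eq_measure_integral => //= A mA _; exact: m12.
by rewrite ge0_integral_pushforward.
Qed.

Lemma integral_embed_measure (mu : {sigma_finite_measure set T1 -> \bar R})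
    (f : T1 -> T2) (g : T2 -> T1) (mf : measurable_fun setT f)
    (mg : measurable_fun setT g) (fK : cancel f g) (F : T2 -> \bar R) :
    measurable_fun setT F -> (forall x, 0 <= F x) ->
  \int[embed_measure mu mf mg fK]_x F x = \int[mu]_x F (f x).
Proof. by move=> mF F0; apply: integral_image. Qed.

End integral_transfer.

Section lebesgue_tuple_integral.
Context {R : realType}.
Local Notation mu := (@lebesgue_measure R).

Lemma integral_lebesgue_tuple0 (F : 0.-tuple R -> \bar R) :
  measurable_fun setT F -> (forall t, 0 <= F t)%E ->
  (\int[lebesgue_tuple R 0]_t F t = F [tuple])%E.
Proof. by move=> mF F0; rewrite integral_dirac// diracT mul1e. Qed.

Lemma integral_lebesgue_tupleS n (F : n.+1.-tuple R -> \bar R) :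
  measurable_fun setT F -> (forall t, 0 <= F t)%E ->
  (\int[lebesgue_tuple R n.+1]_t F t =
   \int[mu]_x \int[lebesgue_tuple R n]_t F (cons_pair (x, t)))%E.
Proof.
move=> mF F0; rewrite integral_embed_measure//.
have mFc := measurableT_comp mF (@measurable_cons_pair R n).
by rewrite sfprod_tonelli1.
Qed.

(** By uniqueness of Lebesgue measure, it is enough to compare lengths of half-open intervals. *)
Lemma lebesgue_measure_affine (c a : R) (A : set R) : 0 < c -> measurable A ->
  (mu A = c%:E * mu ((fun x => c * x + a)%R @^-1` A))%E.
Proof.
move=> c0 mA.
pose cn := NngNum (ltW c0).
have mphi : measurable_fun [set: measurableTypeR R]
  (fun x : measurableTypeR R => (c * x + a)%R : measurableTypeR R).
  by apply: measurable_funD => //; exact: measurable_funM.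
pose nu := mscale cn
  (pushforward mu (fun x : measurableTypeR
  R => (c * x + a)%R : measurableTypeR R)).
have -> : (c%:E * mu ((fun x => c * x + a)%R @^-1` A))%E = nu mphi A by [].
apply: (@lebesgue_measure_unique R) => //= _ [[x y]] _ <-.
rewrite /nu /mscale /= /pushforward.
rewrite (_ : _ @^-1` _ = [set` `](x - a) / c, (y - a) / c]]); last first.
  apply/seteqP; split => z; rewrite /= !in_itv/= ltr_pdivrMr// ler_pdivlMr//;
    by rewrite ltrBlDr lerBrDr (mulrC z).
rewrite !lebesgue_measure_itv/= !lte_fin ltr_pM2r ?invr_gt0// ltrD2r.
case: ifPn => _; last by rewrite mule0.
by rewrite -!EFinD -EFinM; congr EFin; field; rewrite gt_eqF.
Qed.

Lemma integral_lebesgue_affine (c a : R) (F : R -> \bar R) : 0 < c ->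
  measurable_fun setT F -> (forall x, 0 <= F x)%E ->
  (\int[mu]_x F x = c%:E * \int[mu]_x F (c * x + a)%R)%E.
Proof.
move=> c0 mF F0; pose cn := NngNum (ltW c0).
have mphi : measurable_fun [set: R] (fun x : R => c * x + a).
  by apply: measurable_funD => //; exact: measurable_funM.
rewrite -[c]/(cn%:num) -(ge0_integral_mscale mu measurableT cn
  (f := fun x => F (c * x + a)%R))//.
  by apply: integral_image => // A mA; exact: (lebesgue_measure_affine a c0 mA).
exact: (measurableT_comp mF mphi).
Qed.

(** One statement for two uses: translations ([c] equal to 1) in the Schur substitution, and
    dilations ([a] equal to 0) in the tail bounds. *)
Lemma integral_lebesgue_tuple_affine n (c : R) (a : n.-tuple R)
    (F : n.-tuple R -> \bar R) : 0 < c ->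
  measurable_fun setT F -> (forall t, 0 <= F t)%E ->
  (\int[lebesgue_tuple R n]_t F t = (c ^+ n)%:E *
   \int[lebesgue_tuple R n]_t F [tuple (c * tnth t i + tnth a i)%R | i < n])%E.
Proof.
move=> c0; elim: n a F => [|n IH] a F mF F0.
  rewrite expr0 mul1e; apply: eq_integral => t _; congr F.
  by apply: eq_from_tnth => -[].
have mtr k (b : k.-tuple R) : measurable_fun [set: k.-tuple R]
    (fun t : k.-tuple R => [tuple (c * tnth t i + tnth b i)%R | i < k]).
  apply/measurable_fun_tnthP => i;
    rewrite (_ : _ \o _ = fun t : k.-tuple R => c * tnth t i + tnth b i).
    apply: measurable_funD => //; apply: measurable_funM => //;
      exact: measurable_tnth.
  by apply/funext => t /=; rewrite tnth_mktuple.
rewrite !integral_lebesgue_tupleS//;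
  last exact: (measurableT_comp mF (mtr _ _)).
pose a' := [tuple tnth a (lift ord0 i) | i < n].
have mFc := measurableT_comp mF (@measurable_cons_pair R n).
transitivity (\int[mu]_x ((c ^+ n)%:E * \int[lebesgue_tuple R n]_t
   F (cons_pair (x, [tuple (c * tnth t i + tnth a' i)%R | i < n]))))%E.
  apply: eq_integral => x _; rewrite -(IH a' (fun t => F (cons_pair (x, t))))//.
  exact: (measurable_fun_pair2 x mFc).
have mG : measurable_fun setT (fun x : R => \int[lebesgue_tuple R n]_t
   F (cons_pair (x, [tuple (c * tnth t i + tnth a' i)%R | i < n])))%E.
  apply: (measurable_fun_fubini_tonelli_F (m2 := lebesgue_tuple R n)
    (fun z => F (cons_pair
      (z.1, [tuple (c * tnth z.2 i + tnth a' i)%R | i < n])))) => //.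
  apply: (measurableT_comp mFc); apply: measurable_fun_pair => //.
  by apply: (measurableT_comp (mtr _ _)).
rewrite ge0_integralZl_EFin//; last 2 first.
- by move=> x _; apply: integral_ge0.
- by rewrite exprn_ge0// ltW.
rewrite (integral_lebesgue_affine (tnth a ord0) c0 mG); last first.
  by move=> x; exact: integral_ge0.
rewrite muleA -EFinM exprSr; congr (_ * _)%E; apply: eq_integral => x _.
apply: eq_integral => t _; congr F; apply: eq_from_tnth => i.
case: (unliftP ord0 i) => [j ->|->].
  by rewrite tnth_mktuple /cons_pair /= !tnthS !tnth_mktuple.
by rewrite tnth_mktuple /cons_pair /= !tnth0.
Qed.

End lebesgue_tuple_integral.

(** * Lebesgue measure is determined by boxes *)

Section lebesgue_box.
Context {R : realType}.
Local Notation mu := (@lebesgue_measure R).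
Local Open Scope ereal_scope.

Definition box n (A : 'I_n -> set R) : set (n.-tuple R) :=
  [set t | forall i, A i (tnth t i)].

Lemma measurable_box n (A : 'I_n -> set R) :
  (forall i, measurable (A i)) -> measurable (box A).
Proof.
move=> mA; have -> : box A = \bigcap_(i in [set: 'I_n])
  (fun t => tnth t i) @^-1` A i.
  by apply/seteqP; split => t /= bt i => [_|]; exact: bt.
apply: fin_bigcap_measurable => // i _; rewrite -[X in measurable X]setTI.
exact: (measurable_tnth i measurableT (mA i)).
Qed.

Lemma lebesgue_tuple_box n (A : 'I_n -> set R) : (forall i, measurable (A i)) ->
  lebesgue_tuple R n (box A) = \big[mule/1]_(i < n) mu (A i).
Proof.
elim: n A => [|n IH] A mA.
  by rewrite big_ord0 /= diracE mem_set// => -[].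
rewrite big_ord_recl -(IH (fun i => A (lift ord0 i)))// -sfprodE//;
  last 2 first.
- exact: mA.
- exact: measurable_box.
rewrite [LHS]/= /embed_measure /pushforward; congr (sfprod _ _ _).
apply/seteqP; split => -[x t] /=.
  move=> bt; split; first by have := bt ord0; rewrite /cons_pair tnth0.
  by move=> i; have := bt (lift ord0 i); rewrite /cons_pair /= tnthS.
move=> [Ax bt] i; case: (unliftP ord0 i) => [j ->|->].
  by rewrite /cons_pair /= tnthS; exact: bt.
by rewrite /cons_pair /= tnth0.
Qed.

Lemma measurable_tuple_boxE n : @measurable _ (n.-tuple R) =
  <<s [set B | exists2 A : 'I_n -> set R, (forall i, measurable (A i)) &
    B = box A] >>.
Proof.
apply/seteqP; split; last first.
  apply: smallest_sub; first exact: sigma_algebra_measurable.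
  by move=> _ [A mA ->]; exact: measurable_box.
apply: smallest_sub; first exact: smallest_sigma_algebra.
move=> B; rewrite -bigcup_seq => -[i _ [C mC <-]].
apply: sub_sigma_algebra; exists (fun j => if j == i then C else setT).
  by move=> j; case: ifP.
rewrite setTI; apply/seteqP; split => t /=.
  by move=> Ct j; case: eqP => // ->.
by move=> /(_ i); rewrite eqxx.
Qed.

(** Boxes are stable under intersection and generate the sigma-algebra, and the cubes [-k, k]^n
    exhaust the space with finite measure. *)
Lemma lebesgue_tuple_unique n (m : {measure set n.-tuple R -> \bar R}) :
  (forall A : 'I_n -> set R, (forall i, measurable (A i)) ->
    m (box A) = \big[mule/1]_(i < n) mu (A i)) ->
  forall B, measurable B -> lebesgue_tuple R n B = m B.
Proof.
move=> mbox B mB.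
pose g (k : nat) : set (n.-tuple R) := box (fun=> `[(- k%:R)%R, k%:R]%classic).
apply: (measure_unique _ g (measurable_tuple_boxE n)) => //.
- move=> _ _ [A mA ->] [A' mA' ->]; exists (fun i => A i `&` A' i).
    by move=> i; exact: measurableI.
  apply/seteqP; split => t; first by move=> [bA bA'] i; split.
  by move=> bt; split => i; case: (bt i).
- by move=> i; exists (fun=> `[(- i%:R)%R, i%:R]%classic).
- apply/seteqP; split => // t _.
  exists (\max_(i < n) (Num.truncn `|tnth t i|).+1)%N => // i.
  rewrite /= in_itv/= -ler_norml (le_trans (ltW (Num.Theory.truncnS_gt _)))//.
  by rewrite ler_nat (leq_bigmax i).
- by move=> _ [A mA ->]; rewrite [RHS]mbox//; exact: lebesgue_tuple_box.
- move=> k; rewrite [X in X < _](_ : _ = \big[mule/1]_(i < n) mu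
    `[(- k%:R)%R, k%:R]%classic); last exact: lebesgue_tuple_box.
  suff fin : \big[mule/1]_(i < n) mu `[(- k%:R)%R, k%:R]%classic \is a fin_num.
    by rewrite ltey_eq fin.
  elim/big_ind : _ => [//|x y|i _]; first exact: fin_numM.
  by rewrite lebesgue_measure_itv/=; case: ifP.
Qed.

End lebesgue_box.

(** * Lebesgue measure on symmetric matrices, by bordering *)

Section lebesgue_sym_recursion.
Context {R : realType}.
Local Notation mu := (@lebesgue_measure R).

Definition col_of_tuple n (t : n.-tuple R) : 'cV[R]_n := \col_i tnth t i.

Definition sym_block m (t : R) (v : 'cV[R]_m) (W : 'M[R]_m) : 'M[R]_(1 + m) :=
  block_mx t%:M v^T v W.

Lemma tuple_of_symK m (A : 'M[R]_m) : A^T = A ->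
  sym_of_tuple (tuple_of_sym A) = A.
Proof.
move=> As; apply/matrixP => i j; rewrite mxE tnth_mktuple enum_rankK /=.
by case: leqP => //= _; rewrite -{1}As mxE.
Qed.

Lemma sym_block_sym m t (v : 'cV[R]_m) W : W^T = W ->
  (sym_block t v W)^T = sym_block t v W.
Proof. by move=> Ws; rewrite /sym_block tr_block_mx tr_scalar_mx trmxK Ws. Qed.

Lemma big_sym_idx (T : Type) (idx : T) (op : Monoid.com_law idx) m
    (F : 'I_m -> 'I_m -> T) :
  \big[op/idx]_(ij : sym_idx m) F (val ij).1 (val ij).2 =
  \big[op/idx]_(i < m) \big[op/idx]_(j < m | (i <= j)%N) F i j.
Proof.
rewrite pair_big_dep /=.
by rewrite (big_sub [pred ij : 'I_m * 'I_m | (ij.1 <= ij.2)%N]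
  (fun ij => F ij.1 ij.2)).
Qed.

(** The upper triangle is the corner, the rest of the first row, and the upper triangle of the
    remaining block. *)
Lemma big_sym_idxS (T : Type) (idx : T) (op : Monoid.com_law idx) m
    (F : 'I_(1 + m) -> 'I_(1 + m) -> T) :
  \big[op/idx]_(ij : sym_idx (1 + m)) F (val ij).1 (val ij).2 =
  op (F ord0 ord0) (op (\big[op/idx]_(j < m) F ord0 (lift ord0 j))
    (\big[op/idx]_(ij : sym_idx m) F (lift ord0 (val ij).1)
      (lift ord0 (val ij).2))).
Proof.
have E0 : \big[op/idx]_(j < 1 + m | (@ord0 m <= j)%N) F ord0 j =
    op (F ord0 ord0) (\big[op/idx]_(j < m) F ord0 (lift ord0 j)).
  by rewrite -big_ord_recl; apply: eq_bigl.
rewrite (big_sym_idx op F)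
  (big_sym_idx op (fun i j => F (lift ord0 i) (lift ord0 j))).
rewrite [LHS]big_ord_recl [X in op X _ = _]E0 -Monoid.mulmA;
  congr (op _ (op _ _)).
apply: eq_bigr => i _; rewrite [LHS]big_mkcond big_ord_recl /= Monoid.mul1m.
by rewrite [RHS]big_mkcond.
Qed.

(** The enumeration of the index pairs need not list the corner, the border and the remaining block
    in this order; this map is the permutation of coordinates that relates the two orders. *)
Definition sym_coords m
  (z : measurableTypeR R * (m.-tuple R * #|{: sym_idx m}|.-tuple R)) :
    #|{: sym_idx (1 + m)}|.-tuple R :=
  tuple_of_sym (sym_block z.1 (col_of_tuple z.2.1) (sym_of_tuple z.2.2)).

Lemma measurable_col_of_tuple n : measurable_fun setT (@col_of_tuple n).
Proof.
apply: measurable_fun_mx => i j; under eq_fun do rewrite mxE.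
exact: measurable_tnth.
Qed.

Lemma measurable_fun_block_mx d (T : measurableType d) a b c e
    (A : T -> 'M[R]_(a, b)) (B : T -> 'M[R]_(a, c)) (C : T -> 'M[R]_(e, b))
    (D : T -> 'M[R]_(e, c)) :
  measurable_fun setT A -> measurable_fun setT B -> measurable_fun setT C ->
  measurable_fun setT D ->
  measurable_fun setT (fun x => block_mx (A x) (B x) (C x) (D x)).
Proof.
move=> mA mB mC mD; apply: measurable_fun_mx => i j.
rewrite -(splitK i) -(splitK j).
case: (fintype.split i) => k; case: (fintype.split j) => l /=;
  under eq_fun do rewrite ?(block_mxEul, block_mxEur, block_mxEdl, block_mxEdr);
  exact: measurable_fun_entry.
Qed.

Lemma measurable_fun_sym_block d (T : measurableType d) m (t : T -> R)
    (v : T -> 'cV[R]_m) (W : T -> 'M[R]_m) :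
  measurable_fun setT t -> measurable_fun setT v -> measurable_fun setT W ->
  measurable_fun setT (fun x => sym_block (t x) (v x) (W x)).
Proof.
move=> mt mv mW; apply: measurable_fun_block_mx => //;
  last exact: measurable_fun_trmx.
apply: measurable_fun_mx => i j; under eq_fun do rewrite mxE -mulr_natr.
exact: measurable_funM.
Qed.

Lemma measurable_sym_coords m : measurable_fun setT (@sym_coords m).
Proof.
apply: (measurableT_comp (@measurable_tuple_of_sym R _)).
apply: measurable_fun_sym_block => //.
- apply: (measurableT_comp (@measurable_col_of_tuple m)).
  exact: (measurableT_comp measurable_fst measurable_snd).
- apply: (measurableT_comp (@measurable_sym_of_tuple R m)).
  exact: (measurableT_comp measurable_snd measurable_snd).
Qed.

Lemma sym_pairK m (ij : sym_idx m) : sym_pair (val ij).1 (val ij).2 = ij.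
Proof. by apply: val_inj; case: ij => -[i j] /= ->. Qed.

Lemma sym_block00 m t (v : 'cV[R]_m) W : sym_block t v W ord0 ord0 = t.
Proof.
rewrite /sym_block (_ : ord0 = lshift m ord0 :> 'I_(1 + m));
  last exact: val_inj.
by rewrite block_mxEul mxE.
Qed.

Lemma sym_block0l m t (v : 'cV[R]_m) W j :
  sym_block t v W ord0 (lift ord0 j) = v j 0.
Proof.
rewrite /sym_block (_ : ord0 = lshift m ord0 :> 'I_(1 + m));
  last exact: val_inj.
rewrite (_ : lift _ j = rshift 1 j :> 'I_(1 + m)); last exact: val_inj.
by rewrite block_mxEur mxE.
Qed.

Lemma sym_blockll m t (v : 'cV[R]_m) W i j :
  sym_block t v W (lift ord0 i) (lift ord0 j) = W i j.
Proof.
rewrite /sym_block (_ : lift _ j = rshift 1 j :> 'I_(1 + m));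
  last exact: val_inj.
rewrite (_ : lift _ i = rshift 1 i :> 'I_(1 + m)); last exact: val_inj.
by rewrite block_mxEdr.
Qed.

(** A permutation of coordinates pulls a box back to a box with the same sides, so both measures
    agree on boxes. *)
Lemma lebesgue_sym_coords m B : measurable B ->
  lebesgue_tuple R #|{: sym_idx (1 + m)}| B =
  sfprod mu (sfprod (lebesgue_tuple R m) (lebesgue_tuple R #|{: sym_idx m}|))
    (@sym_coords m @^-1` B).
Proof.
pose P := sfprod mu
  (sfprod (lebesgue_tuple R m) (lebesgue_tuple R #|{: sym_idx m}|)).
move=> mB; rewrite -[RHS]/(pushforward P (@sym_coords m) B).
apply: lebesgue_tuple_unique => //; first exact: measurable_sym_coords.
move=> mphi A mA.
pose A' i j := A (enum_rank (sym_pair i j)).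
pose A0 (j : 'I_m) := A' ord0 (lift ord0 j).
pose A1 (k : 'I_#|{: sym_idx m}|) :=
  A' (lift ord0 (val (enum_val k)).1) (lift ord0 (val (enum_val k)).2).
have -> : \big[mule/1%E]_(i < #|{: sym_idx (1 + m)}|) mu (A i) =
    (mu (A' ord0 ord0) * (\big[mule/1]_(j < m) mu (A0 j) *
     \big[mule/1]_(k < #|{: sym_idx m}|) mu (A1 k)))%E.
  transitivity (\big[mule/1%E]_(ij : sym_idx (1 + m)) mu
    (A' (val ij).1 (val ij).2)).
    rewrite (reindex (enum_rank : sym_idx (1 + m) -> _)) /=; last first.
      by exists enum_val => k _; rewrite ?enum_rankK ?enum_valK.
    by apply: eq_bigr => ij _; rewrite /A' sym_pairK.
  rewrite (big_sym_idxS _ (fun i j => mu (A' i j))); congr (_ * (_ * _))%E.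
  rewrite [LHS](reindex (enum_val : 'I_#|{: sym_idx m}| -> _)) //=.
  by exists enum_rank => k _; rewrite ?enum_rankK ?enum_valK.
have pE : @sym_coords m @^-1` box A = A' ord0 ord0 `*` (box A0 `*` box A1).
  apply/seteqP; split => -[t [v w]] /=.
    move=> bt.
    have bij (i j : 'I_(1 + m)) : (i <= j)%N ->
      A' i j (sym_block t (col_of_tuple v) (sym_of_tuple w) i j).
      move=> ij; have := bt (enum_rank (sym_pair i j)).
      by rewrite tnth_mktuple enum_rankK /= ij.
    split; first by have := bij ord0 ord0 (leqnn _); rewrite sym_block00.
    split => [j|k]; first by have := bij ord0 (lift ord0 j) isT;
      rewrite sym_block0l mxE.
    have := bij (lift ord0 (val (enum_val k)).1)
      (lift ord0 (val (enum_val k)).2).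
    rewrite sym_blockll mxE sym_pairK enum_valK; apply.
    by rewrite /= leq_bump2; case: (enum_val k).
  move=> [At [Av Aw]] k; rewrite tnth_mktuple /=.
  rewrite -[k]enum_valK enum_rankK -[X in enum_rank X]sym_pairK.
  case: (enum_val k) => -[i j] /= ij; rewrite -/(A' i j).
  case: (unliftP ord0 i) ij => [i' ->|->]; case: (unliftP ord0 j) => [j' ->|->].
  - rewrite leq_bump2 => ij; rewrite sym_blockll mxE.
    have := Aw (enum_rank (sym_pair i' j')); rewrite /A1 enum_rankK.
    by rewrite /= ij.
  - by [].
  - by move=> _; rewrite sym_block0l mxE; exact: Av.
  - by move=> _; rewrite sym_block00.
rewrite [LHS](_ : _ = P (A' ord0 ord0 `*` (box A0 `*` box A1)));
  last by rewrite -pE.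
have mA1 : measurable (box A1) by apply: measurable_box => k; exact: mA.
have mA0 : measurable (box A0) by apply: measurable_box => k; exact: mA.
rewrite [LHS]sfprodE//; last 2 first.
- exact: mA.
- exact: measurableX.
congr (_ * _)%E; rewrite [LHS]sfprodE// -!lebesgue_tuple_box// => k; exact: mA.
Qed.

Lemma integral_lebesgue_sym m (F : 'M[R]_m -> \bar R) :
  measurable_fun setT F -> (forall M, 0 <= F M)%E ->
  (\int[lebesgue_sym R m]_M F M =
   \int[lebesgue_tuple R #|{: sym_idx m}|]_t F (sym_of_tuple t))%E.
Proof.
move=> mF F0; apply: integral_image => //; exact: measurable_sym_of_tuple.
Qed.

Lemma integral_lebesgue_mx a b (F : 'M[R]_(a, b) -> \bar R) :
  measurable_fun setT F -> (forall M, 0 <= F M)%E ->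
  (\int[lebesgue_mx R a b]_M F M =
   \int[lebesgue_tuple R (a * b)]_t F (mx_of_tuple t))%E.
Proof.
move=> mF F0; apply: integral_image => //; exact: measurable_mx_of_tuple.
Qed.

Lemma integral_lebesgue_symS m (F : 'M[R]_(1 + m) -> \bar R) :
  measurable_fun setT F -> (forall M, 0 <= F M)%E ->
  (\int[lebesgue_sym R (1 + m)]_M F M = \int[mu]_t \int[lebesgue_tuple R m]_v
    \int[lebesgue_sym R m]_W F (sym_block t (col_of_tuple v) W))%E.
Proof.
move=> mF F0.
have mFs : measurable_fun setT (fun t => F (sym_of_tuple t)).
  by apply: (measurableT_comp mF); exact: measurable_sym_of_tuple.
rewrite integral_lebesgue_sym//.
rewrite (integral_image
  (m1 := sfprod mu
  (sfprod (lebesgue_tuple R m) (lebesgue_tuple R #|{: sym_idx m}|)))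
  (@measurable_sym_coords m))//; last exact: lebesgue_sym_coords.
have mG : measurable_fun setT (fun z => F (sym_of_tuple (@sym_coords m z))).
  exact: (measurableT_comp mFs (@measurable_sym_coords m)).
rewrite sfprod_tonelli1//; apply: eq_integral => t _.
have mGt := measurable_fun_pair2 t mG.
rewrite sfprod_tonelli1//; apply: eq_integral => v _.
rewrite integral_lebesgue_sym//.
  apply: eq_integral => w _; congr F; rewrite /sym_coords tuple_of_symK//.
  by rewrite sym_block_sym// sym_of_tuple_sym.
apply: (measurableT_comp mF); apply: measurable_fun_sym_block => //.
Qed.

End lebesgue_sym_recursion.

(** * Gaussian and inverse-Wishart integrals *)

Section inverse_gamma.
Context {R : realType}.
Local Notation mu := (@lebesgue_measure R).

Lemma cvg_powRN (p : R) : 0 < p -> x `^ (- p) @[x --> +oo] --> (0 : R).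
Proof.
move=> p0; apply/cvgrPdist_le => e e0; near=> x.
rewrite sub0r normrN ger0_norm ?powR_ge0// powRN.
rewrite -[leRHS]invrK lef_pV2 ?posrE ?powR_gt0 ?invr_gt0//.
apply: (@le_trans _ _ ((e^-1 `^ p^-1) `^ p)).
  by rewrite -powRrM mulVf ?gt_eqF// powRr1// invr_ge0 ltW.
rewrite ge0_ler_powR ?nnegrE ?powR_ge0//; first exact: ltW.
Unshelve. all: by end_near. Qed.

Lemma integral_powRN_lty (b : R) : 1 < b ->
  (\int[mu]_(x in `[1%R, +oo[) (x `^ (- b))%:E < +oo)%E.
Proof.
move=> b1; pose F (x : R) := (1 - b)^-1 * x `^ (1 - b).
have b0 : 1 - b != 0 by rewrite subr_eq0 lt_eqF.
have dF (x : R) : 0 < x -> is_derive x 1 F (x `^ (- b)).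
  move=> x0; have := is_derive1_powR (1 - b) x0;
    rewrite addrAC subrr sub0r => d.
  apply: is_derive_eq.
  by rewrite /GRing.scale /= mulrA mulVf// mul1r.
have cpow (p x : R) : 0 < x -> {for x, continuous (fun x => x `^ p)}.
  move=> x0; apply: differentiable_continuous; apply/derivable1_diffP.
  by apply: derivable_powR; rewrite in_itv/= andbT.
rewrite (@ge0_continuous_FTC2y _ (fun x => x `^ (- b)) F 1 0)//.
- by rewrite -EFinB ltry.
- by move=> x _; exact: powR_ge0.
- apply: continuous_in_subspaceT => x; rewrite inE /= in_itv/= andbT => x1.
  by apply: cpow; exact: lt_le_trans x1.
- rewrite -[X in _ --> X](mulr0 (1 - b)^-1); apply: cvgMr.
  by rewrite -[1 - b]opprB; apply: cvg_powRN; rewrite subr_gt0.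
- by move=> x x1; have [] := dF x (lt_trans ltr01 x1).
- apply: cvg_at_right_filter; apply: cvgMr; exact: cpow.
- move=> x; rewrite in_itv/= andbT => x1.
  by rewrite derive1E; have [_ ->] := dF x (lt_trans ltr01 x1).
Qed.

(** The inverse-gamma density of shape [b - 1] and scale [a], without its constant. *)
Definition inv_gamma_fun (b a t : R) : R := t `^ (- b) * expR (- (a / t)).

(** The inequality x <= exp x at x = a / (t b), raised to the power [b]; it controls the singularity
    of the power at 0. *)
Lemma inv_gamma_fun_le (b a t : R) : 0 < b -> 0 < a -> 0 < t ->
  inv_gamma_fun b a t <= (b / a) `^ b.
Proof.
move=> b0 a0 t0; rewrite /inv_gamma_fun expRN ler_pdivrMr ?expR_gt0//.
have u0 : 0 <= t^-1 by rewrite invr_ge0 ltW.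
have -> : t `^ (- b) = t^-1 `^ b.
  by rewrite powRN -[t^-1]powR_inv1 ?(ltW t0)// -powRrM mulN1r powRN.
have -> : expR (a / t) = (expR (a / t / b)) `^ b.
  by rewrite -expRM mulfVK ?gt_eqF.
rewrite -powRM ?expR_ge0 ?divr_ge0 ?(ltW a0) ?(ltW b0)//.
apply: ge0_ler_powR; rewrite ?nnegrE ?(ltW b0)//.
  by rewrite mulr_ge0 ?expR_ge0 ?divr_ge0 ?(ltW a0) ?(ltW b0).
apply: (@le_trans _ _ (b / a * (a / t / b))).
  rewrite le_eqVlt; apply/orP; left; apply/eqP; field.
  by rewrite !gt_eqF.
rewrite ler_wpM2l ?divr_ge0 ?(ltW a0) ?(ltW b0)//.
by apply: le_trans (expR_ge1Dx _); rewrite lerDr.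
Qed.

Lemma measurable_inv_gamma_fun (b a : R) :
  measurable_fun setT (inv_gamma_fun b a).
Proof.
apply: measurable_funM; first exact: measurable_powR.
apply: measurableT_comp => //; apply: measurableT_comp => //.
apply: measurable_funM => //; exact: measurable_inv.
Qed.

(** Bounded on ]0, 1[, and below the integrable power t^-b beyond 1. *)
Lemma integral_inv_gamma_lty (b a : R) : 1 < b -> 0 < a ->
  (\int[mu]_(t in `]0%R, +oo[) (inv_gamma_fun b a t)%:E < +oo)%E.
Proof.
move=> b1 a0; have b0 : 0 < b by exact: lt_trans b1.
have mg := measurable_inv_gamma_fun b a.
have g0 t : 0 <= inv_gamma_fun b a t by rewrite mulr_ge0// ?powR_ge0 ?expR_ge0.
rewrite (@itv_bndbnd_setU _ _ _ (BLeft 1))//; last by rewrite bnd_simp ltr01.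
rewrite ge0_integral_setU//=; last 3 first.
- by apply/measurable_EFinP; exact: measurable_funTS.
- by move=> x _; rewrite lee_fin.
- apply/disj_setPS => x []/=; rewrite !in_itv/= andbT => /andP[_ x1].
  by rewrite leNgt x1.
apply: lte_add_pinfty.
  apply: (@le_lt_trans _ _ (\int[mu]_(t in `]0%R, 1%R[) ((b / a) `^ b)%:E)%E).
    apply: ge0_integral_mono => t; first by rewrite lee_fin.
    by rewrite /= in_itv/= => /andP[t0 _]; rewrite lee_fin inv_gamma_fun_le.
  rewrite integral_cst//= lebesgue_measure_itv/= lte_fin ltr01 -EFinB -EFinM.
  exact: ltry.
apply: le_lt_trans (integral_powRN_lty b1).
apply: ge0_integral_mono => t; first by rewrite lee_fin.
rewrite /= in_itv/= andbT => t1;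
  rewrite lee_fin /inv_gamma_fun ler_piMr ?powR_ge0//.
rewrite -expR0 ler_expR oppr_le0 divr_ge0 ?ltW//; exact: lt_le_trans t1.
Qed.

End inverse_gamma.

(** * Gaussian integrals *)

Section gaussian.
Context {R : realType}.
Local Notation mu := (@lebesgue_measure R).

Lemma integral_gauss_affine (y u : R) : 0 < y ->
  (\int[mu]_x (expR (- (y * (x + u) ^+ 2)))%:E =
    (Num.sqrt pi / Num.sqrt y)%:E)%E.
Proof.
move=> y0; have s0 : 0 < Num.sqrt y by rewrite sqrtr_gt0.
have := @integralT_gauss R.
rewrite (integral_lebesgue_affine (Num.sqrt y * u) s0); last 2 first.
- by apply/measurable_EFinP; exact: measurable_gauss_fun.
- by move=> x; rewrite lee_fin gauss_fun_ge0.
have -> : (\int[mu]_x (gauss_fun (Num.sqrt y * x + Num.sqrt y * u))%:E =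
    \int[mu]_x (expR (- (y * (x + u) ^+ 2)))%:E)%E.
  by apply: eq_integral => x _;
    rewrite /gauss_fun -mulrDr exprMn sqr_sqrtr// ltW.
have : (0 <= \int[mu]_x (expR (- (y * (x + u) ^+ 2)))%:E)%E.
  by apply: integral_ge0 => x _; rewrite lee_fin expR_ge0.
(* An infinite value is excluded, as its multiple by sqrt y equals sqrt pi. *)
case: (\int[mu]_x _)%E => [r _ [<-]| |]//; last by rewrite gt0_muley ?lte_fin.
by rewrite -mulrA mulrC mulfVK ?gt_eqF.
Qed.

Lemma col_of_tuple_cons n (x : R) (t : n.-tuple R) :
  col_of_tuple (cons_pair (x, t)) = col_mx x%:M (col_of_tuple t) :>
    'cV[R]_(1 + n).
Proof.
apply/colP => i; rewrite mxE; case: (unliftP ord0 i) => [j ->|->].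
  rewrite (_ : lift _ j = rshift 1 j :> 'I_(1 + n)); last exact: val_inj.
  rewrite col_mxEd mxE (_ : rshift 1 j = lift ord0 j); last exact: val_inj.
  by rewrite /cons_pair /= tnthS.
rewrite [in RHS](_ : ord0 = lshift n ord0 :> 'I_(1 + n)); last exact: val_inj.
by rewrite col_mxEu mxE /cons_pair /= tnth0.
Qed.

(** Integrating the first coordinate first turns the completed square into a one-dimensional
    integral whose value does not depend on the shift; the Schur complement remains, and the
    determinants multiply. *)
Lemma integral_gauss_tuple n (Y : 'M[R]_n) : spd Y ->
  (\int[lebesgue_tuple R n]_t (expR (- qform Y (col_of_tuple t)))%:E =
   (Num.sqrt pi ^+ n / Num.sqrt (\det Y))%:E)%E.
Proof.
have mG k (A : 'M[R]_k) :
  measurable_fun setT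
  (fun t : k.-tuple R => (expR (- qform A (col_of_tuple t)))%:E).
  apply/measurable_EFinP; apply: measurableT_comp => //;
    apply: measurableT_comp => //.
  apply: measurable_fun_qform => //; exact: measurable_col_of_tuple.
elim: n Y => [|n IH] Y Ys.
  rewrite integral_lebesgue_tuple0//.
  rewrite det_mx00 sqrtr1 expr0 divr1 (_ : col_of_tuple _ = 0) ?qform0
    ?oppr0 ?expR0//.
  by apply/colP => -[].
have [Ysym y0 Ss] := (@spdS _ n Y).1 Ys.
rewrite integral_lebesgue_tupleS//.
pose u (t : n.-tuple R) :=
  ((dlsubmx (Y : 'M[R]_(1 + n)))^T *m col_of_tuple t) 0 0 / Y 0 0.
have QE x t : qform Y (col_of_tuple (cons_pair (x, t))) =
    Y 0 0 * (x + u t) ^+ 2 + qform (schur (Y : 'M[R]_(1 + n))) (col_of_tuple t).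
  by rewrite col_of_tuple_cons (@qform_schur _ n Y)// gt_eqF.
have mF := measurableT_comp (mG _ Y) (@measurable_cons_pair R n).
rewrite (fubini_tonelli (m2 := lebesgue_tuple R n)
  (fun z => (expR (- qform Y (col_of_tuple (cons_pair z))))%:E))//.
transitivity (\int[lebesgue_tuple R n]_t ((Num.sqrt pi / Num.sqrt (Y 0 0))%:E *
   (expR (- qform (schur (Y : 'M[R]_(1 + n))) (col_of_tuple t)))%:E))%E.
  apply: eq_integral => t _; rewrite -(integral_gauss_affine (u t) y0) muleC.
  rewrite -ge0_integralZl_EFin ?expR_ge0//.
  - by apply: eq_integral => x _; rewrite QE opprD expRD mulrC EFinM.
  - apply/measurable_EFinP; apply: measurableT_comp => //;
      apply: measurableT_comp => //.
    by apply: measurable_funM => //; apply: measurable_funX;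
      exact: measurable_funD.
rewrite ge0_integralZl_EFin//; last exact: mG.
rewrite IH// (@det_schur _ n)// ?gt_eqF// sqrtrM ?(ltW y0)// exprS -EFinM.
by congr EFin; rewrite invfM; ring.
Qed.

Lemma integral_lebesgue_sym_affine m (c : R) (A : 'M[R]_m)
  (F : 'M[R]_m -> \bar R) :
  0 < c -> A^T = A -> measurable_fun setT F -> (forall M, 0 <= F M)%E ->
  (\int[lebesgue_sym R m]_M F M = (c ^+ #|{: sym_idx m}|)%:E *
   \int[lebesgue_sym R m]_M F (c *: M + A)%R)%E.
Proof.
move=> c0 As mF F0.
have mFs : measurable_fun setT (fun t => F (sym_of_tuple t)).
  by apply: (measurableT_comp mF); exact: measurable_sym_of_tuple.
rewrite integral_lebesgue_sym//
  (integral_lebesgue_tuple_affine (tuple_of_sym A) c0)//.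
rewrite integral_lebesgue_sym//; last first.
  apply: (measurableT_comp mF); apply: measurable_fun_addmx => //.
  exact: measurable_fun_scalemx.
congr (_ * _)%E; apply: eq_integral => t _; congr F; apply/matrixP => i j.
rewrite !mxE tnth_mktuple; congr (_ + _).
by rewrite -[in RHS](tuple_of_symK As) mxE.
Qed.

End gaussian.

(** * Inverse-Wishart integrals *)

Section inverse_wishart.
Context {R : realType}.
Local Notation mu := (@lebesgue_measure R).

(** The inverse-Wishart kernel with a scalar scale matrix, which suffices by comparison. The
    exponent is real because the recursion on [m] lowers it by 1/2. *)
Definition wishart_kernel m (c a : R) (T : 'M[R]_m) : R :=
  \det T `^ (- c) * expR (- (a * \tr (invmx T))).

Lemma measurable_wishart_kernel m c a :
  measurable_fun setT (@wishart_kernel m c a).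
Proof.
apply: measurable_funM.
  by apply: (measurableT_comp (measurable_powR _)); exact: measurable_fun_det.
apply: measurableT_comp => //; apply: measurableT_comp => //.
apply: measurable_funM => //; apply: measurable_fun_trace.
exact: measurable_fun_invmx.
Qed.

Lemma wishart_kernel_ge0 m c a (T : 'M[R]_m) : 0 <= wishart_kernel c a T.
Proof. by rewrite mulr_ge0 ?powR_ge0 ?expR_ge0. Qed.

(** In the coordinates (t, v, X), with [X] the Schur complement, the determinant is t det X and the
    trace of the inverse splits into three terms, one for each factor. *)
Lemma wishart_kernelS m c a t (v : 'cV[R]_m) (X : 'M[R]_m) : 0 < t -> spd X ->
  wishart_kernel c a (sym_block t v (X + t^-1 *: (v *m v^T))) =
  inv_gamma_fun c a t * wishart_kernel c a X *
  expR (- qform (a / t ^+ 2 *: invmx X) v).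
Proof.
move=> t0 Xs; set T := sym_block _ _ _.
have T00 : T 0 0 = t by exact: sym_block00.
have Tdl : dlsubmx T = v by rewrite /T /sym_block block_mxKdl.
have TS : schur T = X by rewrite /schur Tdl T00 /T /sym_block block_mxKdr addrK.
have Tsym : T^T = T.
  by apply: sym_block_sym;
    rewrite linearD /= (spd_sym Xs) linearZ /= trmx_mul trmxK.
have Ts : spd T by apply/spdS; rewrite T00 TS.
rewrite /wishart_kernel (det_schur Tsym) ?T00 ?gt_eqF// TS
  mxtrace_inv_schur// T00 TS Tdl.
rewrite powRM ?(ltW t0) ?(ltW (spd_det_gt0 Xs))// qformZ /inv_gamma_fun.
rewrite !mulrDr !opprD !expRD.
rewrite (_ : a * (qform (invmx X) v / t ^+ 2) = a / t ^+ 2 * qform (invmx X) v);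
  last by ring.
ring.
Qed.

Lemma spd_sym_blockE m t (v : 'cV[R]_m) (X : 'M[R]_m) :
  spd (sym_block t v (X + t^-1 *: (v *m v^T))) -> 0 < t /\ spd X.
Proof.
set T := sym_block _ _ _ => /spdS[_].
have -> : T 0 0 = t by exact: sym_block00.
move=> t0; rewrite /schur (_ : T 0 0 = t); last exact: sym_block00.
rewrite /T /sym_block block_mxKdl block_mxKdr addrK//.
Qed.

(** Extended by 0 off the cone, the kernel can be integrated over all symmetric matrices, a domain
    stable under translation. *)
Let kspd m (c a : R) (T : 'M[R]_m) :
  R := wishart_kernel c a T * \1_(@spd R m) T.

Let integral_kspd m (c a : R) :
  (\int[lebesgue_sym R m]_(T in @spd R m) (wishart_kernel c a T)%:E =
   \int[lebesgue_sym R m]_T (kspd c a T)%:E)%E.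
Proof.
rewrite integral_mkcond; apply: eq_integral => T _; rewrite patchE /kspd indicE.
by case: ifPn; rewrite ?mulr1 ?mulr0.
Qed.

Let measurable_kspd m (c a : R) : measurable_fun setT (@kspd m c a).
Proof.
apply: measurable_funM; first exact: measurable_wishart_kernel.
by apply: measurable_indic; exact: measurable_spd.
Qed.

Let kspd_ge0 m c a (T : 'M[R]_m) : 0 <= kspd c a T.
Proof. by rewrite mulr_ge0 ?wishart_kernel_ge0// indicE. Qed.

Let kspd_block m c a t (v : 'cV[R]_m) (X : 'M[R]_m) : 0 < t ->
  kspd c a (sym_block t v (X + t^-1 *: (v *m v^T))) =
  inv_gamma_fun c a t * (kspd c a X * expR (- qform (a / t ^+ 2 *: invmx X) v)).
Proof.
move=> t0; rewrite /kspd !indicE.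
case: (boolP (X \in _)) => [/set_mem Xs|/negP Xs].
  rewrite wishart_kernelS// mem_set; first by ring.
  have Tsym : (sym_block t v (X + t^-1 *: (v *m v^T)))^T = sym_block t v
    (X + t^-1 *: (v *m v^T)).
    by apply: sym_block_sym;
      rewrite linearD /= (spd_sym Xs) linearZ /= trmx_mul trmxK.
  apply/spdS; split => //; first by rewrite [_ 0 0]sym_block00.
  rewrite /schur [_ 0 0]sym_block00 /sym_block block_mxKdl block_mxKdr addrK//.
rewrite memNset ?mulr0 ?mul0r ?mulr0// => /spd_sym_blockE[_ ?].
by apply: Xs; rewrite inE.
Qed.

(** A Gaussian integral in [v] with precision matrix (a / t^2) X^-1, whose determinant produces both
    t^m and sqrt (det X). *)
Let kspd_half m c a t (X : 'M[R]_m) : 0 < a -> 0 < t ->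
  (\int[lebesgue_tuple R m]_v (kspd c a X *
     expR (- qform (a / t ^+ 2 *: invmx X) (col_of_tuple v)))%:E =
  (Num.sqrt pi ^+ m / Num.sqrt (a ^+ m) * t ^+ m * kspd (c - 2^-1) a X)%:E)%E.
Proof.
move=> a0 t0; have at0 : 0 < a / t ^+ 2 by rewrite divr_gt0// exprn_gt0.
rewrite /kspd !indicE; case: (boolP (X \in _)) => [/set_mem Xs|_]; last first.
  by rewrite !mulr0; apply: integral0_eq => v _; rewrite mul0r.
have d0 := spd_det_gt0 Xs.
rewrite !mulr1; under eq_integral do rewrite EFinM.
rewrite ge0_integralZl_EFin ?wishart_kernel_ge0//; last first.
  apply/measurable_EFinP; apply: measurableT_comp => //;
    apply: measurableT_comp => //.
  apply: measurable_fun_qform => //; exact: measurable_col_of_tuple.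
rewrite integral_gauss_tuple; last exact: spdZ at0 (spd_inv Xs).
rewrite -EFinM; congr EFin; rewrite detZ det_inv /wishart_kernel.
rewrite (_ : \det X `^ (- (c - 2^-1)) = \det X `^ (- c) * Num.sqrt
  (\det X)); last first.
  by rewrite opprB addrC powRD ?powR12_sqrt ?(ltW d0)// (gt_eqF d0) implybT.
have tm0 : 0 < t ^+ m by exact: exprn_gt0.
have -> : (a / t ^+ 2) ^+ m / \det X = a ^+ m * ((t ^+ m)^-1 ^+ 2 / \det X).
  by rewrite exprMn exprVn exprAC exprVn mulrA.
rewrite sqrtrM ?exprn_ge0 ?(ltW a0)// sqrtrM ?sqr_ge0// sqrtr_sqr.
rewrite ger0_norm ?invr_ge0 ?(ltW tm0)// sqrtrV ?(ltW d0)//.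
by rewrite !invfM !invrK; ring.
Qed.

Let integral_kspd_v m c a t : 0 < a -> 0 < t ->
  (\int[lebesgue_tuple R m]_v \int[lebesgue_sym R m]_W
     (kspd c a (sym_block t (col_of_tuple v) W))%:E =
   (inv_gamma_fun (c - m%:R) a t)%:E *
   ((Num.sqrt pi ^+ m / Num.sqrt (a ^+ m))%:E *
   \int[lebesgue_sym R m]_X (kspd (c - 2^-1) a X)%:E))%E.
Proof.
move=> a0 t0.
have g0 b : 0 <= inv_gamma_fun b a t by rewrite mulr_ge0 ?powR_ge0 ?expR_ge0.
have mq : measurable_fun setT (fun z : m.-tuple R * 'M[R]_m =>
    expR (- qform (a / t ^+ 2 *: invmx z.2) (col_of_tuple z.1))).
  apply: measurableT_comp => //; apply: measurableT_comp => //.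
  apply: measurable_fun_qform; last first.
    by apply: (measurableT_comp (@measurable_col_of_tuple R m));
      exact: measurable_fst.
  apply: measurable_fun_scalemx => //; apply: measurable_fun_invmx;
    exact: measurable_snd.
pose G (z : m.-tuple R * 'M[R]_m) := (inv_gamma_fun c a t * (kspd c a z.2 *
    expR (- qform (a / t ^+ 2 *: invmx z.2) (col_of_tuple z.1))))%:E.
have mG : measurable_fun setT G.
  apply/measurable_EFinP; apply: measurable_funM => //;
    apply: measurable_funM => //.
  by apply: (measurableT_comp (@measurable_kspd m c a)); exact: measurable_snd.
have G0 z : (0 <= G z)%E.
  by rewrite lee_fin; apply: mulr_ge0 => //; apply: mulr_ge0 => //;
    exact: expR_ge0.
transitivity (\int[lebesgue_tuple R m]_v \int[lebesgue_sym R m]_X G (v, X))%E.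
  apply: eq_integral => v _; set w := col_of_tuple v.
  (* Scale 1: a pure translation of [W], for fixed [t] and [v]. *)
  rewrite (@integral_lebesgue_sym_affine _ _ 1
    (t^-1 *: (w *m w^T)))//; first last.
  - by move=> M; rewrite lee_fin.
  - apply/measurable_EFinP; apply: (measurableT_comp (@measurable_kspd _ c a)).
    exact: measurable_fun_sym_block.
  - by rewrite linearZ /= trmx_mul trmxK.
  rewrite expr1n mul1e; apply: eq_integral => X _.
  by rewrite scale1r kspd_block.
(* The order is exchanged so that the Gaussian integral over [v] becomes the inner one; its t^m
   turns the exponent [c] of [t] into [c - m]. *)
rewrite fubini_tonelli//.
transitivity (\int[lebesgue_sym R m]_X ((inv_gamma_fun (c - m%:R) a t *
   (Num.sqrt pi ^+ m / Num.sqrt (a ^+ m)))%:E * (kspd (c - 2^-1) a X)%:E))%E.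
  apply: eq_integral => X _; rewrite /G /=; under eq_integral do rewrite EFinM.
  rewrite ge0_integralZl_EFin//; last first.
  - apply/measurable_EFinP; apply: measurable_funM => //.
    exact: (measurable_fun_pair1 X mq).
  - by move=> v _; rewrite lee_fin; apply: mulr_ge0 => //; exact: expR_ge0.
  rewrite kspd_half// -!EFinM; congr EFin.
  rewrite /inv_gamma_fun (_ : t `^ (- (c - m%:R)) = t `^ (- c) *
    t ^+ m); last first.
    by rewrite opprB addrC powRD ?powR_mulrn ?(ltW t0)// (gt_eqF t0) implybT.
  ring.
rewrite ge0_integralZl_EFin//; last 3 first.
- by move=> X _; rewrite lee_fin.
- by apply/measurable_EFinP; exact: measurable_kspd.
- by rewrite mulr_ge0// divr_ge0 ?exprn_ge0 ?sqrtr_ge0.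
by rewrite EFinM muleA.
Qed.

(* Substitute W = X + t^-1 *: (v *m v^T), X being the Schur complement: the
   Gaussian integral over v yields sqrt (det X), which lowers
   the exponent by 1/2. *)
Lemma integral_wishart_kernelS m c a : 0 < a ->
  (\int[lebesgue_sym R (1 + m)]_(T in @spd R (1 + m))
    (wishart_kernel c a T)%:E =
   \int[mu]_(t in `]0%R, +oo[) (inv_gamma_fun (c - m%:R) a t)%:E *
   ((Num.sqrt pi ^+ m / Num.sqrt (a ^+ m))%:E *
   \int[lebesgue_sym R m]_(X in @spd R m)
     (wishart_kernel (c - 2^-1) a X)%:E))%E.
Proof.
move=> a0; rewrite !integral_kspd integral_lebesgue_symS//; last 2 first.
- by apply/measurable_EFinP; exact: measurable_kspd.
- by move=> M; rewrite lee_fin.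
rewrite -ge0_integralZr//; last 3 first.
- by apply/measurable_EFinP; apply: measurable_funTS;
    exact: measurable_inv_gamma_fun.
- by move=> t _; rewrite lee_fin mulr_ge0 ?powR_ge0 ?expR_ge0.
- apply: mule_ge0; first by rewrite lee_fin divr_ge0 ?exprn_ge0 ?sqrtr_ge0.
  by apply: integral_ge0 => X _; rewrite lee_fin.
rewrite [RHS]integral_mkcond; apply: eq_integral => t _; rewrite patchE.
case: ifPn => [|t0]; first by rewrite inE /= in_itv/= andbT => t0;
  exact: integral_kspd_v.
apply: integral0_eq => v _; apply: integral0_eq => W _.
rewrite /kspd indicE memNset ?mulr0// => /spdS[_ + _].
rewrite [_ 0 0]sym_block00 => t1; move/negP: t0; apply.
by rewrite inE /= in_itv/= t1.
Qed.

(** The dimension is a variable here because the number of coordinates of a 0 by 0 symmetric matrix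
    is a cardinal, equal to 0 only by a proof. *)
Let integral_tuple0_lty n (F : n.-tuple R -> R) : n = 0%N ->
  measurable_fun setT F -> (forall t, 0 <= F t) ->
  (\int[lebesgue_tuple R n]_t (F t)%:E < +oo)%E.
Proof.
case: n F => // F _ mF F0; rewrite integral_lebesgue_tuple0 ?ltry//.
exact/measurable_EFinP.
Qed.

(** With c = (kappa + m + 1) / 2 the condition reads kappa > m - 1. It is inherited by the smaller
    matrix, whose exponent is [c - 1/2], and makes the inverse-gamma exponent [c - m] exceed 1. *)
Lemma integral_wishart_kernel_lty m c a : 0 < a -> m%:R < c ->
  (\int[lebesgue_sym R m]_(T in @spd R m) (wishart_kernel c a T)%:E < +oo)%E.
Proof.
move=> a0; elim: m c => [|m IH] c mc.
  rewrite integral_kspd integral_lebesgue_sym//; last 2 first.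
  - by apply/measurable_EFinP; exact: measurable_kspd.
  - by move=> M; rewrite lee_fin.
  apply: integral_tuple0_lty => //; last first.
    apply: (measurableT_comp (@measurable_kspd 0 c a));
      exact: measurable_sym_of_tuple.
  by apply: eq_card0 => -[[[]]].
have mc' : m%:R < c - 2^-1 by move: mc; rewrite -natr1; lra.
have cm : 1 < c - m%:R by move: mc; rewrite -natr1; lra.
have := IH _ mc'; have := integral_inv_gamma_lty cm a0.
rewrite integral_wishart_kernelS//.
have : (0 <= \int[mu]_(t in `]0%R, +oo[) (inv_gamma_fun (c - m%:R) a t)%:E)%E.
  by apply: integral_ge0 => t _; rewrite lee_fin mulr_ge0 ?powR_ge0 ?expR_ge0.
have : (0 <= \int[lebesgue_sym R m]_(X in @spd R m)
  (wishart_kernel (c - 2^-1) a X)%:E)%E.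
  by apply: integral_ge0 => X _; rewrite lee_fin wishart_kernel_ge0.
case: (\int[mu]_(t in _) _)%E => [u| |]//;
  case: (\int[_]_(X in _) _)%E => [v| |]// *.
by rewrite -!EFinM ltry.
Qed.

Let integral_tuple0_gt0 n (F : n.-tuple R -> R) : n = 0%N ->
  measurable_fun setT F -> (forall t, 0 < F t) ->
  (0 < \int[lebesgue_tuple R n]_t (F t)%:E)%E.
Proof.
case: n F => // F _ mF F0; rewrite integral_lebesgue_tuple0 ?lte_fin//.
- exact/measurable_EFinP.
- by move=> t; rewrite lee_fin ltW.
Qed.

Lemma integral_wishart_kernel_gt0 m c a : 0 < a ->
  (0 < \int[lebesgue_sym R m]_(T in @spd R m) (wishart_kernel c a T)%:E)%E.
Proof.
move=> a0; elim: m c => [|m IH] c.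
  rewrite integral_kspd integral_lebesgue_sym//; last 2 first.
  - by apply/measurable_EFinP; exact: measurable_kspd.
  - by move=> M; rewrite lee_fin.
  apply: integral_tuple0_gt0 => //.
  - by apply: eq_card0 => -[[[]]].
  - apply: (measurableT_comp (@measurable_kspd 0 c a));
      exact: measurable_sym_of_tuple.
  - move=> t; rewrite /kspd indicE mem_set ?mulr1; last exact: spd0.
    by rewrite mulr_gt0 ?expR_gt0// powR_gt0// det_mx00.
rewrite integral_wishart_kernelS// !mule_gt0//.
  apply: integral_gt0 => //.
  - by apply/measurable_EFinP; apply: measurable_funTS;
      exact: measurable_inv_gamma_fun.
  - by move=> t; rewrite /= in_itv/= andbT lte_fin => t0;
      rewrite mulr_gt0 ?powR_gt0 ?expR_gt0.
  - suff : mu `]0%R, +oo[%classic != 0%E by [].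
    by rewrite lebesgue_measure_itv/= ltry.
by rewrite lte_fin divr_gt0// ?exprn_gt0 ?sqrtr_gt0 ?pi_gt0 ?exprn_gt0.
Qed.

(** Positivity of the kernel integral holds for every exponent; any exponent shows that the cone is
    not null. *)
Lemma lebesgue_sym_spd_neq0 m : lebesgue_sym R m (@spd R m) != 0%E.
Proof.
apply: (@integral_gt0_measure _ _ _ _ _ (fun T => (wishart_kernel 0 1 T)%:E)).
- exact: measurable_spd.
- by apply/measurable_EFinP; apply: measurable_funTS;
    exact: measurable_wishart_kernel.
- by move=> T _; rewrite lee_fin wishart_kernel_ge0.
- exact: integral_wishart_kernel_gt0.
Qed.

Lemma measurable_inv_wishart_fun m kappa (S : 'M[R]_m) :
  measurable_fun setT (inv_wishart_fun kappa S).
Proof.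
apply: measurable_funM.
  by apply: (measurableT_comp (measurable_powR _)); exact: measurable_fun_det.
apply: measurableT_comp => //; apply: measurableT_comp => //.
apply: measurable_funM => //; apply: measurable_fun_trace.
by apply: measurable_fun_mulmx => //; exact: measurable_fun_invmx.
Qed.

Lemma inv_wishart_fun_gt0 m kappa (S T : 'M[R]_m) : spd T ->
  0 < inv_wishart_fun kappa S T.
Proof. by move=> /spd_det_gt0 T0; rewrite mulr_gt0 ?powR_gt0 ?expR_gt0. Qed.

(** Since tr(T^-1 S) >= b tr(T^-1), the kernel with scalar scale [b / 2] dominates. *)
Lemma integral_inv_wishart_fun m kappa (S : 'M[R]_m) :
  (m <= kappa)%N -> spd S ->
  (0 < \int[lebesgue_sym R m]_(T in @spd R m)
    (inv_wishart_fun kappa S T)%:E < +oo)%E.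
Proof.
move=> mk Ss; have [b b0 bS] := spd_trace_mul_ge Ss.
apply/andP; split.
  apply: integral_gt0.
  - exact: measurable_spd.
  - by apply/measurable_EFinP; apply: measurable_funTS;
      exact: measurable_inv_wishart_fun.
  - by move=> T Ts; rewrite lte_fin inv_wishart_fun_gt0.
  - exact: lebesgue_sym_spd_neq0.
have mc : m%:R < (kappa + m + 1)%:R / 2 :> R.
  by rewrite ltr_pdivlMr// -natrM ltr_nat; lia.
have b2 : 0 < b / 2 by rewrite divr_gt0.
apply: le_lt_trans (integral_wishart_kernel_lty b2 mc).
apply: ge0_integral_mono => T Ts;
  first by rewrite lee_fin ltW// inv_wishart_fun_gt0.
rewrite lee_fin ler_wpM2l ?powR_ge0// ler_expR lerN2 mulrAC ler_pM2r
  ?invr_gt0//.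
exact: bS _ (spd_inv Ts).
Qed.

End inverse_wishart.

(** * Gaussian integrals and dilations on matrices and blocks *)

Section matrix_gaussian.
Context {R : realType}.

Definition sqnorm a b (M : 'M[R]_(a, b)) : R := \sum_i \sum_j M i j ^+ 2.

Lemma sqnorm_ge0 a b (M : 'M[R]_(a, b)) : 0 <= sqnorm M.
Proof. by apply: sumr_ge0 => i _; apply: sumr_ge0 => j _; exact: sqr_ge0. Qed.

Lemma sqnormZ a b k (M : 'M[R]_(a, b)) : sqnorm (k *: M) = k ^+ 2 * sqnorm M.
Proof.
rewrite /sqnorm mulr_sumr; apply: eq_bigr => i _.
by rewrite mulr_sumr; apply: eq_bigr => j _; rewrite mxE exprMn.
Qed.

Lemma sqnorm_col d (v : 'cV[R]_d) : sqnorm v = \sum_i v i 0 ^+ 2.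
Proof. by apply: eq_bigr => i _; rewrite big_ord1. Qed.

(** The crude bound |x| <= 1 + x^2 avoids square roots. *)
Lemma sqnorm_entry a b (M : 'M[R]_(a, b)) i j r : sqnorm M <= r ->
  `|M i j| <= 1 + r.
Proof.
move=> Mr; have h : `|M i j| ^+ 2 <= r.
  apply: le_trans Mr; rewrite real_normK ?num_real// /sqnorm (bigD1 i)//=
    (bigD1 j)//=.
  rewrite -addrA lerDl addr_ge0//; first by apply: sumr_ge0 => k _;
    exact: sqr_ge0.
  by apply: sumr_ge0 => k _; apply: sumr_ge0 => l _; exact: sqr_ge0.
by have := sqr_ge0 (`|M i j| - 1); have := normr_ge0 (M i j); nra.
Qed.

Lemma sum_mxvec_index a b (F : 'I_(a * b) -> R) :
  \sum_(i < a) \sum_(j < b) F (mxvec_index i j) = \sum_k F k.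
Proof.
rewrite pair_big /= [RHS](reindex _ (curry_mxvec_bij _ _)) /=.
by apply: eq_bigr => -[i j].
Qed.

Lemma measurable_fun_sqnorm d (T : measurableType d) a b
  (f : T -> 'M[R]_(a, b)) :
  measurable_fun setT f -> measurable_fun setT (fun x => sqnorm (f x)).
Proof.
move=> mf; apply: measurable_sum => i; apply: measurable_sum => j.
by apply: measurable_funX; exact: measurable_fun_entry.
Qed.

Lemma measurable_gauss_mx a b h :
  measurable_fun setT (fun M : 'M[R]_(a, b) => expR (- (h * sqnorm M))).
Proof.
apply: measurableT_comp => //; apply: measurableT_comp => //.
apply: measurable_funM => //; exact: measurable_fun_sqnorm.
Qed.

Lemma integral_gauss_mx a b h : 0 < h ->
  (0 < \int[lebesgue_mx R a b]_M (expR (- (h * sqnorm M)))%:E < +oo)%E.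
Proof.
move=> h0; rewrite integral_lebesgue_mx//; last first.
  by apply/measurable_EFinP; exact: measurable_gauss_mx.
have Ys : spd (h *: 1%:M : 'M[R]_(a * b)).
  apply: spdZ => //; split; first by rewrite trmx1.
  move=> v v0; rewrite qform1 lt_neqAle sumr_ge0 ?andbT => [|i _];
    last exact: sqr_ge0.
  apply: contraNneq v0 => /esym/eqP; rewrite psumr_eq0 => [|i _];
    last exact: sqr_ge0.
  by move=> /allP v0; apply/eqP/colP => i; rewrite mxE; apply/eqP;
    rewrite -sqrf_eq0; apply: v0; rewrite mem_index_enum.
rewrite (eq_integral
  (fun t => (expR (- qform (h *: 1%:M) (col_of_tuple t)))%:E)).
  rewrite integral_gauss_tuple// lte_fin ltry andbT divr_gt0//.
    by rewrite exprn_gt0// sqrtr_gt0 pi_gt0.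
  by rewrite sqrtr_gt0 spd_det_gt0.
move=> t _; rewrite qformZ qform1; congr (expR (- (h * _)))%:E.
rewrite -sum_mxvec_index; apply: eq_bigr => i _; apply: eq_bigr => j _.
by rewrite !mxE.
Qed.

Lemma integral_lebesgue_mx_scale a b (k : R)
  (F : 'M[R]_(a, b) -> \bar R) : 0 < k ->
  measurable_fun setT F -> (forall M, 0 <= F M)%E ->
  (\int[lebesgue_mx R a b]_M F M =
   (k ^+ (a * b))%:E * \int[lebesgue_mx R a b]_M F (k *: M)%R)%E.
Proof.
move=> k0 mF F0.
have mFk : measurable_fun setT (fun M : 'M[R]_(a, b) => F (k *: M)).
  by apply: (measurableT_comp mF); exact: measurable_fun_scalemx.
have mFt : measurable_fun setT (fun t => F (mx_of_tuple t)).
  by apply: (measurableT_comp mF); exact: measurable_mx_of_tuple.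
rewrite !integral_lebesgue_mx//
  (integral_lebesgue_tuple_affine [tuple 0 | _ < a * b] k0)//.
congr (_ * _)%E; apply: eq_integral => t _; congr F; apply/matrixP => i j.
by rewrite !mxE !tnth_mktuple addr0.
Qed.

End matrix_gaussian.

Section block_measure.
Context {R : realType} {m n p q : nat}.
Local Notation block := (regression_block R m n p q).
Local Notation muY := (lebesgue_block R m n p q).
Local Open Scope ereal_scope.

Definition block_sqnorm (w : block) : R :=
  (sqnorm w.1.1 + sqnorm w.1.2 + sqnorm w.2)%R.

Definition block_scale (k : R) (w : block) : block :=
  ((k *: w.1.1)%R, (k *: w.1.2)%R, (k *: w.2)%R).

Lemma measurable_block_fst : measurable_fun setT (fun w : block => w.1.1).
Proof. exact: (measurableT_comp measurable_fst measurable_fst). Qed.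

Lemma measurable_block_snd : measurable_fun setT (fun w : block => w.1.2).
Proof. exact: (measurableT_comp measurable_snd measurable_fst). Qed.

Lemma measurable_block_thd : measurable_fun setT (fun w : block => w.2).
Proof. exact: measurable_snd. Qed.

Lemma measurable_block_sqnorm : measurable_fun setT block_sqnorm.
Proof.
apply: measurable_funD; first apply: measurable_funD;
  apply: measurable_fun_sqnorm.
- exact: measurable_block_fst.
- exact: measurable_block_snd.
- exact: measurable_block_thd.
Qed.

Lemma integral_lebesgue_block (F : block -> \bar R) :
  measurable_fun setT F -> (forall w, 0 <= F w) ->
  \int[muY]_w F w = \int[lebesgue_mx R (m * n) 1]_u
    \int[lebesgue_mx R (m * q) 1]_v
    \int[lebesgue_mx R (m * p) 1]_z F (u, v, z).
Proof.
move=> mF F0.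
rewrite [LHS](sfprod_tonelli1 _ (lebesgue_mx R (m * p) 1) mF F0).
have mG : measurable_fun setT
  (fun uv => \int[lebesgue_mx R (m * p) 1]_z F (uv, z)).
  exact: measurable_fun_fubini_tonelli_F.
have G0 uv : 0 <= \int[lebesgue_mx R (m * p) 1]_z F (uv, z)
  by exact: integral_ge0.
by rewrite [LHS](sfprod_tonelli1 _ (lebesgue_mx R (m * q) 1) mG G0).
Qed.

Lemma integral_block_scale (k : R) (F : block -> \bar R) : (0 < k)%R ->
  measurable_fun setT F -> (forall w, 0 <= F w) ->
  \int[muY]_w F w =
    (k ^+ (m * n * 1) * (k ^+ (m * q * 1) * k ^+ (m * p * 1)))%:E *
    \int[muY]_w F (block_scale k w).
Proof.
move=> k0 mF F0.
have k_ge0 : (0 <= k)%R by exact: ltW.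
have mFk : measurable_fun setT (fun w => F (block_scale k w)).
  apply: (measurableT_comp mF); apply: measurable_fun_pair; last first.
    by apply: measurable_fun_scalemx => //; exact: measurable_block_thd.
  apply: measurable_fun_pair; apply: measurable_fun_scalemx => //.
    exact: measurable_block_fst.
  exact: measurable_block_snd.
rewrite !integral_lebesgue_block//.
have m1 (G : block -> \bar R) : measurable_fun setT G -> (forall w, 0 <= G w) ->
    measurable_fun setT (fun uv => \int[lebesgue_mx R (m * p) 1]_z G (uv, z)).
  by move=> mG G0; exact: measurable_fun_fubini_tonelli_F.
have m2 (G : block -> \bar R) : measurable_fun setT G -> (forall w, 0 <= G w) ->
    measurable_fun setT
      (fun u => \int[lebesgue_mx R (m * q) 1]_v \int[lebesgue_mx R (m * p) 1]_z
      G (u, v, z)).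
  move=> mG G0; apply: (measurable_fun_fubini_tonelli_F
    (m2 := lebesgue_mx R (m * q) 1)
   (fun uv => \int[lebesgue_mx R (m * p) 1]_z G (uv, z))) => //;
     first exact: m1.
  by move=> uv; exact: integral_ge0.
rewrite (integral_lebesgue_mx_scale k0);
  [|exact: m2|by move=> u; do 2 (apply: integral_ge0 => ? _)].
rewrite EFinM -muleA; congr (_ * _).
rewrite -ge0_integralZl_EFin//; last 3 first.
- by move=> u _; do 2 (apply: integral_ge0 => ? _).
- exact: (m2 _ mFk).
- by rewrite mulr_ge0// exprn_ge0.
apply: eq_integral => u _; rewrite EFinM -muleA.
have mFu : measurable_fun setT (fun v => \int[lebesgue_mx R (m * p) 1]_z F
  ((k *: u)%R, v, z)).
  exact: (measurable_fun_pair2 _ (m1 _ mF F0)).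
rewrite (integral_lebesgue_mx_scale k0)//; last by move=> v;
  exact: integral_ge0.
congr (_ * _).
rewrite -ge0_integralZl_EFin//; last 3 first.
- by move=> v _; apply: integral_ge0.
- exact: (measurable_fun_pair2 u (m1 _ mFk (fun w => F0 _))).
- by rewrite exprn_ge0.
apply: eq_integral => v _.
by rewrite (integral_lebesgue_mx_scale k0)//;
  exact: (measurable_fun_pair2 _ mF).
Qed.

Lemma integral_block_gauss (h : R) : (0 < h)%R ->
  0 < \int[muY]_w (expR (- (h * block_sqnorm w)))%:E < +oo.
Proof.
move=> h0.
have mG : measurable_fun setT
  (fun w : block => (expR (- (h * block_sqnorm w)))%:E).
  apply/measurable_EFinP; apply: measurableT_comp => //;
    apply: measurableT_comp => //.
  by apply: measurable_funM => //; exact: measurable_block_sqnorm.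
rewrite integral_lebesgue_block//.
have ex a : exists2 i : R, (0 < i)%R &
    \int[lebesgue_mx R a 1]_v (expR (- (h * sqnorm v)))%:E = i%:E.
  have := integral_gauss_mx a 1 h0.
  case: (\int[_]_v _) => [i /andP[i0 _]| |]; last 2 first.
  - by rewrite ltxx andbF.
  - by [].
  by exists i.
have [i1 i10 E1] := ex (m * p)%N; have [i2 i20 E2] := ex (m * q)%N.
have [i3 i30 E3] := ex (m * n)%N.
have e2 (r : R) : (0 <= r)%R ->
  forall a, \int[lebesgue_mx R a 1]_v (r%:E * (expR (- (h * sqnorm v)))%:E) =
    r%:E * \int[lebesgue_mx R a 1]_v (expR (- (h * sqnorm v)))%:E.
  by move=> r0 a; rewrite ge0_integralZl_EFin//; apply/measurable_EFinP;
    exact: measurable_gauss_mx.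
suff -> : \int[lebesgue_mx R (m * n) 1]_u \int[lebesgue_mx R (m * q) 1]_v
    \int[lebesgue_mx R (m * p) 1]_z (expR (- (h * block_sqnorm (u, v, z))))%:E =
      (i1 * i2 * i3)%:E.
  by rewrite ltry andbT lte_fin !mulr_gt0.
rewrite EFinM -E3 -e2; last by rewrite mulr_ge0 ?ltW.
apply: eq_integral => u _; rewrite -EFinM mulrAC EFinM -E2 -e2;
  last by rewrite mulr_ge0 ?ltW ?expR_gt0.
apply: eq_integral => v _; rewrite -EFinM -mulrA mulrC EFinM -E1 -e2;
  last by rewrite mulr_ge0 ?expR_ge0.
apply: eq_integral => z _; rewrite -EFinM -!expRD; congr (expR _)%:E.
by rewrite /block_sqnorm /=; ring.
Qed.

End block_measure.

(** * The posterior density *)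

Section quadratic_bounds.
Context {R : realType}.

Lemma spd_coercive_family n d (M : 'I_n -> 'M[R]_d) : (forall i, spd (M i)) ->
  exists2 h : R, 0 < h & forall i (v : 'cV[R]_d), h * \sum_j v j 0 ^+ 2 <=
    qform (M i) v.
Proof.
move=> Ms; have : forall i, exists h : R, 0 < h /\
    forall v : 'cV[R]_d, h * \sum_j v j 0 ^+ 2 <= qform (M i) v.
  by move=> i; have [h h0 hM] := spd_coercive (Ms i); exists h.
move=> /choice[h hP].
(* The default 1 keeps the minimum positive for an empty family. *)
exists (\big[Num.min/1]_(i < n) h i).
  by apply: lt_bigmin => // i _; case: (hP i).
move=> i v; apply: le_trans (proj2 (hP i) v).
rewrite ler_wpM2r//; first by apply: sumr_ge0 => j _; exact: sqr_ge0.
exact: bigmin_le_cond.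
Qed.

Lemma qform_parallelogram d (M : 'M[R]_d) (v c : 'cV[R]_d) :
  qform M (v - c) + qform M (v + c) = 2 * qform M v + 2 * qform M c.
Proof.
rewrite !qformE !mulr_sumr -!big_split /=; apply: eq_bigr => i _.
rewrite !mulr_sumr -!big_split /=; apply: eq_bigr => j _.
by rewrite !mxE; ring.
Qed.

(* The parallelogram law applied to v - c and v. *)
Lemma qform_double d (M : 'M[R]_d) (v c : 'cV[R]_d) :
  qform M (2 *: v - c) + qform M c = 2 * qform M (v - c) + 2 * qform M v.
Proof.
rewrite -qform_parallelogram (_ : v - c - v = - c);
  last by rewrite addrAC subrr sub0r.
by rewrite qformN addrC (_ : v - c + v = 2 *: v - c)// scaler_nat mulr2n addrAC.
Qed.

(** The parallelogram law for v - c and c, with one nonnegative term dropped. *)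
Lemma qform_shift_ge d (M : 'M[R]_d) (v c : 'cV[R]_d) : spd M ->
  qform M v / 2 - qform M c <= qform M (v - c).
Proof.
move=> Ms; have := qform_parallelogram M (v - c) c; rewrite subrK.
have := qform_ge0 (v - c - c) Ms; lra.
Qed.

(** Merges the measurement error of a feature with its prior: [c] is the precision-weighted mean,
    which becomes [updated_mean]. *)
Lemma qform_complete_square d (A B : 'M[R]_d) (u v z : 'cV[R]_d) :
  spd A -> spd B -> let c := invmx (A + B) *m (A *m u + B *m v) in
  qform A (u - z) + qform B (z - v) =
  qform (A + B) (z - c) + (qform A u + qform B v - qform (A + B) c).
Proof.
move=> As Bs c.
have cE : (A + B) *m c = A *m u + B *m v.
  by rewrite /c mulKVmx//; apply: spd_unitmx; exact: spdD.
have qB (M : 'M[R]_d) (a b : 'cV[R]_d) : spd M ->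
    qform M (a - b) = qform M a - 2 * (a^T *m (M *m b)) 0 0 + qform M b.
  move=> Ms; have sym : (b^T *m (M *m a)) 0 0 = (a^T *m (M *m b)) 0 0.
    by rewrite -[RHS]trace_mx11 -mxtrace_tr !trmx_mul trmxK (spd_sym Ms)
      mulmxA trace_mx11.
  rewrite /qform [(a - b)^T]linearB /= !(mulmxBl, mulmxBr) -!mulmxA.
  have mB (X Y : 'M[R]_1) : (X - Y) 0 0 = X 0 0 - Y 0 0 by rewrite !mxE.
  by rewrite !mB sym; ring.
rewrite -(qformN A) opprB !qB//; last exact: spdD.
rewrite cE mulmxDr qformD [X in _ = _ - 2 * X + _ + _]mxE; ring.
Qed.

End quadratic_bounds.

Section posterior_factors.
Context {R : realType} {m n p q : nat}.
Variables (U : 'I_n -> 'M[R]_m) (V : 'I_n -> 'M[R]_p) (Z : 'I_n -> 'cV[R]_q).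
Variables (k : 'I_n -> 'cV[R]_p) (K : 'I_n -> 'M[R]_p).
Variables (a0 : nat) (B0 : 'M[R]_m).
Variables (j0 : 'cV[R]_(m * q + m * p)) (J0 : 'M[R]_(m * q + m * p)).
Variables (y : 'I_n -> 'cV[R]_m) (x : 'I_n -> 'cV[R]_p).
Hypothesis spdU : forall i, spd (U i).
Hypothesis spdV : forall i, spd (V i).
Hypothesis spdK : forall i, spd (K i).
Hypothesis a0_ge : (m <= a0)%N.
Hypothesis spdB0 : spd B0.
Hypothesis spdJ0 : spd J0.

Local Notation block := (regression_block R m n p q).
Local Notation st := (state R m n p q).
Local Notation muX := (lebesgue_mx R n p).
Local Notation muY := (lebesgue_block R m n p q).
Local Notation muS := (lebesgue_sym R m).
Local Notation post := (posterior_fun U V Z k K a0 B0 j0 J0 y x).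

Definition feature_energy (A : 'M[R]_(n, p)) : R :=
  \sum_(i < n) qform (updated_precision V K i)
    (feature A i - updated_mean V k K x i).

Definition block_energy (w : block) : R :=
  \sum_(i < n) qform (invmx (U i)) (latent_response w.1.1 i - y i) +
  qform (invmx J0) (col_mx w.1.2 w.2 - j0).

Definition residual (A : 'M[R]_(n, p)) (w : block) (i : 'I_n) : 'cV[R]_m :=
  latent_response w.1.1 i - regression_mean Z A w.1.2 w.2 i.

Definition coupling_energy (A : 'M[R]_(n, p)) (w : block) (S : 'M[R]_m) : R :=
  \sum_(i < n) qform (invmx S) (residual A w i).

(* The indicator makes the density vanish off the SPD cone, so that the chain
   can be run on all matrices. *)
Definition Sigma_factor (c : R) (S : 'M[R]_m) : R :=
  c * (inv_wishart_fun (n + a0) B0 S * \1_(@spd R m) S).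

Definition block_factor (w : block) : R := expR (- (block_energy w / 2)).

Definition feature_factor (A : 'M[R]_(n, p)) :
  R := expR (- (feature_energy A / 2)).

Definition coupling (A : 'M[R]_(n, p)) (w : block) (S : 'M[R]_m) : R :=
  expR (- (coupling_energy A w S / 2)).

(** The constant [c] sits in the factor of Sigma, so that the normalized posterior itself is a
    product form. *)
Definition posterior_product (c : R) : st -> R :=
  product_form (Sigma_factor c) block_factor feature_factor coupling.

Lemma posterior_productE c s : state_space s ->
  posterior_product c s = c * post s.
Proof.
case: s => -[A [[nu theta] beta]] S Ss;
  rewrite /posterior_product /product_form /=.
rewrite /Sigma_factor indicE mem_set// mulr1 /inv_wishart_fun /block_factor.
rewrite /feature_factor /coupling /block_energy /feature_energy /coupling_energy
  /residual /=.
rewrite -!mulrA; congr (_ * (_ * _)); rewrite -!expRD; congr expR; lra.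
Qed.

Lemma spd_precision i : spd (updated_precision V K i).
Proof. by apply: spdD; exact: spd_inv. Qed.

Lemma block_energy_ge0 w : 0 <= block_energy w.
Proof.
rewrite addr_ge0 ?sumr_ge0// => [i _|]; apply: qform_ge0; exact: spd_inv.
Qed.

Lemma coupling_energy_ge0 A w S : spd S -> 0 <= coupling_energy A w S.
Proof.
by move=> Ss; apply: sumr_ge0 => i _; apply: qform_ge0; exact: spd_inv.
Qed.

Lemma sum_feature_sqr (A : 'M[R]_(n, p)) :
  \sum_(i < n) \sum_j feature A i j 0 ^+ 2 = sqnorm A.
Proof. by apply: eq_bigr => i _; apply: eq_bigr => j _; rewrite !mxE. Qed.

Lemma latent_responseE (nu : 'cV[R]_(m * n)) i j :
  latent_response nu i j 0 = nu (mxvec_index j i) 0.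
Proof. by rewrite !mxE. Qed.

Lemma sum_latent_sqr (nu : 'cV[R]_(m * n)) :
  \sum_(i < n) \sum_j latent_response nu i j 0 ^+ 2 = sqnorm nu.
Proof.
rewrite exchange_big sqnorm_col -[RHS]sum_mxvec_index /=.
by apply: eq_bigr => i _; apply: eq_bigr => j _; rewrite latent_responseE.
Qed.

Lemma sum_col_mx_sqr a b (u : 'cV[R]_a) (v : 'cV[R]_b) :
  \sum_j (col_mx u v) j 0 ^+ 2 = sqnorm u + sqnorm v.
Proof.
rewrite big_split_ord !sqnorm_col; congr (_ + _); apply: eq_bigr => i _.
  by rewrite col_mxEu.
by rewrite col_mxEd.
Qed.

Lemma feature_energy_coercive :
  exists h C : R, 0 < h /\ forall A, h * sqnorm A - C <= feature_energy A.
Proof.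
have [h h0 hP] := spd_coercive_family spd_precision.
exists (h / 2), (\sum_(i < n) qform (updated_precision V K i)
  (updated_mean V k K x i)).
split=> [|A]; first by rewrite divr_gt0.
rewrite -sum_feature_sqr mulr_sumr -sumrB; apply: ler_sum => i _.
apply: le_trans (qform_shift_ge _ _ (spd_precision i)).
by rewrite lerD2r mulrAC ler_pM2r ?invr_gt0// hP.
Qed.

(** The homogeneous part of [block_energy]: the data [y] and the prior mean [j0] are replaced by 0.
    [block_const] below is the value of [block_energy] at 0. *)
Definition block_quadratic (w : block) : R :=
  \sum_(i < n) qform (invmx (U i)) (latent_response w.1.1 i) +
  qform (invmx J0) (col_mx w.1.2 w.2).

Definition block_const : R :=
  \sum_(i < n) qform (invmx (U i)) (y i) + qform (invmx J0) j0.

Lemma block_quadratic_coercive :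
  exists2 h : R, 0 < h & forall w, h * block_sqnorm w <= block_quadratic w.
Proof.
have [h1 h10 h1P] := spd_coercive_family (fun i => spd_inv (spdU i)).
have [h2 h20 h2P] := spd_coercive (spd_inv spdJ0).
exists (Num.min h1 h2); first by rewrite lt_min h10.
move=> w; rewrite /block_sqnorm -addrA mulrDr lerD//.
  rewrite -sum_latent_sqr mulr_sumr; apply: ler_sum => i _.
  apply: le_trans (h1P i _); rewrite ler_wpM2r ?ge_min ?lexx//.
  by apply: sumr_ge0 => j _; exact: sqr_ge0.
rewrite -sum_col_mx_sqr; apply: le_trans (h2P _).
rewrite ler_wpM2r ?ge_min ?lexx ?orbT//.
by apply: sumr_ge0 => j _; exact: sqr_ge0.
Qed.

Lemma block_energy_ge w : block_quadratic w / 2 - block_const <= block_energy w.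
Proof.
rewrite /block_quadratic /block_const /block_energy mulrDl opprD addrACA lerD//.
  rewrite mulr_suml -sumrB; apply: ler_sum => i _; apply: qform_shift_ge.
  exact: spd_inv.
by apply: qform_shift_ge; exact: spd_inv.
Qed.

Lemma latent_responseZ a (nu : 'cV[R]_(m * n)) i :
  latent_response (a *: nu) i = a *: latent_response nu i.
Proof. by apply/colP => j; rewrite [RHS]mxE !latent_responseE mxE. Qed.

Lemma block_energy_double w :
  block_energy (block_scale 2 w) + block_const =
  2 * block_energy w + 2 * block_quadratic w.
Proof.
rewrite /block_energy /block_const /block_quadratic /=.
rewrite -scale_col_mx addrACA qform_double [in RHS]mulrDr
  [in X in _ = _ + X]mulrDr.
rewrite [RHS]addrACA; congr (_ + _).
rewrite -big_split /= !mulr_sumr -big_split /=; apply: eq_bigr => i _.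
by rewrite latent_responseZ qform_double.
Qed.

(** Holds because nu is scaled together with theta and beta. *)
Lemma residual_scale A a w i :
  residual A (block_scale a w) i = a *: residual A w i.
Proof.
rewrite /residual /= latent_responseZ scalerBr; congr (_ - _).
rewrite /regression_mean scalerDr /unvec !linearZ /= -!scalemxAl //.
Qed.

Lemma coupling_energy_scale A a w S :
  coupling_energy A (block_scale a w) S = a ^+ 2 * coupling_energy A w S.
Proof.
by rewrite /coupling_energy mulr_sumr; apply: eq_bigr => i _;
  rewrite residual_scale qformZv.
Qed.

Lemma coupling_energyZ A w a S : a != 0 -> S \in unitmx ->
  coupling_energy A w (a *: S) = a^-1 * coupling_energy A w S.
Proof.
move=> a_neq0 Su; rewrite /coupling_energy mulr_sumr; apply: eq_bigr => i _.
by rewrite invmxZ ?unitmxZ ?unitfE// qformZ.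
Qed.

Section measurability.
Context d (T : measurableType d).
Implicit Types (f : T -> 'M[R]_(n, p)) (g : T -> block) (h : T -> 'M[R]_m).

Lemma measurable_fun_feature f i : measurable_fun setT f ->
  measurable_fun setT (fun t => feature (f t) i).
Proof.
move=> mf; apply: measurable_fun_mx => j l.
under eq_fun do rewrite !mxE; exact: measurable_fun_entry.
Qed.

Lemma measurable_fun_latent (g : T -> 'cV[R]_(m * n)) i :
  measurable_fun setT g ->
  measurable_fun setT (fun t => latent_response (g t) i).
Proof.
move=> mg; apply: measurable_fun_mx => j l.
by under eq_fun do rewrite !mxE; exact: measurable_fun_entry.
Qed.

Lemma measurable_fun_unvec a b (g : T -> 'cV[R]_(b * a)) :
  measurable_fun setT g ->
  measurable_fun setT (fun t => unvec (g t) : 'M[R]_(a, b)).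
Proof.
move=> mg; apply: measurable_fun_mx => j l.
by under eq_fun do rewrite !mxE; exact: measurable_fun_entry.
Qed.

Lemma measurable_fun_col_mx a b (f : T -> 'cV[R]_a) (g : T -> 'cV[R]_b) :
  measurable_fun setT f -> measurable_fun setT g ->
  measurable_fun setT (fun t => col_mx (f t) (g t)).
Proof.
move=> mf mg; apply: measurable_fun_mx => i j; rewrite -(splitK i).
by case: (fintype.split i) => l /=;
  under eq_fun do rewrite ?(col_mxEu, col_mxEd);
  exact: measurable_fun_entry.
Qed.

Lemma measurable_fun_feature_energy f : measurable_fun setT f ->
  measurable_fun setT (fun t => feature_energy (f t)).
Proof.
move=> mf; apply: measurable_sum => i; apply: measurable_fun_qform => //.
apply: measurable_fun_addmx => //; exact: measurable_fun_feature.
Qed.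

Lemma measurable_fun_block_energy g : measurable_fun setT g ->
  measurable_fun setT (fun t => block_energy (g t)).
Proof.
move=> mg.
have m1 := measurableT_comp (@measurable_block_fst R m n p q) mg.
have m2 := measurableT_comp (@measurable_block_snd R m n p q) mg.
have m3 := measurableT_comp (@measurable_block_thd R m n p q) mg.
apply: measurable_funD.
  apply: measurable_sum => i; apply: measurable_fun_qform => //.
  by apply: measurable_fun_addmx => //; exact: measurable_fun_latent m1.
apply: measurable_fun_qform => //; apply: measurable_fun_addmx => //.
exact: measurable_fun_col_mx m2 m3.
Qed.

Lemma measurable_fun_coupling_energy f g h : measurable_fun setT f ->
  measurable_fun setT g -> measurable_fun setT h ->
  measurable_fun setT (fun t => coupling_energy (f t) (g t) (h t)).
Proof.
move=> mf mg mh.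
have m1 := measurableT_comp (@measurable_block_fst R m n p q) mg.
have m2 := measurableT_comp (@measurable_block_snd R m n p q) mg.
have m3 := measurableT_comp (@measurable_block_thd R m n p q) mg.
apply: measurable_sum => i; apply: measurable_fun_qform.
  exact: measurable_fun_invmx.
apply: measurable_fun_addmx; first exact: measurable_fun_latent m1.
apply: measurable_fun_oppmx; apply: measurable_fun_addmx.
  apply: measurable_fun_mulmx => //; apply: measurable_fun_trmx.
  exact: measurable_fun_unvec m2.
apply: measurable_fun_mulmx; last exact: measurable_fun_feature.
by apply: measurable_fun_trmx; exact: measurable_fun_unvec m3.
Qed.

End measurability.

Let measurable_half_exp d (T : measurableType d) (f : T -> R) :
  measurable_fun setT f -> measurable_fun setT (fun t => expR (- (f t / 2))).
Proof.
move=> mf; apply: measurableT_comp => //; apply: measurableT_comp => //.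
exact: measurable_funM.
Qed.

Lemma measurable_Sigma_factor c : measurable_fun setT (Sigma_factor c).
Proof.
apply: measurable_funM => //; apply: measurable_funM.
  exact: measurable_inv_wishart_fun.
by apply: measurable_indic; exact: measurable_spd.
Qed.

Lemma measurable_block_factor : measurable_fun setT block_factor.
Proof. by apply: measurable_half_exp; exact: measurable_fun_block_energy. Qed.

Lemma measurable_feature_factor : measurable_fun setT feature_factor.
Proof. by apply: measurable_half_exp; exact: measurable_fun_feature_energy. Qed.

Lemma measurable_posterior_product c :
  measurable_fun setT (posterior_product c).
Proof.
have m1 : measurable_fun setT (fun z : st => z.1.1)
  by exact: (measurableT_comp measurable_fst measurable_fst).
have m2 : measurable_fun setT (fun z : st => z.1.2)
  by exact: (measurableT_comp measurable_snd measurable_fst).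
have m3 : measurable_fun setT (fun z : st => z.2) by exact: measurable_snd.
apply: measurable_funM; last first.
  by apply: measurable_half_exp; exact: measurable_fun_coupling_energy.
apply: measurable_funM;
  last exact: (measurableT_comp measurable_feature_factor m1).
apply: measurable_funM;
  last exact: (measurableT_comp measurable_block_factor m2).
exact: (measurableT_comp (measurable_Sigma_factor c) m3).
Qed.

Lemma Sigma_factor_gt0 c S : 0 < c -> spd S -> 0 < Sigma_factor c S.
Proof.
move=> c0 Ss; rewrite /Sigma_factor indicE mem_set// mulr1 mulr_gt0//.
exact: inv_wishart_fun_gt0.
Qed.

Lemma Sigma_factor_notin c S : ~ spd S -> Sigma_factor c S = 0.
Proof. by move=> Ss; rewrite /Sigma_factor indicE memNset// !mulr0. Qed.

Lemma integral_Sigma_factor c : 0 < c ->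
  (0 < \int[muS]_S (Sigma_factor c S)%:E < +oo)%E.
Proof.
move=> c0.
have mw := measurable_inv_wishart_fun (n + a0) B0.
have := @integral_inv_wishart_fun R m (n + a0) B0
  (leq_trans a0_ge (leq_addl _ _)) spdB0.
have -> : (\int[muS]_S (Sigma_factor c S)%:E =
    c%:E * \int[muS]_(S in @spd R m) (inv_wishart_fun (n + a0) B0 S)%:E)%E.
  rewrite [in RHS]integral_mkcond -ge0_integralZl_EFin ?ltW//.
  - apply: eq_integral => S _; rewrite patchE /Sigma_factor indicE.
    by case: ifPn => _; rewrite ?mulr1 ?mulr0 ?mule0.
  - by move=> S _; rewrite patchE; case: ifPn => // /set_mem Ss;
      rewrite lee_fin ltW// inv_wishart_fun_gt0.
  - apply/(measurable_restrictT _ _).1; first exact: measurable_spd.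
    by apply/measurable_EFinP; exact: measurable_funTS.
case: (\int[_]_(_ in _) _)%E => [r /andP[r0 _]| |]//;
  last by rewrite ltxx andbF.
by rewrite -EFinM lte_fin ltry mulr_gt0.
Qed.

Let muY_neq0 : muY setT != 0%E.
Proof.
apply: (@integral_gt0_measure _ _ _ _ _
  (fun w => (expR (- (1 * block_sqnorm w)))%:E)) => //.
- apply/measurable_EFinP; apply: measurableT_comp => //;
    apply: measurableT_comp => //.
  by apply: measurable_funM => //; exact: measurable_block_sqnorm.
- by have /andP[] := @integral_block_gauss R m n p q 1 ltr01.
Qed.

Let muX_neq0 : muX setT != 0%E.
Proof.
apply: (@integral_gt0_measure _ _ _ _ _
  (fun A => (expR (- (1 * sqnorm A)))%:E)) => //.
- by apply/measurable_EFinP; exact: measurable_gauss_mx.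
- by have /andP[] := @integral_gauss_mx R n p 1 ltr01.
Qed.

Lemma integral_block_factor : (0 < \int[muY]_w (block_factor w)%:E < +oo)%E.
Proof.
apply/andP; split.
  apply: integral_gt0 => //; last by move=> w _; rewrite lte_fin expR_gt0.
  by apply/measurable_EFinP; exact: measurable_block_factor.
have [h h0 hP] := block_quadratic_coercive.
have h4 : 0 < h / 4 by rewrite divr_gt0.
have /andP[_ goo] := @integral_block_gauss R m n p q _ h4.
apply: (@le_lt_trans _ _ (\int[muY]_w ((expR (block_const / 2))%:E *
    (expR (- (h / 4 * block_sqnorm w)))%:E))%E).
  apply: ge0_integral_mono => w _; first by rewrite lee_fin expR_ge0.
  rewrite -EFinM lee_fin -expRD ler_expR.
  by have := hP w; have := block_energy_ge w; lra.
rewrite ge0_integralZl_EFin ?expR_ge0//.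
- by rewrite lte_mul_pinfty ?lee_fin ?expR_ge0.
apply/measurable_EFinP; apply: measurableT_comp => //;
  apply: measurableT_comp => //.
by apply: measurable_funM => //; exact: measurable_block_sqnorm.
Qed.

Lemma integral_feature_factor : (0 < \int[muX]_A (feature_factor A)%:E < +oo)%E.
Proof.
apply/andP; split.
  apply: integral_gt0 => //; last by move=> w _; rewrite lte_fin expR_gt0.
  by apply/measurable_EFinP; exact: measurable_feature_factor.
have [h [C [h0 hP]]] := feature_energy_coercive.
have h2 : 0 < h / 2 by rewrite divr_gt0.
have /andP[_ goo] := @integral_gauss_mx R n p _ h2.
apply: (@le_lt_trans _ _ (\int[muX]_A ((expR (C / 2))%:E *
    (expR (- (h / 2 * sqnorm A)))%:E))%E).
  apply: ge0_integral_mono => A _; first by rewrite lee_fin expR_ge0.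
  rewrite -EFinM lee_fin -expRD ler_expR.
  by have := hP A; lra.
rewrite ge0_integralZl_EFin ?expR_ge0//.
- by rewrite lte_mul_pinfty ?lee_fin ?expR_ge0.
by apply/measurable_EFinP; exact: measurable_gauss_mx.
Qed.

Definition precision_energy (S : 'M[R]_m) : R := \tr (invmx S *m B0).

Lemma measurable_precision_energy : measurable_fun setT precision_energy.
Proof.
apply: measurable_fun_trace; apply: measurable_fun_mulmx => //.
exact: measurable_fun_invmx.
Qed.

(** [rho] bounds the entries of A, nu, theta and beta, [B] those of each residual, and [r / b] the
    trace of the inverse of [S]; [E] is the resulting bound on the energy. *)
Lemma coupling_bounded r : exists2 eps : R, 0 < eps & forall A w S, spd S ->
  precision_energy S <= r -> sqnorm A <= r -> block_sqnorm w <= r ->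
  eps <= coupling A w S.
Proof.
have [b b0 bP] := spd_trace_mul_ge spdB0.
pose rho := 1 + r.
pose B := rho + (\sum_i \sum_l rho * `|Z i l 0| + p%:R * rho ^+ 2).
pose E := n%:R * (m%:R ^+ 2 * (r / b) * B ^+ 2).
exists (expR (- (E / 2))); first exact: expR_gt0.
move=> A w S Ss Tr Ar wr.
rewrite /coupling ler_expR lerN2 ler_pM2r ?invr_gt0//.
have nu_le : sqnorm w.1.1 <= r.
  by have := sqnorm_ge0 w.1.2; have := sqnorm_ge0 w.2; move: wr;
    rewrite /block_sqnorm; lra.
have theta_le : sqnorm w.1.2 <= r.
  by have := sqnorm_ge0 w.1.1; have := sqnorm_ge0 w.2; move: wr;
    rewrite /block_sqnorm; lra.
have beta_le : sqnorm w.2 <= r.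
  by have := sqnorm_ge0 w.1.1; have := sqnorm_ge0 w.1.2; move: wr;
    rewrite /block_sqnorm; lra.
have rho0 : 0 <= rho.
  by have := sqnorm_ge0 w.2; rewrite /rho; lra.
have trS : \tr (invmx S) <= r / b.
  by rewrite ler_pdivlMr// mulrC (le_trans (bP _ (spd_inv Ss))).
have -> : E = \sum_(i < n) (m%:R ^+ 2 * (r / b) * B ^+ 2).
  by rewrite sumr_const card_ord -[RHS]mulr_natl.
apply: ler_sum => i _; apply: spd_qform_le => //; first exact: spd_inv.
have mB (X Y : 'cV[R]_m) l : (X - Y) l 0 = X l 0 - Y l 0 by rewrite !mxE.
have mD (X Y : 'cV[R]_m) l : (X + Y) l 0 = X l 0 + Y l 0 by rewrite !mxE.
move=> j; rewrite /residual mB (le_trans (ler_normB _ _))// lerD//.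
  by rewrite latent_responseE sqnorm_entry.
rewrite /regression_mean mD (le_trans (ler_normD _ _))// lerD//.
  rewrite mxE (le_trans (ler_norm_sum _ _ _))// [leRHS](bigD1 i)//=.
  rewrite -[leLHS]addr0 lerD//; last first.
    by apply: sumr_ge0 => l _; apply: sumr_ge0 => o _; rewrite mulr_ge0.
  apply: ler_sum => l _; rewrite normrM ler_wpM2r// !mxE.
  exact: sqnorm_entry.
rewrite mxE (le_trans (ler_norm_sum _ _ _))//.
have -> : p%:R * rho ^+ 2 = \sum_(l < p) rho ^+ 2.
  by rewrite sumr_const card_ord -[RHS]mulr_natl.
apply: ler_sum => l _; rewrite normrM expr2 ler_pM// !mxE; exact: sqnorm_entry.
Qed.

(** The change of the power of the determinant when Sigma is halved. *)
Definition Sigma_decay_const : R :=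
  ((2^-1 : R) ^+ m) `^ (- ((n + a0 + m + 1)%:R / 2)).

Lemma Sigma_decay c A w S r : 0 <= c -> r < precision_energy (2^-1 *: S) ->
  posterior_product c (A, w, 2^-1 *: S) <=
  Sigma_decay_const * expR (- (4^-1 * r)) * posterior_product c (A, w, S).
Proof.
move=> c0; rewrite /posterior_product /product_form /=.
(* Halving preserves the complement of the cone, where both sides are 0. *)
have [Ss|nSs] := pselect (spd S); last first.
  rewrite !Sigma_factor_notin ?mul0r ?mulr0// => hS; apply: nSs.
  by have := spdZ (ltr0Sn R 1) hS; rewrite scalerA divff ?scale1r// pnatr_eq0.
have Su := spd_unitmx Ss.
have hS : spd (2^-1 *: S) by apply: spdZ; rewrite ?invr_gt0.
have invE : invmx (2^-1 *: S) = 2 *: invmx S.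
  by rewrite invmxZ ?invrK// unitmxZ// unitfE invr_eq0 pnatr_eq0.
rewrite /precision_energy invE -scalemxAl mxtraceZ => rT.
rewrite /coupling coupling_energyZ ?invr_eq0 ?pnatr_eq0// invrK.
rewrite /Sigma_factor !indicE !mem_set// !mulr1 /inv_wishart_fun invE
  -scalemxAl mxtraceZ.
rewrite detZ powRM ?exprn_ge0 ?invr_ge0 ?(ltW (spd_det_gt0 Ss))//
  -/Sigma_decay_const.
have E0 : 0 <= coupling_energy A w S by exact: coupling_energy_ge0.
move: (coupling_energy A w S) E0 => E E0; move: (\tr _) rT => T rT.
set d := \det S `^ _; set bf := block_factor w; set ff := feature_factor A.
rewrite [leLHS](_ : _ = Sigma_decay_const * c * d * bf * ff *
  (expR (- (2 * T / 2)) * expR (- (2 * E / 2)))); last by ring.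
rewrite [leRHS](_ : _ = Sigma_decay_const * c * d * bf * ff *
  (expR (- (4^-1 * r)) * (expR (- (T / 2)) * expR (- (E / 2))))); last by ring.
rewrite ler_wpM2l; first by [].
  by rewrite !mulr_ge0// ?powR_ge0 ?expR_ge0.
(* Halving [S] replaces exp(- T/2 - E/2) by exp(- T - E). As r < 2 T, the gain T/2 exceeds r/4,
   whence the rate 1/4. *)
by rewrite -!expRD ler_expR; lra.
Qed.

Lemma block_decay : exists2 kappa : R, 0 < kappa &
  forall c A w S r, 0 <= c -> spd S ->
  r < block_sqnorm (block_scale 2 w) ->
  posterior_product c (A, block_scale 2 w, S) <=
  expR (block_const / 2) * expR (- (kappa * r)) * posterior_product c (A, w, S).
Proof.
have [h h0 hP] := block_quadratic_coercive.
(* By [block_energy_double] the exponent drops by at least the quadratic part, up to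
   [block_const / 2]; that part is at least [h] times the squared norm before doubling, which
   exceeds r / 4. *)
exists (h / 4); first by rewrite divr_gt0.
move=> c A w S r c0 Ss; rewrite /posterior_product /product_form /=.
have -> : block_sqnorm (block_scale 2 w) = 4 * block_sqnorm w.
  by rewrite /block_sqnorm /= !sqnormZ; ring.
move=> rw; rewrite /coupling coupling_energy_scale.
have E0 : 0 <= coupling_energy A w S by exact: coupling_energy_ge0.
have := block_energy_double w; have := hP w; have := block_energy_ge0 w.
rewrite /block_factor => Q0 hw dbl.
set sf := Sigma_factor c S; set ff := feature_factor A.
rewrite [leLHS](_ : _ =
  sf * ff * (expR (- (block_energy (block_scale 2 w) / 2)) *
  expR (- (2 ^+ 2 * coupling_energy A w S / 2)))); last by ring.
rewrite [leRHS](_ : _ =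
  sf * ff * (expR (block_const / 2) * expR (- (h / 4 * r)) *
  (expR (- (block_energy w / 2)) * expR (- (coupling_energy A w S / 2)))));
    last by ring.
rewrite ler_wpM2l; first by [].
  apply: mulr_ge0; last exact: expR_ge0.
  by rewrite /sf /Sigma_factor !mulr_ge0 ?indicE// ?powR_ge0 ?expR_ge0.
rewrite -!expRD ler_expR.
have hr : h * r < h * (4 * block_sqnorm w) by rewrite ltr_pM2l.
lra.
Qed.

Local Notation lam := (lebesgue_state R m n p q).

Lemma integral_posterior_product c : 0 < c ->
  (0 < \int[lam]_s (posterior_product c s)%:E < +oo)%E.
Proof.
move=> c0; apply: (@integral_product_form _ _ _ _ _ _ _ muX muY muS (@spd R m)).
- exact: measurable_spd.
- exact: measurable_Sigma_factor.
- exact: measurable_block_factor.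
- exact: measurable_feature_factor.
- exact: measurable_posterior_product.
- by move=> S; exact: Sigma_factor_gt0.
- exact: Sigma_factor_notin.
- by move=> w; exact: expR_gt0.
- by move=> A; exact: expR_gt0.
- by move=> A w S _; exact: expR_gt0.
- move=> A w S Ss; rewrite -expR0 ler_expR oppr_le0 divr_ge0//.
  exact: coupling_energy_ge0.
- exact: integral_Sigma_factor.
- exact: integral_block_factor.
- exact: integral_feature_factor.
Qed.

Lemma posterior_product_geometrically_ergodic c
  (Pi : set st -> \bar R) : 0 < c ->
  (\int[lam]_s (posterior_product c s)%:E = 1)%E ->
  (forall B, measurable B -> B `<=` state_space ->
     Pi B = (\int[lam]_(s in B) (posterior_product c s)%:E)%E) ->
  geometrically_ergodic state_space
    (gibbs_step muX muY muS (@spd R m) (posterior_product c)) Pi.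
Proof.
move=> c0 tot PiE; have [kappa kappa0 kP] := block_decay.
have e1 A w S : spd S -> coupling A w S <= 1.
  by move=> Ss; rewrite -expR0 ler_expR oppr_le0 divr_ge0// coupling_energy_ge0.
apply: (product_form_geometrically_ergodic (@measurable_spd R m)
  (measurable_Sigma_factor c) measurable_block_factor measurable_feature_factor
  (measurable_posterior_product c) (fun S => @Sigma_factor_gt0 c S c0)
  (@Sigma_factor_notin c) (fun w => expR_gt0 _) (fun A => expR_gt0 _)
  (fun A w S _ => expR_gt0 _) e1 (integral_Sigma_factor c0)
  integral_block_factor integral_feature_factor tot measurable_precision_energy
  (measurable_fun_sqnorm (@measurable_id _ 'M[R]_(n, p) setT))
  measurable_block_sqnorm coupling_bounded
  (phiS := fun S => 2^-1 *: S) (KS := 2^-1 ^+ #|{: sym_idx m}|)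
  (MS := Sigma_decay_const) (kS := 4^-1) (phiY := block_scale 2)
  (KY := 2 ^+ (m * n * 1) * (2 ^+ (m * q * 1) * 2 ^+ (m * p * 1)))
  (MY := expR (block_const / 2)) (kY := kappa)) => //.
- exact: powR_ge0.
- move=> h mh h0; rewrite (@integral_lebesgue_sym_affine _ _ 2^-1 0)//.
  + by congr (_ * _)%E; apply: eq_integral => S _; rewrite addr0.
  + by rewrite trmx0.
- by move=> A w S r; apply: Sigma_decay; exact: ltW.
- by move=> h mh h0; exact: integral_block_scale.
- by move=> A w S r Ss; apply: kP => //; exact: ltW.
Qed.

(** * The joint density and its proportionality constant *)

Definition normal_const d (C : 'M[R]_d) :
  R := (Num.sqrt ((2 * pi) ^+ d * \det C))^-1.

Lemma normal_const_gt0 d (C : 'M[R]_d) : spd C -> 0 < normal_const C.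
Proof.
move=> Cs; rewrite invr_gt0 sqrtr_gt0 mulr_gt0 ?spd_det_gt0// exprn_gt0//.
by rewrite mulr_gt0 ?pi_gt0.
Qed.

(** Isolates the determinant, the only part of the constant that varies when [C] is the parameter
    Sigma. *)
Lemma normal_constE d (C : 'M[R]_d) : spd C ->
  normal_const C = (Num.sqrt ((2 * pi) ^+ d))^-1 * \det C `^ (- 2^-1).
Proof.
move=> /spd_det_gt0/ltW C0; rewrite /normal_const sqrtrM; last first.
  by rewrite exprn_ge0// mulr_ge0 ?pi_ge0.
by rewrite invfM powRN powR12_sqrt.
Qed.

Lemma observation_factor (i : 'I_n) :
  exists2 c : R, 0 < c & forall (A : 'M[R]_(n, p)) (w : block)
    (S : 'M[R]_m), spd S ->
  normal_mx_pdf (latent_response w.1.1 i) (U i) (y i) *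
  normal_mx_pdf (regression_mean Z A w.1.2 w.2 i) S (latent_response w.1.1 i) *
  normal_mx_pdf (feature A i) (V i) (x i) *
  normal_mx_pdf (k i) (K i) (feature A i) =
  c * (\det S `^ (- 2^-1) * (expR (- (qform (invmx S) (residual A w i) / 2)) *
  (expR (- (qform (invmx (U i)) (latent_response w.1.1 i - y i) / 2)) *
  expR (- (qform (updated_precision V K i)
    (feature A i - updated_mean V k K x i) / 2))))).
Proof.
(* What completing the square leaves over; it depends on the data only. *)
pose c0 := qform (invmx (V i)) (x i) + qform (invmx (K i)) (k i) -
  qform (updated_precision V K i) (updated_mean V k K x i).
exists (normal_const (U i) * (Num.sqrt ((2 * pi) ^+ m))^-1 *
  normal_const (V i) *
  normal_const (K i) * expR (- (c0 / 2))).
  rewrite !mulr_gt0 ?normal_const_gt0 ?expR_gt0// invr_gt0 sqrtr_gt0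
    exprn_gt0//.
  by rewrite mulr_gt0 ?pi_gt0.
move=> A w S Ss; rewrite /normal_mx_pdf -!/(normal_const _) (normal_constE Ss).
rewrite -/(residual A w i) -(qformN _ (y i - _)) opprB.
have cs := qform_complete_square (x i) (k i) (feature A i) (spd_inv (spdV i))
  (spd_inv (spdK i)).
rewrite (_ : expR (- (qform (updated_precision V K i) _ / 2)) =
  expR (c0 / 2) * (expR (- (qform (invmx (V i)) (x i - feature A i) / 2)) *
    expR (- (qform (invmx (K i)) (feature A i - k i) / 2)))); last first.
  rewrite -!expRD; congr expR; rewrite /c0 /updated_precision /updated_mean.
  by move: cs => /=; rewrite /updated_precision; lra.
rewrite [expR (- (c0 / 2))]expRN; field.
by rewrite !gt_eqF ?expR_gt0// sqrtr_gt0 exprn_gt0// mulr_gt0 ?pi_gt0.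
Qed.

Lemma joint_pdfE : exists2 c : R, 0 < c & forall s : st, state_space s ->
  joint_pdf U V Z k K a0 B0 j0 J0 y x s = c * post s.
Proof.
have : forall i, exists c :
  R, 0 < c /\ forall (A : 'M[R]_(n, p)) (w : block) (S : 'M[R]_m), spd S ->
  normal_mx_pdf (latent_response w.1.1 i) (U i) (y i) *
  normal_mx_pdf (regression_mean Z A w.1.2 w.2 i) S (latent_response w.1.1 i) *
  normal_mx_pdf (feature A i) (V i) (x i) *
  normal_mx_pdf (k i) (K i) (feature A i) =
  c * (\det S `^ (- 2^-1) * (expR (- (qform (invmx S) (residual A w i) / 2)) *
  (expR (- (qform (invmx (U i)) (latent_response w.1.1 i - y i) / 2)) *
  expR (- (qform (updated_precision V K i)
    (feature A i - updated_mean V k K x i) / 2))))).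
  by move=> i; have [c c0 cP] := observation_factor i; exists c.
move=> /choice[c cP].
have /andP[W0 Woo] := @integral_inv_wishart_fun R m a0 B0 a0_ge spdB0.
pose W := fine (\int[muS]_(S in @spd R m) (inv_wishart_fun a0 B0 S)%:E)%E.
have Wgt0 : 0 < W by rewrite fine_gt0// W0.
exists ((\prod_(i < n) c i) * W^-1 * normal_const J0).
  apply: mulr_gt0; last exact: normal_const_gt0.
  apply: mulr_gt0; last by rewrite invr_gt0.
  by apply: prodr_gt0 => i _; case: (cP i).
move=> [[A [[nu theta] beta]] S] /= Ss.
pose w : block := (nu, theta, beta).
have d0 := spd_det_gt0 Ss.
under eq_bigr do rewrite (proj2 (cP _) A w S Ss).
rewrite !big_split /= prodr_const card_ord -!expR_sum.
rewrite /inv_wishart_pdf -/W /normal_mx_pdf -/(normal_const J0)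
  /inv_wishart_fun.
(* Each observation contributes one factor det^(-1/2), which turns the prior degree [a0] into
   [n + a0]. *)
have -> : \det S `^ (- ((n + a0 + m + 1)%:R / 2)) =
    \det S `^ (- 2^-1) ^+ n * \det S `^ (- ((a0 + m + 1)%:R / 2)).
  rewrite -powR_mulrn ?powR_ge0// -powRrM -powRD;
    last by rewrite (gt_eqF d0) implybT.
  by congr (_ `^ _); rewrite -!addnA natrD; lra.
rewrite !expRD.
have sE (F : 'I_n -> R) :
  expR (\sum_(i < n) - (F i / 2)) = expR (- (\sum_(i < n) F i) / 2).
  by rewrite sumrN -mulr_suml mulNr.
rewrite !sE !mulNr; rewrite /residual /=.
by ring.
Qed.

End posterior_factors.

(** The kernel evaluates the density only at SPD values of Sigma, so the posterior may be replaced
    by a version that vanishes off the cone. *)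
Lemma eq_gibbs_kernel (R : realType) (m n p q : nat)
  (f g : state R m n p q -> R) :
  (forall s, state_space s -> f s = g s) ->
  gibbs_kernel f = gibbs_step (lebesgue_mx R n p) (lebesgue_block R m n p q)
    (lebesgue_sym R m) (@spd R m) g.
Proof.
move=> fg; apply/funext => -[[A w] S0]; apply/funext => B.
rewrite /gibbs_kernel /gibbs_step.
have fgS A' w' S : spd S -> f (A', w', S) = g (A', w', S)
  by move=> Ss; exact: fg.
apply: eq_integral => S /set_mem Ss.
have E1 : cond_Sigma f A w S = g (A, w, S) / margS (lebesgue_sym R m)
  (@spd R m) g A w.
  rewrite /cond_Sigma /margS fgS//; congr (_ / fine _).
  by apply: eq_integral => T /set_mem Ts; rewrite fgS.
rewrite E1.
apply: (congr1 (mule _)).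
apply: eq_integral => w' _.
have E2 : cond_block f A S w' = g (A, w', S) / margY
  (lebesgue_block R m n p q) g A S.
  rewrite /cond_block /margY fgS//; congr (_ / fine _).
  by apply: eq_integral => w'' _; rewrite fgS.
rewrite E2.
apply: (congr1 (mule _)).
apply: eq_integral => A' _.
have E3 : cond_A f w' S A' = g (A', w', S) / margX (lebesgue_mx R n p) g w' S.
  rewrite /cond_A /margX fgS//; congr (_ / fine _).
  by apply: eq_integral => A'' _; rewrite fgS.
by rewrite E3.
Qed.

Unset Implicit Arguments.
Set Strict Implicit.
Set Printing Implicit Defensive.

Theorem corollary4 (R : realType) (m n p q : nat)
  (m_gt0 : (0 < m)%N) (n_gt0 : (0 < n)%N) (p_gt0 : (0 < p)%N) (q_gt0 : (0 < q)%N)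
  (U : 'I_n -> 'M[R]_m) (V : 'I_n -> 'M[R]_p) (Z : 'I_n -> 'cV[R]_q)
  (k : 'I_n -> 'cV[R]_p) (K : 'I_n -> 'M[R]_p)
  (a0 : nat) (B0 : 'M[R]_m)
  (j0 : 'cV[R]_(m * q + m * p)) (J0 : 'M[R]_(m * q + m * p))
  (spdU : forall i, spd (U i)) (spdV : forall i, spd (V i))
  (spdK : forall i, spd (K i))
  (a0_ge : (m <= a0)%N) (spdB0 : spd B0) (spdJ0 : spd J0)
  (y : 'I_n -> 'cV[R]_m) (x : 'I_n -> 'cV[R]_p) :
  let pi_n := posterior_pdf U V Z k K a0 B0 j0 J0 y x in
  (exists2 c : R, 0 < c & forall s, state_space s ->
     pi_n s = c * posterior_fun U V Z k K a0 B0 j0 J0 y x s) /\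
  geometrically_ergodic state_space (gibbs_kernel pi_n) (target_measure pi_n).
Proof.
move=> pi_n.
pose post := posterior_fun U V Z k K a0 B0 j0 J0 y x.
pose prod := posterior_product U V Z k K a0 B0 j0 J0 y x.
pose lam := lebesgue_state R m n p q.
have prodE c s : state_space s -> prod c s = c * post s
  by exact: posterior_productE.
have mE : measurable (@state_space R m n p q).
  rewrite -[X in measurable X]setTI.
  have ms : measurable_fun setT (fun s : state R m n p q => s.2)
    by exact: measurable_snd.
  exact: (ms measurableT _ (@measurable_spd R m)).
have off c s : ~ state_space s -> prod c s = 0.
  case: s => -[A w] S nSs; rewrite /prod /posterior_product /product_form /=.
  by rewrite Sigma_factor_notin ?mul0r.
have prodM c1 c s : prod (c1 * c) s = c1 * prod c s.
  have [Es|nEs] := pselect (state_space s); last by rewrite !off ?mulr0.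
  by rewrite !prodE// mulrA.
have mprod c : measurable_fun setT (prod c)
  by exact: measurable_posterior_product.
have prodT c : (\int[lam]_(s in state_space) (prod c s)%:E =
  \int[lam]_s (prod c s)%:E)%E.
  rewrite integral_mkcond; apply: eq_integral => s _; rewrite patchE.
  by case: ifPn => // /negP nEs; rewrite off// => Es; apply: nEs; rewrite inE.
have [c1 c10 jointE] := joint_pdfE Z k j0 y x spdU spdV spdK a0_ge spdB0 spdJ0.
have /andP[I0 Ioo] := integral_posterior_product Z k j0 y x spdU spdV spdK a0_ge
  spdB0 spdJ0 c10.
pose I := fine (\int[lam]_s (prod c1 s)%:E)%E.
have IE : (\int[lam]_s (prod c1 s)%:E = I%:E)%E
  by rewrite fineK// ge0_fin_numE// ltW.
have Igt0 : 0 < I by rewrite -lte_fin -IE.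
(* [c1] comes from the joint density and [I] is its integral. *)
have piE s : state_space s -> pi_n s = c1 / I * post s.
  move=> Es; rewrite /pi_n /posterior_pdf jointE// mulrAC; congr (_ / _ * _).
  rewrite /I -prodT; congr fine; apply: eq_integral => s' /set_mem Es'.
  by rewrite jointE// prodE.
have c0 : 0 < c1 / I by rewrite divr_gt0.
have piE' s : state_space s -> pi_n s = prod (c1 / I) s
  by move=> Es; rewrite piE// prodE.
split; first by exists (c1 / I).
rewrite (eq_gibbs_kernel piE').
apply: posterior_product_geometrically_ergodic => //.
  (* Total mass 1: the factor 1 / I is taken out of the integral, which leaves [I]. *)
  rewrite -/lam -/prod; under eq_integral do rewrite mulrC prodM EFinM.
  rewrite ge0_integralZl_EFin//; last 3 first.
  - move=> s _; rewrite lee_fin; have [Es|nEs] := pselect (state_space s);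
      last by rewrite off.
    rewrite prodE// mulr_ge0 ?(ltW c10)//;
      case: s Es => -[A [[nu theta] beta]] S _.
    by rewrite /post /posterior_fun !mulr_ge0 ?powR_ge0 ?expR_ge0.
  - exact/measurable_EFinP.
  - by rewrite invr_ge0 ltW.
  by rewrite IE -EFinM mulVf// gt_eqF.
move=> B mB BE; rewrite /target_measure setIidr//.
by apply: eq_integral => s /set_mem Bs; rewrite piE'//; exact: BE.
Qed.
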